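(* Let $n\geq 4$ and $k\geq1$ be integers, and let $u=(u_{ij})$ be the fundamental corepresentation of $A_s(n)$, with Haar state denoted $\int$. Then for all multi-indices $i=(i_1,\ldots,i_k)$, $j=(j_1,\ldots,j_k)$ in $\{1,\ldots,n\}^k$, $$\int u_{i_1j_1}\cdots u_{i_kj_k}=\sum_{p,q\in NC(k)}\delta_{pi}\,\delta_{qj}\,W_{kn}(p,q),$$ where $W_{kn}=G_{kn}^{-1}$.
   Context: A magic unitary is a square matrix over a C*-algebra whose entries are projections such that the entries of each row and of each column are mutually orthogonal and sum to $1$. $A_s(n)$ is the universal C*-algebra generated by $n^2$ elements $u_{ij}$ subject to the relations making $u=(u_{ij})$ a magic unitary; it is a compact quantum group with comultiplication $\Delta(u_{ij})=\sum_k u_{ik}\otimes u_{kj}$, counit $\varepsilon(u_{ij})=\delta_{ij}$, antipode $S(u_{ij})=u_{ji}$, and $u$ is its fundamental corepresentation. The Haar state $\int$ is the unique state $h$ on $A_s(n)$ with $(h\otimes \mathrm{id})\Delta=(\mathrm{id}\otimes h)\Delta=h(\cdot)1$. $NC(k)$ is the set of non-crossing partitions of $\{1,\ldots,k\}$; for $p\in NC(k)$, $|p|$ is its number of blocks, and $p\vee q$ is the join (finest partition, in the lattice of all partitions, coarser than both $p$ and $q$). For a multi-index $i$, $\delta_{pi}=1$ if $i$ is constant on every block of $p$, and $0$ otherwise. The Gram matrix $G_{kn}$ is the $NC(k)\times NC(k)$ matrix $G_{kn}(p,q)=n^{|p\vee q|}$, and the Weingarten matrix is $W_{kn}=G_{kn}^{-1}$.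 *)

(* Defs.v *)
From HB Require Import structures.
From mathcomp Require Import all_boot all_order all_algebra.
From mathcomp Require Import reals complex.

Set Implicit Arguments.
Unset Strict Implicit.
Unset Printing Implicit Defensive.

Import Order.TTheory GRing.Theory Num.Theory.

Local Open Scope ring_scope.
Local Open Scope complex_scope.

(* Unital C*-algebras over the complex numbers R[i].  The norm is a field of
   the mixin because Hierarchy Builder cannot join the ring structure with
   completeNormedModType: that join would have to sit below numDomainType.
   Algebras in the library are nonzero, so 1 != 0 here. *)
HB.mixin Record isCStarAlgebra (R : realType) A & GRing.Algebra R[i] A := {
  star : A -> A ;
  cnorm : A -> R ;
  starD : forall a b : A, star (a + b) = star a + star b ;
  starZ : forall (c : R[i]) (a : A), star (c *: a) = c^* *: star a ;
  starM : forall a b : A, star (a * b) = star b * star a ;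
  starK : forall a : A, star (star a) = a ;
  cnorm_eq0 : forall a : A, cnorm a = 0 -> a = 0 ;
  cnormD : forall a b : A, cnorm (a + b) <= cnorm a + cnorm b ;
  cnormZ : forall (c : R[i]) (a : A),
    cnorm (c *: a) = Normc.normc c * cnorm a ;
  cnormM : forall a b : A, cnorm (a * b) <= cnorm a * cnorm b ;
  cnorm_star : forall a : A, cnorm (star a * a) = cnorm a ^+ 2 ;
  cnorm_complete : forall x : nat -> A,
    (forall e : R, 0 < e -> exists N : nat, forall m n : nat,
       (N <= m)%N -> (N <= n)%N -> cnorm (x m - x n) < e) ->
    exists l : A, forall e : R, 0 < e -> exists N : nat, forall n : nat,
       (N <= n)%N -> cnorm (x n - l) < e
}.

#[short(type="cstarAlgType")]
HB.structure Definition CStarAlgebra (R : realType) :=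
  { A of isCStarAlgebra R A & GRing.Algebra R[i] A }.

Definition star_preserving (R : realType) (A B : cstarAlgType R) (f : A -> B) :=
  forall a : A, f (star a) = star (f a).

Definition bounded_map (R : realType) (A B : cstarAlgType R) (f : A -> B) :=
  exists M : R, forall a : A, cnorm (f a) <= M * cnorm a.

Definition is_projection (R : realType) (A : cstarAlgType R) (a : A) :=
  a * a = a /\ star a = a.

Definition magic_unitary (R : realType) (A : cstarAlgType R) (n : nat)
    (u : 'M[A]_n) :=
  [/\ forall i j, is_projection (u i j),
      forall i j j', j != j' -> u i j * u i j' = 0,
      forall i i' j, i != i' -> u i j * u i' j = 0,
      forall i, \sum_j u i j = 1
    & forall j, \sum_i u i j = 1].

(* (A, u) is A_s(n) with its fundamental corepresentation: the initial
   C*-algebra carrying an n x n magic unitary. *)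
Definition is_quantum_permutation_algebra (R : realType) (n : nat)
    (A : cstarAlgType R) (u : 'M[A]_n) :=
  magic_unitary u /\
  forall (B : cstarAlgType R) (v : 'M[B]_n), magic_unitary v ->
    (exists f : {lrmorphism A -> B},
       star_preserving f /\ forall i j, f (u i j) = v i j) /\
    (forall f g : {lrmorphism A -> B},
       star_preserving f -> star_preserving g ->
       (forall i j, f (u i j) = v i j) -> (forall i j, g (u i j) = v i j) ->
       f =1 g).

Definition lin_indep (R : realType) (A : cstarAlgType R) (m : nat)
    (a : 'I_m -> A) :=
  forall c : 'I_m -> R[i], \sum_s c s *: a s = 0 -> forall s, c s = 0.

(* T is the completion of the algebraic tensor product of the *-algebras A and
   B for some C*-norm, with tens a b the elementary tensor; the last but one
   clause is injectivity of the algebraic tensor product into T. *)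
Definition is_cstar_tensor (R : realType) (A B T : cstarAlgType R)
    (tens : A -> B -> T) :=
  [/\ (forall b : B, linear (fun a : A => tens a b)) /\
      (forall a : A, linear (tens a)),
      tens 1 1 = 1 /\
      (forall a a' b b', tens a b * tens a' b' = tens (a * a') (b * b')),
      forall a b, star (tens a b) = tens (star a) (star b),
      forall (m : nat) (a : 'I_m -> A) (b : 'I_m -> B), lin_indep a ->
        \sum_s tens (a s) (b s) = 0 -> forall s, b s = 0
    & forall (t : T) (e : R), 0 < e ->
        exists (m : nat) (a : 'I_m -> A) (b : 'I_m -> B),
          cnorm (t - \sum_s tens (a s) (b s)) < e].

(* The minimal (spatial) tensor product: the completion for the least C*-norm
   on the algebraic tensor product. *)
Definition is_min_tensor (R : realType) (A B T : cstarAlgType R)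
    (tens : A -> B -> T) :=
  is_cstar_tensor tens /\
  forall (T' : cstarAlgType R) (tens' : A -> B -> T'), is_cstar_tensor tens' ->
    forall (m : nat) (a : 'I_m -> A) (b : 'I_m -> B),
      cnorm (\sum_s tens (a s) (b s)) <= cnorm (\sum_s tens' (a s) (b s)).

Definition is_comultiplication (R : realType) (n : nat) (A T : cstarAlgType R)
    (u : 'M[A]_n) (tens : A -> A -> T) (Delta : {lrmorphism A -> T}) :=
  star_preserving Delta /\
  forall i j, Delta (u i j) = \sum_l tens (u i l) (u l j).

Definition is_state (R : realType) (A : cstarAlgType R) (h : {scalar A}) :=
  h 1 = 1 /\ forall a : A, 0 <= h (star a * a).

(* S is h (x) id, resp. id (x) h, followed by the identification of
   R[i] (x) A, resp. A (x) R[i], with A. *)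
Definition is_left_slice (R : realType) (A T : cstarAlgType R)
    (tens : A -> A -> T) (h : {scalar A}) (S : {linear T -> A}) :=
  bounded_map S /\ forall a b : A, S (tens a b) = h a *: b.

Definition is_right_slice (R : realType) (A T : cstarAlgType R)
    (tens : A -> A -> T) (h : {scalar A}) (S : {linear T -> A}) :=
  bounded_map S /\ forall a b : A, S (tens a b) = h b *: a.

Definition is_haar_state (R : realType) (A T : cstarAlgType R)
    (tens : A -> A -> T) (Delta : {lrmorphism A -> T}) (h : {scalar A}) :=
  [/\ is_state h,
      exists S : {linear T -> A}, is_left_slice tens h S /\
        forall a : A, S (Delta a) = (h a)%:A
    & exists S : {linear T -> A}, is_right_slice tens h S /\
        forall a : A, S (Delta a) = (h a)%:A].

Section Partitions.
Variable k : nat.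
Implicit Types (p q r s : {set {set 'I_k}}).

Definition is_part p : bool := partition p [set: 'I_k].

Definition noncrossing p : bool :=
  [forall B in p, forall B' in p, (B != B') ==>
     ~~ [exists a in B, exists b in B', exists c in B, exists d in B',
           [&& (a < b)%N, (b < c)%N & (c < d)%N]]].

Definition coarser r p : bool := [forall B in p, exists B' in r, B \subset B'].

Definition is_join p q r : bool :=
  [&& is_part r, coarser r p, coarser r q
    & [forall s, [&& is_part s, coarser s p & coarser s q] ==> coarser s r]].

Definition pjoin p q : {set {set 'I_k}} := odflt set0 [pick r | is_join p q r].

Lemma coarser_anti r s :
  is_part r -> is_part s -> coarser r s -> coarser s r -> r = s.
Proof.
suff sub x y : is_part x -> is_part y -> coarser x y -> coarser y x ->
    {subset x <= y}.
  by move=> Pr Ps rs sr; apply/setP => B; apply/idP/idP; apply: sub.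
move=> Px _ /forall_inP xy /forall_inP yx B Bx.
have /exists_inP[C Cy BC] := yx _ Bx; have /exists_inP[D Dx CD] := xy _ Cy.
have [_ /trivIsetP tx x0] := and3P Px.
have/set0Pn[z zB] : B != set0 by apply: contraNneq x0 => <-.
have BD : B = D.
  apply/eqP/negP => /negP /(tx _ _ Bx Dx) /pred0P /(_ z) /=.
  by rewrite zB (subsetP CD) // (subsetP BC).
by rewrite (_ : B = C) //; apply/eqP; rewrite eqEsubset BC BD CD.
Qed.

Lemma is_join_uniq p q r s : is_join p q r -> is_join p q s -> r = s.
Proof.
move=> /and4P[Pr rp rq /forallP rmin] /and4P[Ps sp sq /forallP smin].
apply: coarser_anti => //.
  by have /implyP := smin r; apply; rewrite Pr rp.
by have /implyP := rmin s; apply; rewrite Ps sp.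
Qed.

Lemma is_join_exists p q :
  is_part p -> is_part q -> exists r, is_join p q r.
Proof.
move=> Pp Pq; pose ub s := [&& is_part s, coarser s p & coarser s q].
pose E x y := [forall s, ub s ==> (pblock s x == pblock s y)].
have eqE : {in [set: 'I_k] & &, equivalence_rel E}.
  move=> x y z _ _ _; split; first by apply/forall_inP.
  move=> /forall_inP xy; apply/forall_inP/forall_inP => H s us.
    by rewrite -(eqP (xy s us)) H.
  by rewrite (eqP (xy s us)) H.
pose r := equivalence_partition E [set: 'I_k].
have Pr : is_part r := equivalence_partitionP eqE.
have crP t : is_part t -> (forall s, ub s -> coarser s t) -> coarser r t.
  move=> Pt st; apply/forall_inP => B Bt.
  have [_ _ t0] := and3P Pt.
  have/set0Pn[x xB] : B != set0 by apply: contraNneq t0 => <-.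
  have cr : cover r = setT by apply/eqP; have [] := and3P Pr.
  apply/exists_inP; exists (pblock r x); first by rewrite pblock_mem // cr inE.
  apply/subsetP => y yB; rewrite pblock_equivalence_partition ?inE //.
  apply/forall_inP => s us; have /forall_inP/(_ _ Bt) := st s us.
  case/exists_inP => C Cs /subsetP BC; have /and3P[/and3P[_ ts _] _ _] := us.
  by rewrite (def_pblock ts Cs (BC _ xB)) (def_pblock ts Cs (BC _ yB)).
exists r; rewrite /is_join Pr !crP //=; first last.
- by move=> s /and3P[].
- by move=> s /and3P[].
apply/forall_inP => s us; apply/forall_inP => B Br.
have [_ tr r0] := and3P Pr; have /and3P[/and3P[/eqP cs ts _] _ _] := us.
have/set0Pn[x xB] : B != set0 by apply: contraNneq r0 => <-.
apply/exists_inP; exists (pblock s x); first by rewrite pblock_mem // cs inE.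
apply/subsetP => y; rewrite -(def_pblock tr Br xB).
rewrite pblock_equivalence_partition ?inE // => /forall_inP/(_ s us)/eqP ->.
by rewrite mem_pblock cs inE.
Qed.

(* The default value set0 in pjoin is never reached on partitions. *)
Lemma pjoinP p q : is_part p -> is_part q -> is_join p q (pjoin p q).
Proof.
move=> Pp Pq; rewrite /pjoin; case: pickP => [r //|no].
by have [r] := is_join_exists Pp Pq; rewrite no.
Qed.

Definition NC := {p : {set {set 'I_k}} | is_part p && noncrossing p}.

End Partitions.

Definition gram (R : realType) (k n : nat) : 'M[R[i]]_#|{: NC k}| :=
  \matrix_(a, b) (n%:R ^+ #|pjoin (val (enum_val a)) (val (enum_val b))|).

Definition weingarten (R : realType) (k n : nat) (p q : NC k) : R[i] :=
  invmx (gram R k n) (enum_rank p) (enum_rank q).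

Definition pdelta (R : realType) (k n : nat) (p : NC k)
    (i : {ffun 'I_k -> 'I_n}) : R[i] :=
  [forall B in val p, forall s in B, forall t in B, i s == i t]%:R.

(* Main.v *)
From HB Require Import structures.
Require Import Defs.
From mathcomp Require Import all_boot all_order all_algebra.
From mathcomp Require classical_sets.
From mathcomp Require Import boolp reals complex zify ring lra.

(**
Let NC be the span of the tensors of noncrossing partitions of {1..k}, and Q the
orthogonal projection onto it; once the Gram matrix is invertible, the right-hand
side of the Weingarten formula is the entry Q(i,j).

Invertibility.  Let U_1..U_4 be the real Pauli matrices.  Averaging over U_x turns
the tensor of p into the functional a_1..a_k |-> prod_B tr(prod_(s in B) a_s) on
2x2 matrices.  On matrix units this is a noncrossing pairing of 2k points evaluated
on a word in two letters, and it is triangular for the lexicographic order, the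
leading word recording which points open and which points close a pair.

Integration.  Put P(i,j) = h(u_(i1 j1) .. u_(ik jk)).  The magic relations give
u_k xi_p = xi_p for p noncrossing, hence P Q = Q.  Left invariance of h gives the
relation P u_k = P in A, and P Q = P follows once it may be evaluated at a linear
functional with moments Q on a quotient of A.  Since A is universal, it suffices to
build a magic unitary in some C*-algebra with a vector functional having moments
Q.  This is a GNS construction on words: the magic relations hold because NC is
stable under doubling, merging, inserting and summing out letters, and positivity
is the complete positivity of the orthogonal projection onto the *-algebra of
noncrossing intertwiners.
*)

Set Implicit Arguments.
Unset Strict Implicit.
Unset Printing Implicit Defensive.
Import Order.TTheory GRing.Theory Num.Theory.
Local Open Scope ring_scope.

(** * Planar tensors *)

(** The bound n >= 4 enters through invertibility. A noncrossing partition of k points is a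
    noncrossing pairing of 2k points with loop value the square root of n, and the four Pauli
    matrices realise the loop value 2 on 2x2 matrices; further letters are sent to 0, so that one
    family serves every n >= 4. The obstacle in the integration is that A is known only by its
    universal property, so coefficients of products of generators cannot be compared inside A. A
    functional with computed moments has to be brought in from outside, and the Haar state cannot
    serve since its moments are what is sought. The candidate moments are therefore imposed, and
    their positivity is proved by linear algebra: once row words are bent around, the matrix of the
    moments of w^* w' is the Choi matrix of the projection Q. Bounding the length of words puts this
    in a finite matrix algebra E, where the Choi matrix is compared with multiplication by one
    positive invertible element of the commutant of E. *)

Section ListSurgery.
Variables (X : Type) (x0 : X).
Implicit Types (s i : nat) (l : seq X).

Definition del s l := take s l ++ drop s.+1 l.
Definition dup s l := take s.+1 l ++ drop s l.
Definition inj s x l := take s l ++ x :: drop s l.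

Lemma size_del s l : (s < size l)%N -> size (del s l) = (size l).-1.
Proof. rewrite /del size_cat size_take size_drop => h; rewrite h; lia. Qed.

Lemma size_dup s l : (s < size l)%N -> size (dup s l) = (size l).+1.
Proof. rewrite /dup size_cat size_take_min size_drop; lia. Qed.

Lemma size_inj s x l : (s <= size l)%N -> size (inj s x l) = (size l).+1.
Proof. rewrite /inj size_cat size_take_min /= size_drop; lia. Qed.

Lemma nth_del s l i : (s < size l)%N ->
  nth x0 (del s l) i = nth x0 l (bump s i).
Proof.
move=> h; rewrite /del nth_cat size_take_min nth_drop /bump.
case: ltnP => hi; first by rewrite nth_take; [congr nth|]; lia.
by congr nth; lia.
Qed.

Lemma nth_dup s l i : (s < size l)%N ->
  nth x0 (dup s l) i = nth x0 l (if (i <= s)%N then i else i.-1).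
Proof.
move=> h; rewrite /dup nth_cat size_take_min nth_drop.
case: ltnP => hi; first by rewrite nth_take; [congr nth; case: ifP|]; lia.
by congr nth; case: ifP; lia.
Qed.

Lemma nth_inj s x l i : (s <= size l)%N ->
  nth x0 (inj s x l) i = if (i == s)%N then x else nth x0 l (unbump s i).
Proof.
move=> h; rewrite /inj nth_cat size_take_min /unbump.
case: ltnP => hi.
  by rewrite ifF ?nth_take; [congr nth| |]; lia.
case: eqP => [->|hn]; first by rewrite (_ : (s - _)%N = 0%N) //; lia.
rewrite (_ : (i - minn s (size l))%N = (i - s.+1).+1); last by lia.
by rewrite /= nth_drop; congr nth; lia.
Qed.

Lemma split_size a b (l : seq X) : size l = (a + b)%N ->
  exists u v, [/\ l = u ++ v, size u = a & size v = b].
Proof.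
move=> h; exists (take a l), (drop a l).
by rewrite cat_take_drop size_take_min size_drop; split=> //; lia.
Qed.

Lemma del_catr s (u v : seq X) : del (size u + s) (u ++ v) = u ++ del s v.
Proof.
rewrite /del take_cat drop_cat !ifF; try lia.
by rewrite -addnS !(addnC (size u)) !addnK -catA.
Qed.

Lemma dup_inj (w z : seq X) x :
  dup (size w) (inj (size w) x (w ++ z)) = w ++ x :: x :: z.
Proof.
rewrite /inj take_size_cat // drop_size_cat // /dup drop_size_cat //.
by rewrite (_ : w ++ x :: z = rcons w x ++ z) ?take_size_cat ?size_rcons ?cat_rcons.
Qed.

End ListSurgery.

Section Tensors.
Variables (C : numClosedFieldType) (X : finType) (x0 : X).
Implicit Types (f g : seq X -> C) (k s : nat) (l : seq X).

(** [ins] adds an isolated point and [fork] doubles a point within its block; [tsum] and [tmerge]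
    are their transposes for the bilinear pairing that sums [f l * g l] over words. *)
Definition ins s f l := f (del s l).
Definition fork s f l := (nth x0 l s == nth x0 l s.+1)%:R * f (del s.+1 l).
Definition tmerge s f l := f (dup s l).
Definition tsum s f l := \sum_x f (inj s x l).

(* A tensor of order k is a function on words of which only the values on words
   of length k matter.  Inserting a singleton and doubling a point generate all
   noncrossing partitions. *)
Inductive planar : nat -> (seq X -> C) -> Prop :=
| planar_one : planar 0 (fun=> 1)
| planar_ins k s f : (s <= k)%N -> planar k f -> planar k.+1 (ins s f)
| planar_fork k s f : (s < k)%N -> planar k f -> planar k.+1 (fork s f)
| planar_lin k (c : C) f g :
    planar k f -> planar k g -> planar k (fun l => c * f l + g l)
| planar_zero k : planar k (fun=> 0)
| planar_ext k f g : (forall l, size l = k -> f l = g l) ->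
    planar k f -> planar k g.

Lemma planarZ k c f : planar k f -> planar k (fun l => c * f l).
Proof.
move=> fk; apply: planar_ext (planar_lin c fk (planar_zero k)) => l _.
by rewrite addr0.
Qed.

Lemma planarD k f g : planar k f -> planar k g -> planar k (fun l => f l + g l).
Proof.
by move=> fk gk; apply: planar_ext (planar_lin 1 fk gk) => l _; rewrite mul1r.
Qed.

Lemma planar_sum k (I : Type) (r : seq I) (P : pred I) (F : I -> seq X -> C) :
  (forall i, P i -> planar k (F i)) ->
  planar k (fun l => \sum_(i <- r | P i) F i l).
Proof.
move=> FP; elim: r => [|i r IH].
  by apply: planar_ext (planar_zero k) => l _; rewrite big_nil.
have [Pi|nPi] := boolP (P i).
  by apply: planar_ext (planarD (FP _ Pi) IH) => l _; rewrite big_cons Pi.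
by apply: planar_ext IH => l _; rewrite big_cons (negbTE nPi).
Qed.

Ltac natcases := rewrite /bump /unbump; repeat (case: ifP => ?);
  solve [by [] | lia | congr nth; lia].

Ltac listeq :=
  apply: (@eq_from_nth _ x0) => [|i hi];
  rewrite ?(size_del, size_dup, size_inj); try lia;
  rewrite ?(nth_del, nth_dup, nth_inj) ?(size_del, size_dup, size_inj);
  try lia.

(** Merging commutes, up to a shift of positions, with the last generator applied to [f], unless it
    involves a point just inserted or exactly the two points just doubled; then the two operations
    cancel. *)
Lemma planar_merge k f : planar k f ->
  forall s, (s.+1 < k)%N -> planar k.-1 (tmerge s f).
Proof.
elim=> {k f} [//|k t f tk fP IH|k t f tk fP IH|k c f g fP IHf gP IHg|k|
  k f g fg fP IH] s sk /=.
- have [ts|ts|ts] := ltngtP t s.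
  + have -> : k = k.-1.+1 by lia.
    apply: planar_ext (planar_ins (s := t) _ (IH s.-1 _)); try lia.
    move=> l lk; rewrite /ins /tmerge; congr f; listeq.
    natcases.
  + have [->|ts'] := eqVneq t s.+1.
      apply: planar_ext fP => l lk; rewrite /tmerge /ins; congr f; listeq.
      natcases.
    have -> : k = k.-1.+1 by lia.
    apply: planar_ext (planar_ins (s := t.-1) _ (IH s _)); try lia.
    move=> l lk; rewrite /ins /tmerge; congr f; listeq.
    natcases.
  + apply: planar_ext fP => l lk; rewrite /tmerge /ins; congr f; listeq.
    natcases.
- have [ts|ts|ts] := ltngtP t s.
  + have -> : k = k.-1.+1 by lia.
    apply: planar_ext (planar_fork (s := t) _ (IH s.-1 _)); try lia.
    move=> l lk; rewrite /fork /tmerge.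
    rewrite !nth_dup; try lia.
    rewrite (ltnW ts) ts; case: eqP => [e|_]; last by rewrite !mul0r.
    congr (_ * f _); listeq.
    (* The two index maps can disagree only for [s = t.+1], where they choose between the letters at
       [t] and [t.+1]; the fork makes these equal. *)
    have [->|it] := eqVneq i t.+1; last by natcases.
    have [st|st] := eqVneq s t.+1; last by natcases.
    have E a b : (t <= a <= t.+1)%N -> (t <= b <= t.+1)%N ->
        nth x0 l a = nth x0 l b.
      move=> ha hb; have [->|->] : a = t \/ a = t.+1 by lia.
        by have [->|->] : b = t \/ b = t.+1 by lia.
      by have [->|->] : b = t \/ b = t.+1 by lia.
    by apply: E; rewrite /bump; repeat (case: ifP => ?); lia.
  + have -> : k = k.-1.+1 by lia.
    apply: planar_ext (planar_fork (s := t.-1) _ (IH s _)); try lia.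
    move=> l lk; rewrite /fork /tmerge; congr (_ * f _).
      rewrite !nth_dup; try lia.
      by congr (_ == _)%:R; natcases.
    listeq; natcases.
  + apply: planar_ext fP => l lk; rewrite /tmerge /fork.
    rewrite !nth_dup; try lia.
    rewrite ts leqnn ltnn eqxx mul1r; congr f; listeq.
    natcases.
- by apply: planar_lin; [apply: IHf|apply: IHg].
- exact: planar_zero.
- by apply: planar_ext (IH s sk) => l lk; apply: fg; rewrite size_dup; lia.
Qed.

(** Besides commutations the induction meets two cancellations: summing out an inserted point gives
    the scalar [#|X|], and summing out either of two doubled points undoes the doubling. *)
Lemma planar_tsum k f : planar k f ->
  forall s, (s < k)%N -> planar k.-1 (tsum s f).
Proof.
elim=> {k f} [//|k t f tk fP IH|k t f tk fP IH|k c f g fP IHf gP IHg|k|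
  k f g fg fP IH] s sk /=.
- have [ts|ts|ts] := ltngtP t s.
  + have -> : k = k.-1.+1 by lia.
    apply: planar_ext (planar_ins (s := t) _ (IH s.-1 _)); try lia.
    move=> l lk; rewrite /ins /tsum; apply: eq_bigr => x _; congr f; listeq.
    natcases.
  + have -> : k = k.-1.+1 by lia.
    apply: planar_ext (planar_ins (s := t.-1) _ (IH s _)); try lia.
    move=> l lk; rewrite /ins /tsum; apply: eq_bigr => x _; congr f; listeq.
    natcases.
  + apply: planar_ext (planarZ #|X|%:R fP) => l lk.
    rewrite /tsum /ins (eq_bigr (fun=> f l)) => [|x _].
      by rewrite sumr_const mulr_natl.
    congr f; listeq.
    natcases.
- have [ts|ts|ts] := ltngtP t s.
  + have [st|st] := eqVneq s t.+1.
      apply: planar_ext fP => l lk.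
      rewrite /tsum /fork (bigD1 (nth x0 l t)) //= big1 => [|x /negbTE xl].
        rewrite !nth_inj; try lia.
        rewrite st eqxx ifF; last by lia.
        rewrite (_ : unbump _ _ = t); last by rewrite /unbump; lia.
        rewrite eqxx mul1r addr0; congr f; listeq.
        natcases.
      rewrite !nth_inj; try lia.
      rewrite st eqxx ifF; last by lia.
      rewrite (_ : unbump _ _ = t); last by rewrite /unbump; lia.
      by rewrite eq_sym xl mul0r.
    have -> : k = k.-1.+1 by lia.
    apply: planar_ext (planar_fork (s := t) _ (IH s.-1 _)); try lia.
    move=> l lk; rewrite /fork /tsum mulr_sumr; apply: eq_bigr => x _.
    congr (_ * f _).
      rewrite !nth_inj; try lia.
      rewrite !ifF; try lia.
      by congr (_ == _)%:R; natcases.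
    listeq; natcases.
  + have -> : k = k.-1.+1 by lia.
    apply: planar_ext (planar_fork (s := t.-1) _ (IH s _)); try lia.
    move=> l lk; rewrite /fork /tsum mulr_sumr; apply: eq_bigr => x _.
    congr (_ * f _).
      rewrite !nth_inj; try lia.
      rewrite !ifF; try lia.
      by congr (_ == _)%:R; natcases.
    listeq; natcases.
  + apply: planar_ext fP => l lk.
    rewrite /tsum /fork (bigD1 (nth x0 l t)) //= big1 => [|x /negbTE xl].
      rewrite !nth_inj; try lia.
      rewrite ts eqxx ifF; last by lia.
      rewrite (_ : unbump _ _ = s); last by rewrite /unbump; lia.
      rewrite eqxx mul1r addr0; congr f; listeq.
      natcases.
    rewrite !nth_inj; try lia.
    rewrite ts eqxx ifF; last by lia.
    rewrite (_ : unbump _ _ = s); last by rewrite /unbump; lia.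
    by rewrite -ts xl mul0r.
- apply: planar_ext (planar_lin c (IHf s sk) (IHg s sk)) => l _.
  by rewrite /tsum big_split mulr_sumr.
- by apply: planar_ext (planar_zero _) => l _; rewrite /tsum big1.
- apply: planar_ext (IH s sk) => l lk; apply: eq_bigr => x _; apply: fg.
  rewrite size_inj; lia.
Qed.

End Tensors.

(** * Sums over words of a given length *)

Section WordSums.
Variables (X : finType) (V : nmodType).
Implicit Types (F : seq X -> V).

(** Only the range of summation is typed by a length; the summand lives on plain lists, so that
    concatenating and splitting words needs no transport along equalities of lengths. *)
Definition lsum k F : V := \sum_(t : k.-tuple X) F t.

Lemma eq_lsum k F G : (forall l, size l = k -> F l = G l) -> lsum k F = lsum k G.
Proof. by move=> FG; apply: eq_bigr => t _; rewrite FG ?size_tuple. Qed.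

Lemma lsum0 F : lsum 0 F = F [::].
Proof.
rewrite /lsum (eq_bigr (fun=> F [::])) => [|t _]; last by rewrite tuple0.
by rewrite sumr_const card_tuple expn0.
Qed.

Lemma lsumS k F : lsum k.+1 F = \sum_x lsum k (fun l => F (x :: l)).
Proof.
rewrite /lsum pair_big /=.
rewrite (reindex (fun p : X * k.-tuple X => [tuple of p.1 :: p.2])) //=.
exists (fun t : k.+1.-tuple X => (thead t, [tuple of behead t])) => [[x t] _|t _].
  by congr pair; apply: val_inj.
by apply: val_inj; case: (tupleP t).
Qed.

Lemma lsum_cat a b F : lsum (a + b) F = lsum a (fun u => lsum b (fun v => F (u ++ v))).
Proof.
elim: a F => [|a IH] F; first by rewrite lsum0.
by rewrite addSn !lsumS; apply: eq_bigr => x _; rewrite IH.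
Qed.

Lemma lsum_rev k F : lsum k F = lsum k (fun l => F (rev l)).
Proof.
rewrite /lsum (reindex_inj (h := fun t : k.-tuple X => [tuple of rev t])) //=.
by move=> t t' /(congr1 val) /= /(can_inj revK) /val_inj.
Qed.

Lemma lsum_exchange (I : finType) k (F : I -> seq X -> V) :
  lsum k (fun l => \sum_i F i l) = \sum_i lsum k (F i).
Proof. exact: exchange_big. Qed.

Lemma lsum_rcons k F : lsum k.+1 F = lsum k (fun l => \sum_x F (rcons l x)).
Proof.
rewrite lsum_rev lsumS -lsum_exchange [RHS]lsum_rev.
by apply: eq_lsum => l _; apply: eq_bigr => x _; rewrite rev_cons.
Qed.

End WordSums.

Lemma lsumD (X : finType) (V : nmodType) k (F G : seq X -> V) :
  lsum k (fun l => F l + G l) = lsum k F + lsum k G.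
Proof. exact: big_split. Qed.

Lemma lsum_mulr (X : finType) (K : pzSemiRingType) k (c : K) (F : seq X -> K) :
  lsum k (fun l => c * F l) = c * lsum k F.
Proof. by rewrite /lsum mulr_sumr. Qed.

Lemma lsum_scaler (X : finType) (K : pzRingType) (V : lmodType K) k (c : K)
    (F : seq X -> V) :
  c *: lsum k F = lsum k (fun l => c *: F l).
Proof. exact: scaler_sumr. Qed.

(** * Tensor product, conjugation, reversal and contraction of planar tensors *)

Section PlanarAlgebra.
Variables (C : numClosedFieldType) (X : finType) (x0 : X).
Implicit Types (f g : seq X -> C) (k s : nat) (l : seq X).
Local Notation planar := (@planar C X x0).
Local Notation fork := (fork x0).

Lemma planar_tens k m f g : planar k f -> planar m g ->
  planar (k + m) (fun l => f (take k l) * g (drop k l)).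
Proof.
move=> fP; elim=> {m g} [|m s g sm gP IH|m s g sm gP IH|m c g g' gP IH gP' IH'|m|
  m g g' gg' gP IH].
- by rewrite addn0; apply: planar_ext fP => l <-; rewrite take_size mulr1.
- rewrite addnS; apply: planar_ext (planar_ins (s := k + s) _ IH); try lia.
  move=> l; rewrite -addnS => /split_size[u [v [-> <- _]]].
  by rewrite /ins del_catr !take_size_cat // !drop_size_cat.
- rewrite addnS; apply: planar_ext (planar_fork (s := k + s) _ IH); try lia.
  move=> l; rewrite -addnS => /split_size[u [v [-> <- vm]]].
  rewrite /fork -addnS del_catr !take_size_cat // !drop_size_cat //.
  rewrite !nth_cat !ifF; try lia.
  by rewrite !(addnC (size u)) !addnK mulrCA.
- apply: planar_ext (planar_lin c IH IH') => l _.
  by rewrite mulrDr mulrCA.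
- by apply: planar_ext (planar_zero _ _ _) => l _; rewrite mulr0.
- apply: planar_ext IH => l lk; rewrite gg' // size_drop; lia.
Qed.

Lemma planar_conj k f : planar k f -> planar k (fun l => (f l)^*).
Proof.
elim=> {k f} [|k s f sk fP IH|k s f sk fP IH|k c f g fP IHf gP IHg|k|
  k f g fg fP IH].
- by apply: planar_ext (planar_one _ _) => l _; rewrite rmorph1.
- exact: planar_ins IH.
- apply: planar_ext (planar_fork sk IH) => l _.
  by rewrite /fork rmorphM /= rmorph_nat.
- by apply: planar_ext (planar_lin c^* IHf IHg) => l _; rewrite rmorphD rmorphM.
- by apply: planar_ext (planar_zero _ _ k) => l _; rewrite rmorph0.
- by apply: planar_ext IH => l lk; rewrite fg.
Qed.

Lemma del_rev s l : (s < size l)%N -> del s (rev l) = rev (del ((size l).-1 - s) l).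
Proof.
move=> h; rewrite /del take_rev drop_rev rev_cat; congr (rev (drop _ _) ++ rev (take _ _)); lia.
Qed.

Lemma planar_rev k f : planar k f -> planar k (fun l => f (rev l)).
Proof.
elim=> {k f} [|k s f sk fP IH|k s f sk fP IH|k c f g fP IHf gP IHg|k|
  k f g fg fP IH].
- exact: planar_one.
- apply: planar_ext (planar_ins (s := k - s) _ IH); try lia.
  move=> l lk; rewrite /ins del_rev; last by lia.
  by congr (f (rev (del _ _))); lia.
- apply: planar_ext (planar_fork (s := k.-1 - s) _ IH); try lia.
  move=> l lk; rewrite /fork del_rev; last by lia.
  rewrite !nth_rev; try lia.
  rewrite (_ : (size l - s.+1)%N = (k.-1 - s).+1); last by lia.
  rewrite (_ : (size l - s.+2)%N = (k.-1 - s)%N); last by lia.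
  rewrite eq_sym; case: eqP => [e|_]; last by rewrite !mul0r.
  congr (_ * f (rev _)); apply: (@eq_from_nth _ x0) => [|i].
    by rewrite !size_del; lia.
  rewrite !nth_del ?size_del; try lia.
  move=> hi; have [->|it] := eqVneq i (k.-1 - s)%N.
    have -> : bump (k.-1 - s).+1 (k.-1 - s) = (k.-1 - s)%N by rewrite /bump; lia.
    by rewrite -e; congr nth; rewrite /bump; lia.
  congr nth; rewrite /bump; lia.
- exact: planar_lin.
- exact: planar_zero.
- by apply: planar_ext IH => l lk; rewrite fg ?size_rev.
Qed.

(** The word [m ++ rev m] is a nest of pairs. The innermost of [b.+1] pairs sits at the adjacent
    positions [a + b] and [(a + b).+1], so a merge followed by a sum contracts it, and the induction
    proceeds outwards. *)
Lemma planar_contract a b r f : planar (a + b + b + r) f ->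
  planar (a + r) (fun l => lsum b (fun m => f (take a l ++ m ++ rev m ++ drop a l))).
Proof.
elim: b f => [|b IH] f fP.
  rewrite !addn0 in fP; apply: planar_ext fP => l _.
  by rewrite lsum0 /= cat_take_drop.
have mP : planar (a + b + b + r).+1 (tmerge (a + b) f).
  have -> : (a + b + b + r).+1 = (a + b.+1 + b.+1 + r).-1 by lia.
  by apply: planar_merge fP _ _; lia.
have /IH : planar (a + b + b + r) (tsum (a + b) (tmerge (a + b) f)).
  by apply: planar_tsum mP _ _; lia.
apply: planar_ext => _ /split_size[u [v [-> ua vr]]].
rewrite lsum_rcons; apply: eq_lsum => m mb; apply: eq_bigr => x _.
rewrite /tmerge !take_size_cat // !drop_size_cat // catA -ua -mb -size_cat.
rewrite dup_inj rev_rcons -cats1; congr f; by rewrite /= -!catA.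
Qed.

(* x is read as a matrix indexed by words; reversing the row index makes matrix
   multiplication the contraction of adjacent letters. *)
Definition biplanar (x : seq X -> seq X -> C) :=
  forall k m, planar (k + m) (fun L => x (rev (take k L)) (drop k L)).

Lemma biplanar_comp x y k b r :
  biplanar x -> biplanar y ->
  planar (k + r) (fun L =>
    lsum b (fun m => x (rev (take k L)) m * y m (drop k L))).
Proof.
move=> xP yP; have := planar_tens (xP k b) (yP b r).
rewrite addnA => /planar_contract; apply: planar_ext.
move=> _ /split_size[u [v [-> ua vr]]]; apply: eq_lsum => m mb.
rewrite (take_size_cat v ua) (drop_size_cat v ua) catA.
have um : size (u ++ m) = (k + b)%N by rewrite size_cat ua mb.
rewrite (take_size_cat _ um) (drop_size_cat _ um) (take_size_cat _ ua).
by rewrite (drop_size_cat _ ua) take_size_cat ?drop_size_cat ?size_rev // revK.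
Qed.

Lemma biplanar_star x : biplanar x -> biplanar (fun i j => (x j i)^*).
Proof.
move=> xP k l; have /planar_conj/planar_rev := xP l k; rewrite addnC.
apply: planar_ext => _ /split_size[u [v [-> ua vr]]].
rewrite take_size_cat // drop_size_cat // rev_cat.
by rewrite take_size_cat ?size_rev // drop_size_cat ?size_rev // revK.
Qed.

(** With the row word reversed, the identity is a nest of pairs; a new innermost pair is a point
    inserted in the middle and doubled at once. *)
Lemma biplanar_id : biplanar (fun i j => (i == j)%:R).
Proof.
move=> k l; have [->|kl] := eqVneq l k; last first.
  apply: planar_ext (planar_zero _ _ _) => _ /split_size[u [v [-> ua vr]]].
  rewrite take_size_cat // drop_size_cat //; case: eqP => // /(congr1 size).
  by rewrite size_rev ua vr => e; rewrite e eqxx in kl.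
elim: {l} k => [|k IH].
  by apply: planar_ext (planar_one _ _) => -[].
rewrite addSn addnS.
apply: planar_ext (planar_fork (s := k) _ (planar_ins (s := k) _ IH)); try lia.
move=> l lk; have [u [v [-> ua]]] := @split_size _ k k.+2 l ltac:(lia).
case: v => [|a [|b v]] //= [vk].
have d1 : del k.+1 (u ++ [:: a, b & v]) = u ++ a :: v.
  by rewrite -ua -(addn1 (size u)) del_catr /del /= drop0.
have d2 : del k (u ++ a :: v) = u ++ v.
  by rewrite -ua -{1}(addn0 (size u)) del_catr /del /= drop0.
rewrite /fork /ins d1 d2 !nth_cat ua ltnn subnn ltnNge leqnSn subSnn /=.
rewrite take_size_cat // drop_size_cat // -cat_rcons.
rewrite take_size_cat ?size_rcons ?ua // drop_size_cat ?size_rcons ?ua //.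
by rewrite rev_rcons eqseq_cons; case: (a == b); rewrite ?mul1r ?mul0r.
Qed.

End PlanarAlgebra.

(** * Noncrossing relations and partitions *)

Section NoncrossingRelations.
Implicit Types (e : rel nat) (k s t a b c d : nat).

(** Noncrossing partitions as relations on [nat] constrained only on the first [k] points, so that
    deleting a point is a mere reindexing, [pull]. *)
Definition nceq k e : Prop :=
  [/\ forall a, (a < k)%N -> e a a,
      forall a b, (a < k)%N -> (b < k)%N -> e a b -> e b a,
      forall a b c, (a < k)%N -> (b < k)%N -> (c < k)%N ->
        e a b -> e b c -> e a c
    & forall a b c d, (a < b)%N -> (b < c)%N -> (c < d)%N -> (d < k)%N ->
        e a c -> e b d -> e a b].

Definition pull s e : rel nat := fun a b => e (bump s a) (bump s b).

Lemma bump_lt s a k : (s <= k)%N -> (a < k)%N -> (bump s a < k.+1)%N.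
Proof. rewrite /bump; lia. Qed.

Lemma nceq_pull k e s : (s <= k)%N -> nceq k.+1 e -> nceq k (pull s e).
Proof.
move=> sk [er es et ec].
have B a : (a < k)%N -> (bump s a < k.+1)%N by exact: bump_lt.
split.
- by move=> a ak; apply: er; apply: B.
- by move=> a b ak bk; apply: es; apply: B.
- by move=> a b c ak bk ck; apply: et; apply: B.
- move=> a b c d ab bc cd dk; apply: ec (B _ dk); rewrite /bump; lia.
Qed.

(* A pair of related points at minimal distance is adjacent, by noncrossing. *)
Lemma nceq_reducible k e : nceq k.+1 e ->
  (exists2 s, (s <= k)%N & forall t, (t <= k)%N -> e s t = (t == s)) \/
  (exists2 s, (s < k)%N & e s s.+1).
Proof.
move=> [er es et ec].
have [[s [t [st tk est]]]|no] :=
    pselect (exists s t, [/\ (s < t)%N, (t <= k)%N & e s t]); last first.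
  left; exists 0%N => // t tk; have [->|t0] := eqVneq t 0%N; first exact: er.
  by apply/negP => e0t; apply: no; exists 0%N, t; split=> //; lia.
move: {2}(t - s)%N (leqnn (t - s)%N) => m.
elim: m s t st tk est => [|m IH] s t st tk est mst; first lia.
have [ts|ts] := eqVneq t s.+1; first by right; exists s; [lia|rewrite -ts].
(* A partner [r] of [s.+1] is sought. Without one, [s.+1] is a singleton; between [s.+1] and [t] it
   yields a closer pair; otherwise it equals [s] or its pair crosses that of [s] and [t], and [s],
   [s.+1] are related. *)
have [[r [rk rs ers]]|no] :=
    pselect (exists r, [/\ (r <= k)%N, r != s.+1 & e s.+1 r]); last first.
  left; exists s.+1 => [|r rk]; first lia.
  have [->|rs] := eqVneq r s.+1; first by apply: er; lia.
  by apply/negP => er1; apply: no; exists r.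
have [rs1|rs1] := ltnP r s.+1.
  have [e1|rns] := eqVneq r s.
    by right; exists s; [lia|rewrite -{1}e1; apply: es => //; lia].
  right; exists s; first lia.
  have ers' : e r s.+1 by apply: es => //; lia.
  have er_s : e r s by apply: (ec r s s.+1 t) => //; lia.
  apply: (et _ r) => //; try lia.
  by apply: es => //; lia.
have [rt|rt] := leqP r t; first by apply: (IH s.+1 r) => //; lia.
right; exists s; first lia.
by apply: (ec s s.+1 t r) => //; lia.
Qed.

Lemma nceq_ind (P : nat -> rel nat -> Prop) :
  (forall e, nceq 0 e -> P 0%N e) ->
  (forall k e s, nceq k.+1 e -> (s <= k)%N ->
     (forall t, (t <= k)%N -> e s t = (t == s)) ->
     nceq k (pull s e) -> P k (pull s e) -> P k.+1 e) ->
  (forall k e s, nceq k.+1 e -> (s < k)%N -> e s s.+1 ->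
     nceq k (pull s.+1 e) -> P k (pull s.+1 e) -> P k.+1 e) ->
  forall k e, nceq k e -> P k e.
Proof.
move=> P0 P1 P2; elim=> [|k IH] e ek; first exact: P0.
have [[s sk es]|[s sk es]] := nceq_reducible ek.
  by apply: (P1 _ _ s) => //; [|apply: IH]; apply: nceq_pull.
by apply: (P2 _ _ s) => //; [|apply: IH]; apply: nceq_pull.
Qed.

Definition adjoin s e : rel nat :=
  fun a b => (a == b) || [&& a != s, b != s & e (unbump s a) (unbump s b)].

Lemma nceq_adjoin k s e : (s <= k)%N -> nceq k e -> nceq k.+1 (adjoin s e).
Proof.
move=> sk [er es et ec].
have U a : (a < k.+1)%N -> a != s -> (unbump s a < k)%N by rewrite /unbump; lia.
rewrite /adjoin; split.
- by move=> a _; rewrite eqxx.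
- move=> a b ak bk /orP[/eqP->|/and3P[aS bS eab]]; first by rewrite eqxx.
  by rewrite aS bS (es _ _ _ _ eab) ?orbT ?U.
- move=> a b c ak bk ck /orP[/eqP-> //|/and3P[aS bS eab]].
  case/orP=> [/eqP<-|/and3P[_ cS ebc]]; first by rewrite aS bS eab orbT.
  by rewrite aS cS (et _ _ _ _ _ _ eab ebc) ?orbT ?U.
- move=> a b c d ab bc cd dk /orP[/eqP ac|/and3P[aS cS eac]]; first lia.
  case/orP=> [/eqP bd|/and3P[bS dS ebd]]; first lia.
  rewrite aS bS (ec _ _ (unbump s c) (unbump s d)) ?orbT ?U //;
  rewrite /unbump; lia.
Qed.

Definition push s e : rel nat := fun a b => e (unbump s a) (unbump s b).

Lemma nceq_push k s e : (s < k)%N -> nceq k e -> nceq k.+1 (push s e).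
Proof.
move=> sk [er es et ec].
have U a : (a < k.+1)%N -> (unbump s a < k)%N by rewrite /unbump; lia.
rewrite /push; split.
- by move=> a ak; apply: er; apply: U.
- by move=> a b ak bk; apply: es; apply: U.
- by move=> a b c ak bk ck; apply: et; apply: U.
- move=> a b c d ab bc cd dk eac ebd.
  have [e1|ne1] := eqVneq (unbump s a) (unbump s b).
    by rewrite e1; apply: er; apply: U; lia.
  have [e2|ne2] := eqVneq (unbump s b) (unbump s c); first by rewrite e2.
  have [e3|ne3] := eqVneq (unbump s c) (unbump s d).
    apply: (et _ (unbump s c)) => //; try (apply: U; lia).
    by apply: es; rewrite ?e3 //; apply: U; lia.
  apply: (ec _ _ (unbump s c) (unbump s d)) => //; try (by apply: U; lia);
  move: ne1 ne2 ne3; rewrite /unbump; lia.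
Qed.

End NoncrossingRelations.

Section Deltas.
Variables (X : eqType) (x0 : X).
Implicit Types (e : rel nat) (k s t : nat) (l : seq X).

Definition delta e l : bool :=
  all (fun s => all (fun t => e s t ==> (nth x0 l s == nth x0 l t))
    (iota 0 (size l))) (iota 0 (size l)).

Lemma deltaP e l : reflect (forall s t, (s < size l)%N -> (t < size l)%N ->
  e s t -> nth x0 l s = nth x0 l t) (delta e l).
Proof.
apply: (iffP allP) => [H s t sl tl est|H s].
  have /H/allP/(_ t) : s \in iota 0 (size l) by rewrite mem_iota.
  by rewrite mem_iota => /(_ tl)/implyP/(_ est)/eqP.
rewrite mem_iota => sl; apply/allP => t; rewrite mem_iota => tl.
by apply/implyP => est; apply/eqP/H.
Qed.

Lemma eq_delta e e' l :
  (forall a b, (a < size l)%N -> (b < size l)%N -> e a b = e' a b) ->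
  delta e l = delta e' l.
Proof.
by move=> ee; apply/deltaP/deltaP => H s t sl tl est; apply: H;
   rewrite // ?ee // -ee.
Qed.

Lemma delta_singleton k e s l : nceq k.+1 e -> (s <= k)%N ->
  (forall t, (t <= k)%N -> e s t = (t == s)) -> size l = k.+1 ->
  delta e l = delta (pull s e) (del s l).
Proof.
move=> [er es et _] sk eS lk.
have sl : (s < size l)%N by lia.
apply/deltaP/deltaP => H a b; rewrite ?size_del ?lk //.
  by move=> ak bk eab; rewrite !nth_del //; apply: H => //; rewrite lk bump_lt.
move=> ak bk eab.
have [aS|aS] := eqVneq a s; first by move: eab; rewrite aS eS // => /eqP->.
have [bS|bS] := eqVneq b s.
  by have := es _ _ ak bk eab; rewrite bS eS // => /eqP->.
have := H (unbump s a) (unbump s b); rewrite !nth_del // /pull !unbumpK //.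
by apply=> //; rewrite size_del ?lk //= /unbump; lia.
Qed.

Lemma delta_adjacent k e s l : nceq k.+1 e -> (s < k)%N -> e s s.+1 ->
  size l = k.+1 ->
  delta e l = (nth x0 l s == nth x0 l s.+1) && delta (pull s.+1 e) (del s.+1 l).
Proof.
move=> [er es et _] sk ess lk.
have sl : (s.+1 < size l)%N by lia.
apply/deltaP/andP => [H|[/eqP ss /deltaP H]].
  split; first by apply/eqP/H => //; lia.
  apply/deltaP => a b; rewrite size_del lk //= => ak bk eab.
  by rewrite !nth_del //; apply: H => //; rewrite lk bump_lt.
(* [r] replaces each point by a related one, carrying the same letter, that survives the deletion of
   [s.+1]. *)
pose r a := if a == s.+1 then s else a.
have rP a : (a < k.+1)%N ->
    [/\ nth x0 l a = nth x0 l (r a), e a (r a), (r a < k.+1)%N & r a != s.+1].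
  rewrite /r; case: eqP => [->|/eqP aS] ak; split=> //; try lia.
  - by apply: es => //; lia.
  - exact: er.
move=> a b; rewrite lk => ak bk eab.
have [-> ea rak ras] := rP _ ak; have [-> eb rbk rbs] := rP _ bk.
have rab : e (r a) (r b) by apply: (et _ b) => //; apply: (et _ a) => //; apply: es.
have := H (unbump s.+1 (r a)) (unbump s.+1 (r b)).
rewrite !nth_del // /pull !unbumpK //.
by apply=> //; rewrite size_del ?lk //= /unbump; lia.
Qed.

End Deltas.

Section NCPartitions.
Variable k : nat.
Implicit Types (p q : NC k).

Definition ncrel p : rel nat := fun a b =>
  if (insub a, insub b) is (Some x, Some y) then y \in pblock (val p) (x : 'I_k)
  else false.

Lemma ncrel_ord p (x y : 'I_k) : ncrel p x y = (y \in pblock (val p) x).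
Proof. by rewrite /ncrel !valK. Qed.

Lemma ncrelE p a b (ak : (a < k)%N) (bk : (b < k)%N) :
  ncrel p a b = (Ordinal bk \in pblock (val p) (Ordinal ak)).
Proof. exact: ncrel_ord p (Ordinal ak) (Ordinal bk). Qed.

Lemma NC_part p : partition (val p) [set: 'I_k].
Proof. by case: p => p /= /andP[]. Qed.

Lemma NC_mem p (x : 'I_k) : pblock (val p) x \in val p.
Proof. by rewrite pblock_mem // (cover_partition (NC_part p)) inE. Qed.

Lemma NC_self p (x : 'I_k) : x \in pblock (val p) x.
Proof. by rewrite mem_pblock (cover_partition (NC_part p)) inE. Qed.

Lemma NC_triv p : trivIset (val p).
Proof. by have /and3P[] := NC_part p. Qed.

Lemma nceq_ncrel p : nceq k (ncrel p).
Proof.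
have same (x y : 'I_k) : y \in pblock (val p) x -> pblock (val p) y = pblock (val p) x.
  by move=> yx; apply: def_pblock yx; [exact: NC_triv|exact: NC_mem].
split.
- by move=> a ak; rewrite ncrelE NC_self.
- by move=> a b ak bk; rewrite !ncrelE => /same ->; rewrite NC_self.
- by move=> a b c ak bk ck; rewrite !ncrelE => /same <-.
- move=> a b c d ab bc cd dk.
  have ck := ltn_trans cd dk; have bk := ltn_trans bc ck.
  have ak := ltn_trans ab bk.
  rewrite !ncrelE => ac bd.
  have /andP[_ /forall_inP/(_ _ (NC_mem p (Ordinal ak)))] := valP p.
  move=> /forall_inP/(_ _ (NC_mem p (Ordinal bk)))/implyP nc.
  case: eqP nc => [-> _|_ /(_ isT)]; first exact: NC_self.
  case/negP; apply/exists_inP; exists (Ordinal ak); first exact: NC_self.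
  apply/exists_inP; exists (Ordinal bk); first exact: NC_self.
  apply/exists_inP; exists (Ordinal ck) => //.
  by apply/exists_inP; exists (Ordinal dk) => //; apply/and3P.
Qed.

Lemma ncrel_inj p q :
  (forall a b, (a < k)%N -> (b < k)%N -> ncrel p a b = ncrel q a b) -> p = q.
Proof.
move=> pq; apply: val_inj.
rewrite -(equivalence_partition_pblock (NC_part p)).
rewrite -(equivalence_partition_pblock (NC_part q)).
congr equivalence_partition; apply/funext => x; apply/funext => y /=.
by rewrite -!ncrel_ord pq.
Qed.

Lemma NC_of_nceq e : nceq k e ->
  exists p, forall a b, (a < k)%N -> (b < k)%N -> ncrel p a b = e a b.
Proof.
move=> [er es et ec]; pose E (x y : 'I_k) := e x y.
have eqE : {in [set: 'I_k] & &, equivalence_rel E}.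
  move=> x y z _ _ _; split; first exact: er.
  move=> exy; apply/idP/idP => [exz|]; last exact: et.
  by apply: et exz => //; apply: es.
pose P := equivalence_partition E [set: 'I_k].
have PP : partition P [set: 'I_k] := equivalence_partitionP eqE.
have pbP x y : (y \in pblock P x) = E x y.
  by rewrite pblock_equivalence_partition ?inE.
have PE x B : B \in P -> x \in B -> B = pblock P x.
  by move=> BP xB; rewrite (def_pblock _ BP xB) //; case/and3P: PP.
have ncP : noncrossing P.
  apply/forall_inP => B BP; apply/forall_inP => B' BP'; apply/implyP.
  apply: contraNN => /exists_inP[a aB /exists_inP[b bB /exists_inP[c cB]]].
  case/exists_inP=> d dB /and3P[ab bc cd].
  have eab : E a b.
    apply: (ec a b c d) => //; rewrite -/(E _ _) -pbP.
      by rewrite -(PE a B).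
    by rewrite -(PE b B').
  rewrite (PE a B) // (PE b B') //; apply/eqP/esym/def_pblock.
  - by case/and3P: PP.
  - by rewrite -(PE a B).
  - by rewrite pbP.
have PNC : is_part P && noncrossing P by rewrite /is_part PP.
exists (exist _ P PNC) => a b ak bk.
by rewrite ncrelE /= pbP.
Qed.

End NCPartitions.

Section PlanarSpan.
Variables (C : numClosedFieldType) (X : finType) (x0 : X).
Implicit Types (f g : seq X -> C) (k : nat).
Local Notation planar := (@planar C X x0).
Local Notation delta := (delta x0).

Lemma planar_delta k e : nceq k e -> planar k (fun l => (delta e l)%:R).
Proof.
move: k e; apply: nceq_ind => [e _|k e s ek sk es _ IH|k e s ek sk es _ IH].
- by apply: planar_ext (planar_one _ _) => -[].
- apply: planar_ext (planar_ins sk IH) => l lk.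
  by rewrite /ins (delta_singleton x0 ek sk es lk).
- apply: planar_ext (planar_fork sk IH) => l lk.
  by rewrite /fork (delta_adjacent x0 ek sk es lk) -mulnb natrM.
Qed.

Definition inspan k f := exists c : NC k -> C,
  forall l, size l = k -> f l = \sum_p c p * (delta (ncrel p) l)%:R.

Lemma inspan_lin k c f g : inspan k f -> inspan k g ->
  inspan k (fun l => c * f l + g l).
Proof.
move=> [a fa] [b gb]; exists (fun p => c * a p + b p) => l lk.
rewrite fa // gb // mulr_sumr -big_split /=.
by apply: eq_bigr => p _; rewrite mulrDl mulrA.
Qed.

Lemma inspan_zero k : inspan k (fun=> 0).
Proof. by exists (fun=> 0) => l _; rewrite big1 // => p _; rewrite mul0r. Qed.

Lemma inspan_ext k f g : (forall l, size l = k -> f l = g l) ->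
  inspan k f -> inspan k g.
Proof. by move=> fg [c fc]; exists c => l lk; rewrite -fg ?fc. Qed.

Lemma inspan_delta k e : nceq k e -> inspan k (fun l => (delta e l)%:R).
Proof.
move=> /NC_of_nceq[p pe]; exists (fun q => (q == p)%:R) => l lk.
rewrite (bigD1 p) //= eqxx mul1r big1 => [|q /negbTE->]; last by rewrite mul0r.
by rewrite addr0; congr (nat_of_bool _)%:R; apply: eq_delta; rewrite lk => a b ak bk; rewrite pe.
Qed.

Lemma inspan_sum k (I : Type) (r : seq I) (c : I -> C) (F : I -> seq X -> C) :
  (forall i, inspan k (F i)) -> inspan k (fun l => \sum_(i <- r) c i * F i l).
Proof.
move=> FP; elim: r => [|i r IH].
  by apply: inspan_ext (inspan_zero k) => l _; rewrite big_nil.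
by apply: inspan_ext (inspan_lin (c i) (FP i) IH) => l _; rewrite big_cons.
Qed.

(** Together with [planar_delta] this identifies planar tensors with the span of noncrossing
    partitions: [ins] and [fork] carry the tensor of a relation to that of its [adjoin] and
    [push]. *)
Lemma planar_inspan k f : planar k f -> inspan k f.
Proof.
elim=> {k f} [|k s f sk _ [c fc]|k s f sk _ [c fc]|k c f g _ IH _ IH'|k|
  k f g fg _ IH].
- have : nceq 0 eq_op by split.
  by move=> /inspan_delta; apply: inspan_ext => -[].
- have : inspan k.+1 (fun l => \sum_p c p * (delta (adjoin s (ncrel p)) l)%:R).
    apply: inspan_sum => p; apply/inspan_delta/nceq_adjoin => //.
    exact: nceq_ncrel.
  apply: inspan_ext => l lk; rewrite /ins fc ?size_del ?lk //.
  apply: eq_bigr => p _; congr (_ * (nat_of_bool _)%:R).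
  rewrite (delta_singleton x0 (nceq_adjoin sk (nceq_ncrel p)) sk _ lk).
    apply: eq_delta => a b; rewrite size_del ?lk //= => ak _.
    rewrite /pull /adjoin !bumpK !(eq_sym (bump _ _) s) !neq_bump /=.
    case: eqP => [/(can_inj (bumpK s)) <-|//].
    by have [er _ _ _] := nceq_ncrel p; rewrite er.
  move=> t tk; rewrite /adjoin eqxx orbF eq_sym //.
- have : inspan k.+1 (fun l => \sum_p c p * (delta (push s (ncrel p)) l)%:R).
    apply: inspan_sum => p; apply/inspan_delta/nceq_push => //.
    exact: nceq_ncrel.
  apply: inspan_ext => l lk; rewrite /fork fc ?size_del ?lk //.
  rewrite mulr_sumr; apply: eq_bigr => p _; rewrite mulrCA -natrM mulnb.
  congr (_ * (nat_of_bool _)%:R).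
  have [er _ _ _] := nceq_ncrel p.
  rewrite (delta_adjacent x0 (nceq_push sk (nceq_ncrel p)) sk _ lk).
    congr (_ && _); apply: eq_delta => a b _ _; rewrite /pull /push.
    have U i : unbump s (bump s.+1 i) = i by rewrite /bump /unbump; lia.
    by rewrite !U.
  have U1 : unbump s s = s by rewrite /unbump; lia.
  have U2 : unbump s s.+1 = s by rewrite /unbump; lia.
  by rewrite /push U1 U2 er.
- exact: inspan_lin.
- exact: inspan_zero.
- exact: inspan_ext IH.
Qed.

End PlanarSpan.

(** * Linear independence of noncrossing partitions for n >= 4 *)

Section Words.
Implicit Types (e : rel nat) (k s t a b : nat) (u v d : seq bool).

(** On words of equal length the binary value turns the lexicographic order into the order of [nat],
    where arithmetic and the choice of a maximum are available. *)
Definition bin d : nat := foldl (fun m (c : bool) => m.*2 + c)%N 0%N d.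

Lemma bin_cat u v : (bin (u ++ v) = bin u * 2 ^ size v + bin v)%N.
Proof.
rewrite /bin foldl_cat.
set g := fun m => _; move: (foldl g 0%N u) => m.
elim/last_ind: v => [|v c IH]; first by rewrite /= muln1 addn0.
by rewrite -cats1 !foldl_cat IH /g size_cat /= addn1 expnS; nia.
Qed.

Lemma bin_lt d : (bin d < 2 ^ size d)%N.
Proof.
elim/last_ind: d => [//|d c IH].
rewrite -cats1 bin_cat size_cat addn1 expnS.
by rewrite [bin [:: c]]/(bin _) /=; case: c => /=; lia.
Qed.

Lemma bin_inj u v : size u = size v -> bin u = bin v -> u = v.
Proof.
elim/last_ind: u v => [|u c IH]; first by case.
elim/last_ind => [|v c' _]; first by rewrite size_rcons.
rewrite !size_rcons => -[uv]; rewrite -!cats1 !bin_cat.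
rewrite [bin [:: c]]/(bin _) [bin [:: c']]/(bin _) /= => h.
have cc : c = c' by case: c c' h => -[] /=; lia.
by rewrite (IH v) ?cc //; move: h; rewrite cc; lia.
Qed.

(** If the prefixes differ, they decide both comparisons. If they agree, the inserted pairs decide,
    [true], [false] being the larger of the two pairs of unequal letters; in case of a tie the
    suffixes do. *)
Lemma bin_insert u v u' v' c c' : size u = size u' -> size v = size v' ->
  c != c' -> (bin (u ++ v) <= bin (u' ++ v'))%N ->
  (bin (u ++ [:: c, c' & v]) <= bin (u' ++ [:: true, false & v']))%N.
Proof.
move=> uu vv cc; rewrite -(cat1s c) -(cat1s c') -(cat1s true) -(cat1s false).
rewrite !bin_cat !size_cat /= -vv.
have := bin_lt v; have := bin_lt v'; rewrite -vv.
move: (bin u) (bin u') (bin v) (bin v') => x x' y y'.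
rewrite -addn1 !add1n !expnS; move: (2 ^ size v)%N => M.
have [xx|xx|->] := ltngtP x x'; case: c c' cc => -[] //= _; rewrite /bin /=; nia.
Qed.

Definition isfst e a := all (fun r => ~~ e r a) (iota 0 a).
Definition islst k e a := all (fun r => ~~ e a r) (iota a.+1 (k - a.+1)).

Lemma isfstP e a : reflect (forall r, (r < a)%N -> e r a = false) (isfst e a).
Proof.
apply: (iffP allP) => [H r ra|H r]; last by rewrite mem_iota => /H->.
by apply/negbTE/H; rewrite mem_iota.
Qed.

Lemma islstP k e a :
  reflect (forall r, (a < r < k)%N -> e a r = false) (islst k e a).
Proof.
apply: (iffP allP) => [H r ra|H r].
  by apply/negbTE/H; rewrite mem_iota; lia.
by rewrite mem_iota => h; rewrite H //; lia.
Qed.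

Lemma isfst_singleton k e s a : (s <= k)%N -> nceq k.+1 e ->
  (forall t, (t <= k)%N -> e s t = (t == s)) -> (a < k)%N ->
  isfst (pull s e) a = isfst e (bump s a).
Proof.
move=> sk _ es ak; apply/isfstP/isfstP => H r rb.
  have [->|rs] := eqVneq r s.
    by rewrite es ?(negbTE (neq_bump _ _)) ?[_ == s]eq_sym ?(negbTE (neq_bump _ _)) // /bump; lia.
  have := H (unbump s r); rewrite /pull unbumpK //; apply.
  by move: rb rs; rewrite /bump /unbump; lia.
by apply: H; rewrite /bump; lia.
Qed.

Lemma islst_singleton k e s a : (s <= k)%N -> nceq k.+1 e ->
  (forall t, (t <= k)%N -> e s t = (t == s)) -> (a < k)%N ->
  islst k (pull s e) a = islst k.+1 e (bump s a).
Proof.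
move=> sk [_ sym _ _] es ak; apply/islstP/islstP => H r rb.
  have [->|rs] := eqVneq r s.
    apply/negP => /sym; rewrite es; last by rewrite /bump; lia.
    by rewrite eq_sym (negbTE (neq_bump _ _)) => H0; have := H0 ltac:(rewrite /bump; lia) ltac:(lia).
  have := H (unbump s r); rewrite /pull unbumpK //; apply.
  by move: rb rs; rewrite /bump /unbump; lia.
by apply: H; rewrite /bump; lia.
Qed.

Lemma isfst_adjacent k e s a : (s < k)%N -> nceq k.+1 e -> e s s.+1 ->
  (a < k)%N -> isfst (pull s.+1 e) a = isfst e (bump s.+1 a).
Proof.
move=> sk [_ sym tr _] es ak; apply/isfstP/isfstP => H r rb; last first.
  by apply: H; rewrite /bump; lia.
have [rs|rs] := eqVneq r s.+1; last first.
  have := H (unbump s.+1 r); rewrite /pull unbumpK //; apply.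
  by move: rb rs; rewrite /bump /unbump; lia.
have sa : (s < a)%N by move: rb; rewrite rs /bump; lia.
have := H s sa; rewrite /pull (_ : bump s.+1 s = s) => [h|]; last by rewrite /bump; lia.
apply/negP; rewrite rs => era; move/negP: h; apply.
by apply: (tr _ s.+1) => //; rewrite /bump; lia.
Qed.

(** Deleting [s.+1] fuses it with [s]: whether the fused point is last in its block is read at
    [s.+1], whereas in [isfst_adjacent] being first is read at [s]. *)
Lemma islst_adjacent k e s a : (s < k)%N -> nceq k.+1 e -> e s s.+1 ->
  (a < k)%N -> islst k (pull s.+1 e) a = islst k.+1 e (if a == s then s.+1 else bump s.+1 a).
Proof.
move=> sk [_ sym tr _] es ak.
have bs : bump s.+1 s = s by rewrite /bump; lia.
have es' : e s.+1 s by apply: sym => //; lia.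
have -> : islst k (pull s.+1 e) a = islst k (fun _ r => e (if a == s then s.+1 else bump s.+1 a) (bump s.+1 r)) a.
  apply/islstP/islstP => H r ra; rewrite -(H r ra) // /pull.
    case: eqP => // ->; rewrite bs.
    by apply/idP/idP; apply: tr => //; rewrite /bump; lia.
  case: eqP => // ->; rewrite bs.
  by apply/idP/idP; apply: tr => //; rewrite /bump; lia.
apply/islstP/islstP => H r rb; last first.
  by apply: H; move: rb; case: eqP; rewrite /bump; lia.
have [rs|rs] := eqVneq r s.+1; last first.
  have := H (unbump s.+1 r); rewrite unbumpK //; apply.
  by move: rb rs; case: eqP; rewrite /bump /unbump; lia.
move: rb; case: eqP => as_ rb; first lia.
have sa : (a < s)%N by move: rb; rewrite rs /bump; lia.
have := H s ltac:(lia); rewrite ifN_eq ?bs; last by apply/eqP.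
move=> h; apply/negP => era; move/negP: h; apply; rewrite rs in era.
by apply: (tr _ s.+1) => //; rewrite /bump; lia.
Qed.

(** As with brackets, openings and closings determine the matching, because a reduction of [e] is
    also one of [e']. A point both first and last is a singleton; and if [s] is not last while
    [s.+1] is not first, their partners either are each other or cross, so that [s] and [s.+1] are
    related. *)
Lemma word_inj k e : nceq k e -> forall e', nceq k e' ->
  (forall a, (a < k)%N -> isfst e a = isfst e' a /\ islst k e a = islst k e' a) ->
  forall a b, (a < k)%N -> (b < k)%N -> e a b = e' a b.
Proof.
move: k e; apply: nceq_ind => [//|k e s ek sk es epk IH|k e s ek sk es epk IH] e' e'k same.
  have es' t : (t <= k)%N -> e' s t = (t == s).
    have [er' sym' _ _] := e'k; have [er sym _ _] := ek.
    move=> tk; have [->|ts] := eqVneq t s; first exact: er'.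
    have [fs ls] := same s ltac:(lia).
    have/isfstP fs' : isfst e' s.
      by rewrite -fs; apply/isfstP => r rs; apply/negP => /sym; rewrite es; lia.
    have/islstP ls' : islst k.+1 e' s.
      by rewrite -ls; apply/islstP => r rs; rewrite es; lia.
    have [st|st|st] := ltngtP s t; first by apply: ls'; lia.
      by apply/negP => est; have := fs' t st; rewrite sym'.
    by rewrite st eqxx in ts.
  have epe a b : (a < k)%N -> (b < k)%N -> pull s e a b = pull s e' a b.
    apply: IH => [|a' ak]; first exact: nceq_pull.
    rewrite (isfst_singleton sk ek es ak) (islst_singleton sk ek es ak).
    rewrite (isfst_singleton sk e'k es' ak) (islst_singleton sk e'k es' ak).
    by apply: same; rewrite bump_lt.
  have [_ sym' _ _] := e'k; have [_ sym _ _] := ek.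
  move=> a b ak bk; have [->|aS] := eqVneq a s; first by rewrite es ?es'.
  have [->|bS] := eqVneq b s.
    by apply/idP/idP => [/sym|/sym']; rewrite ?es ?es' // => /(_ ak sk); rewrite (negbTE aS).
  have := epe (unbump s a) (unbump s b); rewrite /pull !unbumpK //; apply.
    by move: aS; rewrite /unbump; lia.
  by move: bS; rewrite /unbump; lia.
have [er' sym' tr' nc'] := e'k; have [er sym tr _] := ek.
have es' : e' s s.+1.
  have [_ ls] := same s ltac:(lia); have [fs _] := same s.+1 ltac:(lia).
  have [r [rs rk er_]] : exists r, [/\ (r <= s)%N, (r <= k)%N & e' r s.+1].
    have : ~~ isfst e' s.+1.
      by rewrite -fs; apply/isfstP => /(_ s (ltnSn s)); rewrite es.
    move=> nf; apply: contrapT => no; move/negP: nf; apply; apply/isfstP => r rs.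
    by apply/negP => h; apply: no; exists r; split=> //; lia.
  have [t [st tk et_]] : exists t, [/\ (s < t)%N, (t <= k)%N & e' s t].
    have : ~~ islst k.+1 e' s.
      by rewrite -ls; apply/islstP => /(_ s.+1); rewrite es => /(_ ltac:(lia)).
    move=> nf; apply: contrapT => no; move/negP: nf; apply; apply/islstP => t st.
    by apply/negP => h; apply: no; exists t; split=> //; lia.
  have [rs1|rs'] := eqVneq r s; first by rewrite -{1}rs1.
  have [ts1|ts'] := eqVneq t s.+1; first by rewrite -ts1.
  have rs_ : e' r s by apply: (nc' r s s.+1 t) => //; lia.
  by apply: (tr' _ r) => //; try lia; apply: sym' => //; lia.
have epe a b : (a < k)%N -> (b < k)%N -> pull s.+1 e a b = pull s.+1 e' a b.
  apply: IH => [|a' ak]; first exact: nceq_pull.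
  rewrite (isfst_adjacent sk ek es ak) (islst_adjacent sk ek es ak).
  rewrite (isfst_adjacent sk e'k es' ak) (islst_adjacent sk e'k es' ak).
  split; first by apply: (same _ _).1; rewrite bump_lt.
  by apply: (same _ _).2; case: ifP => _; [lia|rewrite bump_lt].
pose r a := if a == s.+1 then s else a.
have rP f a : nceq k.+1 f -> f s s.+1 -> (a < k.+1)%N -> f a (r a).
  move=> [fr fsym _ _] fs ak; rewrite /r; case: eqP => [->|_]; last exact: fr.
  by apply: fsym => //; lia.
have rk a : (a < k.+1)%N -> (r a < k.+1)%N /\ r a != s.+1 by rewrite /r; case: eqP; lia.
have rE f a b : nceq k.+1 f -> f s s.+1 -> (a < k.+1)%N -> (b < k.+1)%N ->
    f a b = f (r a) (r b).
  move=> fk fs ak bk; have [_ fsym ftr _] := fk.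
  have [rak _] := rk _ ak; have [rbk _] := rk _ bk.
  have fa := rP f a fk fs ak; have fb := rP f b fk fs bk.
  apply/idP/idP => h.
    by apply: (ftr _ b) => //; apply: (ftr _ a) => //; apply: fsym.
  by apply: (ftr _ (r b)) => //; [apply: (ftr _ (r a))|apply: fsym].
move=> a b ak bk; rewrite (rE e) // (rE e') //.
have [rak ra] := rk _ ak; have [rbk rb] := rk _ bk.
have := epe (unbump s.+1 (r a)) (unbump s.+1 (r b)); rewrite /pull !unbumpK //.
by apply; rewrite /unbump; lia.
Qed.

(* The opening/closing word of the noncrossing pairing of 2k points obtained by
   fattening e: point i contributes the letters 2i and 2i+1. *)
Definition wbit k e i := if odd i then ~~ islst k e i./2 else isfst e i./2.
Definition word k e : seq bool := mkseq (wbit k e) k.*2.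

Lemma size_word k e : size (word k e) = k.*2. Proof. by rewrite size_mkseq. Qed.

Lemma word_insert k e w s : size w = k.*2 -> (s <= k.*2)%N ->
  (forall i, (i < s)%N -> wbit k.+1 e i = nth true w i) ->
  wbit k.+1 e s = true -> wbit k.+1 e s.+1 = false ->
  (forall i, (s <= i < k.*2)%N -> wbit k.+1 e i.+2 = nth true w i) ->
  word k.+1 e = take s w ++ [:: true, false & drop s w].
Proof.
move=> wk sk wlo w1 w2 whi; apply: (@eq_from_nth _ true) => [|i].
  rewrite size_word size_cat size_take_min /= size_drop; lia.
rewrite size_word => ik; rewrite nth_mkseq // nth_cat size_take_min wk.
rewrite (minn_idPl sk); case: ltnP => h; first by rewrite nth_take ?wlo.
have [->|is0] := eqVneq i s; first by rewrite subnn.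
have [->|is1] := eqVneq i s.+1; first by rewrite subSnn.
rewrite (_ : (i - s)%N = (i - s.+2).+2) /=; last by lia.
by rewrite nth_drop -whi; [congr wbit|]; lia.
Qed.

Lemma word_singleton k e s : (s <= k)%N -> nceq k.+1 e ->
  (forall t, (t <= k)%N -> e s t = (t == s)) ->
  word k.+1 e = take s.*2 (word k (pull s e)) ++
    [:: true, false & drop s.*2 (word k (pull s e))].
Proof.
move=> sk ek es; have [_ sym _ _] := ek.
apply: word_insert; rewrite ?size_word //; try lia.
- move=> i ik; rewrite nth_mkseq; last by lia.
  rewrite /wbit (isfst_singleton sk ek es) ?(islst_singleton sk ek es); try lia.
  by rewrite (_ : bump s i./2 = i./2) // /bump; lia.
- rewrite /wbit odd_double doubleK; apply/isfstP => r rs.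
  by apply/negP => /sym; rewrite es; lia.
- rewrite /wbit oddS odd_double /= uphalf_double; apply/negbTE; rewrite negbK.
  by apply/islstP => r rs; rewrite es; lia.
- move=> i ik; rewrite nth_mkseq; last by lia.
  rewrite /wbit (isfst_singleton sk ek es) ?(islst_singleton sk ek es); try lia.
  by rewrite /= negbK (_ : bump s i./2 = i./2.+1) // /bump; lia.
Qed.

(** A doubled point creates a pair between the right leg of [s] and the left leg of [s.+1], letters
    2s+1 and 2s+2; in [word_singleton] the new pair consists of the two legs of one point, letters
    2s and 2s+1. *)
Lemma word_adjacent k e s : (s < k)%N -> nceq k.+1 e -> e s s.+1 ->
  word k.+1 e = take s.*2.+1 (word k (pull s.+1 e)) ++
    [:: true, false & drop s.*2.+1 (word k (pull s.+1 e))].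
Proof.
move=> sk ek es; have [_ sym _ _] := ek.
apply: word_insert; rewrite ?size_word //; try lia.
- move=> i ik; rewrite nth_mkseq; last by lia.
  rewrite /wbit (isfst_adjacent sk ek es) ?(islst_adjacent sk ek es); try lia.
  rewrite (_ : bump s.+1 i./2 = i./2); last by rewrite /bump; lia.
  by case: ifP => // oi; rewrite ifF //; lia.
- rewrite /wbit oddS odd_double /= uphalf_double; apply/islstP => /(_ s.+1).
  by rewrite es => /(_ ltac:(lia)).
- rewrite /wbit /= negbK odd_double /= doubleK.
  by apply/isfstP => /(_ s (ltnSn s)); rewrite es.
- move=> i ik; rewrite nth_mkseq; last by lia.
  rewrite /wbit (isfst_adjacent sk ek es) ?(islst_adjacent sk ek es); try lia.
  rewrite /= negbK; case: ifP => oi.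
    case: eqP => [->//|is_].
    by rewrite (_ : bump s.+1 i./2 = i./2.+1) // /bump; lia.
  by rewrite (_ : bump s.+1 i./2 = i./2.+1) // /bump; lia.
Qed.

End Words.

(** * Evaluating partition tensors on 2x2 matrices *)

Section PauliTwirl.
Variables (C : numClosedFieldType) (m : nat).
Local Notation X := 'I_m.+4.
Implicit Types (x : X) (a b : 'M[C]_2) (e : rel nat) (f : seq X -> C).
Implicit Types (u v : seq 'M[C]_2) (d : seq bool).

Lemma ord2_ind (P : 'I_2 -> Prop) : P ord0 -> P (lift ord0 ord0) -> forall i, P i.
Proof. by move=> P0 P1 i; case: (unliftP ord0 i) => [j|] ->; rewrite ?(ord1 j). Qed.

(** The matrices 1, Z, X and iY. They are real, so that transposition is their adjunction, and
    orthogonal for the trace, which is the source of [sum_twirl]. Sending the letters from 4 on to 0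
    keeps [twirlM] valid for all letters. *)
Definition pauli x : 'M[C]_2 := \matrix_(r, c)
  match val x with
  | 0 => (r == c)%:R
  | 1 => (r == c)%:R * (-1) ^+ r
  | 2 => (r != c)%:R
  | 3 => (r != c)%:R * (-1) ^+ r
  | _ => 0
  end.

Definition twirl x a : 'M[C]_2 := pauli x *m a *m (pauli x)^T.

Lemma pauli_eq0 x : (4 <= x)%N -> pauli x = 0.
Proof.
by move=> h; apply/matrixP => i j; rewrite !mxE; case: x h => -[|[|[|[|x]]]].
Qed.

Lemma pauli_orth x : (pauli x)^T *m pauli x = (x < 4)%:R%:M.
Proof.
apply/matrixP => i j; rewrite !mxE !big_ord_recl big_ord0 !mxE.
by case: x => -[|[|[|[|x]]]] xm /=; elim/ord2_ind: i; elim/ord2_ind: j => /=;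
  ring.
Qed.

Lemma sum_twirl a : \sum_x twirl x a = (\tr a *+ 2)%:M.
Proof.
rewrite !big_ord_recl big1 => [|x _]; last first.
  by rewrite /twirl pauli_eq0 ?mul0mx.
apply/matrixP => i j; rewrite !mxE /mxtrace !big_ord_recl !big_ord0 !mxE.
rewrite !big_ord_recl !big_ord0 !mxE.
by elim/ord2_ind: i; elim/ord2_ind: j => /=; ring.
Qed.

Lemma twirlM x a b : twirl x a * twirl x b = twirl x (a * b).
Proof.
rewrite /twirl -!mulmxE !mulmxA -(mulmxA _ _^T) pauli_orth.
case: ltnP => h; first by rewrite mulmx1.
by rewrite pauli_eq0 ?mul0mx.
Qed.

(* By sum_twirl and twirlM, at the tensor of a partition p this is, up to a power
   of 2, the product over the blocks of p of the traces of the products of the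
   entries of u. *)
Definition twirled k f u : 'M[C]_2 :=
  lsum k (fun l => f l *: \prod_(p <- zip l u) twirl p.1 p.2).

Lemma twirl_prod_cat (l l' : seq X) u v : size l = size u ->
  \prod_(p <- zip (l ++ l') (u ++ v)) twirl p.1 p.2 =
  (\prod_(p <- zip l u) twirl p.1 p.2) * \prod_(p <- zip l' v) twirl p.1 p.2.
Proof. by move=> lu; rewrite zip_cat // big_cat. Qed.

Lemma twirled_scale k f u c a v : (size (u ++ v)).+1 = k ->
  twirled k f (u ++ c *: a :: v) = c *: twirled k f (u ++ a :: v).
Proof.
rewrite size_cat -addnS => <-; rewrite /twirled !lsum_cat lsum_scaler.
apply: eq_lsum => t ts; rewrite lsum_scaler; apply: eq_lsum => -[//|x t'] _.
rewrite !twirl_prod_cat //= !big_cons /= scalerA mulrC -scalerA; congr (_ *: _).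
by rewrite /twirl -scalemxAr -!scalemxAl -scalerAl -scalerAr.
Qed.

(** Summing over the free letter turns its factor into a scalar matrix by [sum_twirl], which leaves
    the product. In [twirled_fork] two neighbouring factors carry the same letter, and [twirlM]
    fuses them. *)
Lemma twirled_ins k s f u a v : size u = s -> size (u ++ v) = k ->
  twirled k.+1 (ins s f) (u ++ a :: v) = (\tr a *+ 2) *: twirled k f (u ++ v).
Proof.
move=> us; rewrite size_cat us => <-; rewrite /twirled -addnS !lsum_cat.
rewrite lsum_scaler; apply: eq_lsum => t ts; rewrite lsumS -lsum_exchange.
rewrite lsum_scaler; apply: eq_lsum => t' _.
rewrite twirl_prod_cat ?us // scalerA mulrC -scalerA.
set A := \prod_(p <- zip t u) _; set B := \prod_(p <- zip t' v) _.
rewrite (eq_bigr (fun x => f (t ++ t') *: (A * (twirl x a * B)))) => [|x _].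
  rewrite -scaler_sumr -mulr_sumr -mulr_suml sum_twirl; congr (_ *: _).
  by rewrite -mulmxE mul_scalar_mx -scalemxAr.
rewrite twirl_prod_cat ?us //= big_cons /= /ins /del take_size_cat //.
by rewrite -cat_rcons drop_size_cat ?size_rcons ?ts.
Qed.

Lemma twirled_fork k s f u a b v : size u = s -> (size (u ++ v)).+1 = k ->
  twirled k.+1 (fork ord0 s f) (u ++ a :: b :: v) = twirled k f (u ++ a * b :: v).
Proof.
move=> us; rewrite size_cat us -addnS => <-; rewrite /twirled -addnS !lsum_cat.
apply: eq_lsum => t ts; rewrite !lsumS; apply: eq_bigr => x _; rewrite lsumS.
rewrite -lsum_exchange; apply: eq_lsum => t' _.
rewrite (bigD1 x) //= [X in _ + X]big1 => [|y /negbTE yx].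
  rewrite addr0 /fork !nth_cat -ts ltnn subnn ltnNge leqnSn subSnn /= eqxx mul1r.
  have -> : del (size t).+1 (t ++ [:: x, x & t']) = t ++ x :: t'.
    by rewrite -(addn1 (size t)) del_catr /del /= drop0.
  rewrite !zip_cat ?ts // !big_cat /= !big_cons /=; congr (_ *: (_ * _)).
  by rewrite mulrA twirlM.
rewrite /fork !nth_cat -ts ltnn subnn ltnNge leqnSn subSnn /= eq_sym yx mul0r.
by rewrite scale0r.
Qed.

(** In [munit] the column index is negated, so that trace and product both contract two letters
    exactly when they differ, as an opening with a closing. *)
Definition bidx (c : bool) : 'I_2 := if c then ord0 else lift ord0 ord0.
Definition munit (c c' : bool) : 'M[C]_2 := delta_mx (bidx c) (bidx (~~ c')).

Lemma tr_munit c c' : \tr (munit c c') = (c != c')%:R.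
Proof.
rewrite /mxtrace !big_ord_recl big_ord0 !mxE.
by case: c; case: c' => /=; rewrite ?addr0 ?add0r.
Qed.

Lemma munitM c c1 c2 c' : munit c c1 * munit c2 c' = (c1 != c2)%:R *: munit c c'.
Proof.
rewrite /munit -mulmxE mul_delta_mx_cond.
by case: c1; case: c2 => /=; rewrite ?scale0r ?scale1r ?mulr0n ?mulr1n.
Qed.

Fixpoint munits d : seq 'M[C]_2 :=
  if d is c :: c' :: d' then munit c c' :: munits d' else [::].

Lemma munits_cat s (d d' : seq bool) : size d = s.*2 ->
  munits (d ++ d') = munits d ++ munits d' /\ size (munits d) = s.
Proof.
elim: s d => [|s IH] [|c [|c' d]] //=; rewrite doubleS => -[] /IH [-> ->] //.
Qed.

(** Triangularity. Each reduction of [e] contracts two adjacent letters, which must differ for a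
    nonzero value; choosing [true], [false] every time produces [word k e], and [bin_insert] shows
    that this choice is the greatest. *)
Lemma twirled_word k e : nceq k e ->
  (forall d, size d = k.*2 ->
     twirled k (fun l => (delta ord0 e l)%:R) (munits d) != 0 ->
     (bin d <= bin (word k e))%N) /\
  twirled k (fun l => (delta ord0 e l)%:R) (munits (word k e)) != 0.
Proof.
move: k e; apply: nceq_ind => [e ek|k e s ek sk es epk [IH1 IH2]|
  k e s ek sk es epk [IH1 IH2]].
- split; first by case.
  by rewrite /twirled lsum0 /= big_nil scale1r oner_neq0.
- have E d1 c c' d2 : size d1 = s.*2 -> size d2 = (k - s).*2 ->
      twirled k.+1 (fun l => (delta ord0 e l)%:R) (munits (d1 ++ [:: c, c' & d2])) =
      ((c != c')%:R *+ 2) *: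
      twirled k (fun l => (delta ord0 (pull s e) l)%:R) (munits (d1 ++ d2)).
    move=> d1s d2s; have [-> ms] := munits_cat [:: c, c' & d2] d1s.
    have [-> _] := munits_cat d2 d1s; rewrite /= -tr_munit -(twirled_ins _ _ ms).
      apply: eq_lsum => l lk; congr (_ *: _).
      by rewrite (delta_singleton ord0 ek sk es lk).
    have [] := @munits_cat (k - s) d2 [::] d2s; rewrite size_cat ms => _ ->; lia.
  rewrite (word_singleton sk ek es); set w := word k _ in IH1 IH2 *.
  have ws : size w = k.*2 by rewrite size_word.
  have tw : size (take s.*2 w) = s.*2 by rewrite size_take_min ws; lia.
  have dw : size (drop s.*2 w) = (k - s).*2 by rewrite size_drop ws; lia.
  split; last by rewrite E // cat_take_drop scaler_eq0 (negbTE IH2) orbF pnatr_eq0.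
  move=> d dk; have [d1 [d2' [-> d1s]]] := @split_size _ s.*2 (k - s).*2.+2 d ltac:(lia).
  case: d2' => [|c [|c' d2]] //= [d2s]; rewrite E // scaler_eq0 negb_or.
  case: (c =P c') => [->|/eqP cc]; first by rewrite mul0rn eqxx.
  move=> /andP[_ /IH1] h; apply: bin_insert; rewrite ?tw ?dw //.
  by rewrite cat_take_drop; apply: h; rewrite size_cat d1s d2s; lia.
(* Here the contracted pair [c], [c'] straddles two matrix units, so the outer letters [c0] and
   [c1], which survive as one matrix unit, are named apart. *)
- have E d1 c0 c c' c1 d2 : size d1 = s.*2 -> size d2 = (k - s.+1).*2 ->
      twirled k.+1 (fun l => (delta ord0 e l)%:R)
        (munits ((d1 ++ [:: c0]) ++ [:: c, c', c1 & d2])) =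
      (c != c')%:R *:
      twirled k (fun l => (delta ord0 (pull s.+1 e) l)%:R)
        (munits ((d1 ++ [:: c0]) ++ c1 :: d2)).
    move=> d1s d2s; rewrite -!catA.
    have [-> ms] := munits_cat ([:: c0] ++ [:: c, c', c1 & d2]) d1s.
    have [-> _] := munits_cat ([:: c0] ++ c1 :: d2) d1s; rewrite /=.
    have sz : (size (munits d1 ++ munits d2)).+1 = k.
      have [] := @munits_cat (k - s.+1) d2 [::] d2s.
      rewrite size_cat ms => _ ->; lia.
    rewrite (_ : twirled _ _ _ = twirled k.+1 (fork ord0 s (fun l => (delta ord0 (pull s.+1 e) l)%:R)) (munits d1 ++ [:: munit c0 c, munit c' c1 & munits d2])).
      by rewrite (twirled_fork _ _ _ ms sz) munitM twirled_scale.
    apply: eq_lsum => l lk; congr (_ *: _).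
    by rewrite (delta_adjacent ord0 ek sk es lk) /fork -natrM mulnb.
  rewrite (word_adjacent sk ek es); set w := word k _ in IH1 IH2 *.
  have ws : size w = k.*2 by rewrite size_word.
  have split_word d (dk : size d = k.*2) : exists d1 c0 c1 d2,
      [/\ d = (d1 ++ [:: c0]) ++ c1 :: d2, size d1 = s.*2 & size d2 = (k - s.+1).*2].
    have [d1 [d2 [-> d1s]]] := @split_size _ s.*2 (k - s.+1).*2.+2 d ltac:(lia).
    case: d2 => [|c0 [|c1 d2]] //= [d2s]; exists d1, c0, c1, d2.
    by rewrite -catA.
  split.
    move=> d dk; have [d1 [d2' [-> d1s]]] := @split_size _ s.*2 (k - s.+1).*2.+4 d ltac:(lia).
    case: d2' => [|c0 [|c [|c' [|c1 d2]]]] //= [d2s].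
    rewrite -[d1 ++ _]/(d1 ++ [:: c0] ++ [:: c, c', c1 & d2]) catA E //.
    rewrite scaler_eq0 negb_or; case: (c =P c') => [->|/eqP cc]; first by rewrite eqxx.
    move=> /andP[_ /IH1] h; apply: bin_insert => //.
    + by rewrite size_cat size_take_min ws d1s /=; lia.
    + by rewrite size_drop ws /= d2s; lia.
    + by rewrite cat_take_drop; apply: h; rewrite !size_cat /= d1s d2s; lia.
  have [d1 [c0 [c1 [d2 [wE d1s d2s]]]]] := split_word _ ws.
  rewrite wE take_size_cat ?drop_size_cat ?size_cat ?d1s ?addn1 //.
  by rewrite E // -wE scale1r.
Qed.

End PauliTwirl.

Section Independence.
Variables (C : numClosedFieldType) (m k : nat).
Local Notation X := 'I_m.+4.
Implicit Types (p q : NC k) (l : seq X).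

Lemma word_ncrel_inj p q : word k (ncrel p) = word k (ncrel q) -> p = q.
Proof.
move=> pq; apply: ncrel_inj; apply: word_inj; try exact: nceq_ncrel.
move=> a ak; have := congr1 (fun w => (nth true w a.*2, nth true w a.*2.+1)) pq.
rewrite !nth_mkseq; try lia.
by rewrite /wbit oddS odd_double /= uphalf_double doubleK => -[-> /negb_inj ->].
Qed.

(** Among the nonzero coefficients take [p] with the greatest word and test the relation on that
    word. Any other [q] that contributes has a word at least as great, hence equal, so [q = p]. *)
Lemma delta_indep (c : NC k -> C) :
  (forall l, size l = k -> \sum_p c p * (delta ord0 (ncrel p) l)%:R = 0) ->
  forall p, c p = 0.
Proof.
move=> c0 p; apply/eqP/negPn/negP => cp.
case: (@arg_maxnP _ p (fun q => c q != 0) (fun q => bin (word k (ncrel q))) cp).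
move=> {cp} {}p cp pmax; set w := munits C (word k (ncrel p)).
have : twirled k (fun l => \sum_q c q * (delta (ord0 : X) (ncrel q) l)%:R) w = 0.
  by rewrite /twirled /lsum big1 // => l _; rewrite c0 ?scale0r ?size_tuple.
rewrite /twirled (_ : lsum _ _ =
    \sum_q c q *: twirled k (fun l => (delta (ord0 : X) (ncrel q) l)%:R) w); last first.
  under [RHS]eq_bigr => q _ do rewrite /twirled lsum_scaler.
  rewrite -lsum_exchange; apply: eq_lsum => l _.
  by rewrite scaler_suml; apply: eq_bigr => q _; rewrite scalerA.
rewrite (bigD1 p) //= big1 => [|q qp].
  have [_ /negbTE nz] := @twirled_word C m _ _ (nceq_ncrel p).
  by rewrite addr0 => /eqP; rewrite scaler_eq0 nz orbF (negbTE cp).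
apply/eqP; rewrite scaler_eq0; apply/norP => -[cq tq].
have [/(_ (word k (ncrel p))) + _] := @twirled_word C m _ _ (nceq_ncrel q).
rewrite size_word => /(_ erefl tq) h1; have h2 := pmax _ cq.
move/eqP: qp; apply; apply: word_ncrel_inj; apply: bin_inj.
  by rewrite !size_word.
by apply/eqP; rewrite eqn_leq h1 andbT; exact: h2.
Qed.

End Independence.

(** * Powers of n as inner products of partition vectors *)

Section Gram.
Variables (k n : nat).
Implicit Types (p q r : {set {set 'I_k}}) (i : {ffun 'I_k -> 'I_n}).

Definition blockconst p i : bool :=
  [forall B in p, forall s in B, forall t in B, i s == i t].

Lemma blockconstP p i :
  reflect (forall B, B \in p -> {in B &, forall s t, i s = i t}) (blockconst p i).
Proof.
apply: (iffP forall_inP) => [H B Bp s t sB tB|H B Bp].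
  by apply/eqP; have /forall_inP/(_ s sB)/forall_inP/(_ t tB) := H B Bp.
by apply/forall_inP => s sB; apply/forall_inP => t tB; apply/eqP/(H B).
Qed.

Lemma blockconst_join p q i : is_part p -> is_part q ->
  blockconst (pjoin p q) i = blockconst p i && blockconst q i.
Proof.
move=> Pp Pq; have /and4P[Pr rp rq /forallP rmin] := pjoinP Pp Pq.
set r := pjoin p q in Pr rp rq rmin *.
have sub p' : coarser r p' -> blockconst r i -> blockconst p' i.
  move=> /forall_inP rp' /blockconstP ri; apply/blockconstP => B Bp s t sB tB.
  have /exists_inP[B' B'r /subsetP BB'] := rp' B Bp.
  by apply: (ri B') => //; apply: BB'.
apply/idP/andP => [ri|[pi qi]]; first by split; apply: sub.
(* The level sets of [i] form an upper bound of [p] and [q], hence lie above their join. *)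
pose s := preim_partition i [set: 'I_k].
have Ps : partition s [set: 'I_k] := preim_partitionP i _.
have cs p' : is_part p' -> blockconst p' i -> coarser s p'.
  move=> Pp' /blockconstP p'i; apply/forall_inP => B Bp'.
  have [_ _ p'0] := and3P Pp'.
  have /set0Pn[x xB] : B != set0 by apply: contraNneq p'0 => <-.
  apply/exists_inP; exists (pblock s x).
    by rewrite pblock_mem // (cover_partition Ps) inE.
  apply/subsetP => y yB; rewrite pblock_equivalence_partition ?inE //.
    by rewrite (p'i _ Bp' x y).
  by move=> a b c _ _ _; split=> // /eqP->.
have /implyP/(_ _)/forall_inP sr := rmin s.
apply/blockconstP => B Br x y xB yB.
have /exists_inP[D Ds /subsetP BD] : [exists B' in s, B \subset B'].
  by apply: sr => //; rewrite /is_part Ps !cs.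
have [_ ts _] := and3P Ps.
have := BD y yB; rewrite -(def_pblock ts Ds (BD x xB)).
rewrite pblock_equivalence_partition ?inE //; first by move/eqP.
by move=> a b c _ _ _; split=> // /eqP->.
Qed.

Lemma card_blockconst r : is_part r ->
  #|[set i | blockconst r i]| = (n ^ #|r|)%N.
Proof.
move=> Pr; have [_ tr r0] := and3P Pr.
have cr x : pblock r x \in r by rewrite pblock_mem // (cover_partition Pr) inE.
pose S : finType := {B | B \in r}.
pose blk x : S := Sub (pblock r x) (cr x).
pose ph (g : {ffun S -> 'I_n}) := [ffun x => g (blk x)].
have blkP (B : S) : exists x, blk x = B.
  have /set0Pn[x xB] : val B != set0.
    by apply: contraNneq r0 => <-; apply: valP.
  by exists x; apply: val_inj => /=; apply: def_pblock xB => //; apply: valP.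
have ph_inj : injective ph.
  move=> g g' /ffunP gg; apply/ffunP => B; have [x <-] := blkP B.
  by have := gg x; rewrite !ffunE.
have -> : [set i | blockconst r i] = ph @: [set: {ffun S -> 'I_n}].
  apply/setP => i; rewrite inE; apply/blockconstP/imsetP => [H|[g _ ->]].
    have [w wP] := choice blkP.
    exists [ffun B => i (w B)] => //; apply/ffunP => x; rewrite !ffunE.
    apply: (H _ (cr x)); first by rewrite mem_pblock (cover_partition Pr) inE.
    have /(congr1 val) /= <- := wP (blk x).
    by rewrite mem_pblock (cover_partition Pr) inE.
  move=> B Br s t sB tB; rewrite !ffunE; congr (g _); apply: val_inj => /=.
  by rewrite (def_pblock tr Br sB) (def_pblock tr Br tB).
rewrite card_imset // cardsT card_ffun card_ord card_sig.
by congr (_ ^ _)%N; apply: eq_card.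
Qed.

End Gram.

Section GramMatrix.
Variables (R : realType) (k n : nat).
Local Notation N := #|{: NC k}|.

(** The power of [n] counts the multi-indices constant on the blocks of the join, which are those
    constant on the blocks of both partitions. *)
Lemma gramE (a b : 'I_N) : gram R k n a b =
  \sum_(i : {ffun 'I_k -> 'I_n}) pdelta R (enum_val a) i * pdelta R (enum_val b) i.
Proof.
have PP (p : NC k) : is_part (val p) by case: p => p /= /andP[].
rewrite mxE -natrX -card_blockconst; last first.
  by have /and4P[] := pjoinP (PP (enum_val a)) (PP (enum_val b)).
rewrite -sum1_card natr_sum big_mkcond /=; apply: eq_bigr => i _.
rewrite inE blockconst_join; [|exact: PP|exact: PP].
have E p : pdelta R p i = (blockconst (val p) i)%:R by [].
by rewrite !E; do 2! case: blockconst; rewrite ?mulr0 ?mulr1 ?mul0r.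
Qed.

End GramMatrix.

(** * The Gram matrix and the projection onto planar tensors *)

Lemma lsum_ffun (X : finType) (V : nmodType) k (F : seq X -> V) :
  lsum k F = \sum_(i : {ffun 'I_k -> X}) F (codom i).
Proof.
rewrite /lsum (reindex (fun i : {ffun 'I_k -> X} => [tuple i s | s < k])) /=.
  by apply: eq_bigr => i _.
exists (fun t : k.-tuple X => [ffun s => tnth t s]) => [i _|t _].
  by apply/ffunP => s; rewrite ffunE tnth_mktuple.
by apply: eq_from_tnth => s; rewrite tnth_mktuple ffunE.
Qed.

Section GramUnit.
Variables (R : realType) (k m : nat).
Local Notation n := m.+4.
Local Notation N := #|{: NC k}|.
Local Notation C := R[i].

Lemma nth_codom (i : {ffun 'I_k -> 'I_n}) (s : 'I_k) : nth ord0 (codom i) s = i s.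
Proof. by rewrite (nth_map s) ?nth_ord_enum // size_enum_ord. Qed.

Lemma pdelta_codom (p : NC k) (i : {ffun 'I_k -> 'I_n}) :
  pdelta R p i = (delta ord0 (ncrel p) (codom i))%:R.
Proof.
congr (nat_of_bool _)%:R; apply/(@blockconstP k n (val p) i)/deltaP => H.
  move=> s t; rewrite size_codom card_ord => sk tk; rewrite ncrelE => st.
  have := H _ (NC_mem p (Ordinal sk)) (Ordinal sk) (Ordinal tk) (NC_self _ _) st.
  by rewrite -!nth_codom.
move=> B Bp s t sB tB; rewrite -!nth_codom; apply: H.
- by rewrite size_codom card_ord.
- by rewrite size_codom card_ord.
- by rewrite ncrel_ord (def_pblock (NC_triv p) Bp sB).
Qed.

Lemma gram_lsum (p q : NC k) : gram R k n (enum_rank p) (enum_rank q) =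
  lsum k (fun l : seq 'I_n => (delta ord0 (ncrel p) l)%:R * (delta ord0 (ncrel q) l)%:R).
Proof.
rewrite gramE lsum_ffun; apply: eq_bigr => i _.
by rewrite !enum_rankK !pdelta_codom.
Qed.

(** A row vector killed by the Gram matrix gives a combination [S] of partition tensors of squared
    norm zero; [S] then vanishes on every word, and [delta_indep] applies. *)
Lemma gram_unit : gram R k n \in unitmx.
Proof.
rewrite -row_free_unit; apply: inj_row_free => v vG.
pose S (l : seq 'I_n) : C :=
  \sum_(p : NC k) v 0 (enum_rank p) * (delta ord0 (ncrel p) l)%:R.
have S0 : lsum k (fun l => S l * (S l)^*) = 0.
  have E l : S l * (S l)^* = \sum_(q : NC k) (v 0 (enum_rank q))^* *
     \sum_(p : NC k) v 0 (enum_rank p) *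
        ((delta ord0 (ncrel p) l)%:R * (delta ord0 (ncrel q) l)%:R).
    rewrite [in X in _ * X]/S rmorph_sum mulr_sumr; apply: eq_bigr => q _.
    rewrite rmorphM rmorph_nat mulrCA /S mulr_suml; congr (_ * _).
    by apply: eq_bigr => p _; rewrite mulrA.
  rewrite (funext E).
  rewrite lsum_exchange big1 // => q _.
  rewrite /lsum -mulr_sumr exchange_big /=.
  have /rowP/(_ (enum_rank q)) := vG; rewrite !mxE => vq.
  rewrite [X in _ * X](_ : _ = 0) ?mulr0 // -[RHS]vq.
  rewrite (reindex _ (onW_bij _ (@enum_rank_bij (NC k)))) /=.
apply: eq_bigr => p _.
  by rewrite gram_lsum /lsum mulr_sumr.
have SI l : size l = k -> S l = 0.
  move=> /eqP lk; move/eqP: S0; rewrite /lsum psumr_eq0 => [|t _]; last exact: mul_conjC_ge0.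
  move=> /allP/(_ (Tuple lk)); rewrite mem_index_enum => /(_ isT)/=.
  by rewrite mul_conjC_eq0 => /eqP.
have v0 := @delta_indep _ m k (fun p => v 0 (enum_rank p)) SI.
by apply/rowP => a; rewrite -(enum_valK a) v0 mxE.
Qed.

(** The kernel of the projection Q. Positivity and the moment relations rest on four of its
    properties: it is planar in [I], symmetric, real, and reproduces planar tensors
    ([wproj_repr]). *)
Definition wproj (I J : seq 'I_n) : C :=
  \sum_(p : NC k) \sum_(q : NC k) (delta ord0 (ncrel p) I)%:R *
     (delta ord0 (ncrel q) J)%:R * weingarten R n p q.

Lemma weingarten_sym (p q : NC k) : weingarten R n p q = weingarten R n q p.
Proof.
rewrite /weingarten -[in LHS](trmxK (invmx _)) mxE trmx_inv; congr (invmx _ _ _).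
apply/matrixP => a b; rewrite mxE !gramE.
by apply: eq_bigr => i _; rewrite mulrC.
Qed.

Lemma weingarten_real (p q : NC k) : (weingarten R n p q)^* = weingarten R n p q.
Proof.
have := map_invmx (Num.conj : {rmorphism C -> C}) (gram R k n).
move=> /matrixP/(_ (enum_rank p) (enum_rank q)); rewrite mxE => ->.
congr (invmx _ _ _); apply/matrixP => a b; rewrite !mxE.
by rewrite rmorphXn rmorph_nat.
Qed.

Lemma wproj_sym I J : wproj I J = wproj J I.
Proof.
rewrite /wproj exchange_big /=; apply: eq_bigr => p _; apply: eq_bigr => q _.
by rewrite weingarten_sym (mulrC _%:R).
Qed.

Lemma wproj_conj I J : (wproj I J)^* = wproj I J.
Proof.
rewrite /wproj rmorph_sum; apply: eq_bigr => p _; rewrite rmorph_sum.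
by apply: eq_bigr => q _; rewrite !rmorphM !rmorph_nat /= weingarten_real.
Qed.

Lemma wproj_planar J : planar ord0 k (wproj ^~ J).
Proof.
apply: planar_sum => p _; apply: planar_sum => q _.
apply: planar_ext (planarZ ((delta ord0 (ncrel q) J)%:R * weingarten R n p q)
  (planar_delta C ord0 (nceq_ncrel p))) => I _.
by rewrite mulrC mulrA.
Qed.

Lemma wproj_delta (r : NC k) I :
  lsum k (fun J => wproj I J * (delta ord0 (ncrel r) J)%:R) =
  (delta ord0 (ncrel r) I)%:R.
Proof.
transitivity (\sum_(p : NC k) (delta ord0 (ncrel p) I)%:R * (p == r)%:R : C).
  rewrite (eq_lsum (G := fun J => \sum_(p : NC k) (delta ord0 (ncrel p) I)%:R *
    \sum_(q : NC k) weingarten R n p q *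
      ((delta ord0 (ncrel q) J)%:R * (delta ord0 (ncrel r) J)%:R))) => [|J _]; last first.
    rewrite /wproj mulr_suml; apply: eq_bigr => p _; rewrite mulr_suml mulr_sumr.
    by apply: eq_bigr => q _; ring.
  rewrite lsum_exchange; apply: eq_bigr => p _.
  rewrite /lsum -mulr_sumr exchange_big /=; congr (_ * _).
  have /matrixP/(_ (enum_rank p) (enum_rank r)) := mulVmx gram_unit.
  rewrite !mxE (inj_eq enum_rank_inj) => <-.
  rewrite (reindex _ (onW_bij _ (@enum_rank_bij (NC k)))) /=; apply: eq_bigr => q _.
  by rewrite gram_lsum /lsum mulr_sumr.
rewrite (bigD1 r) //= eqxx mulr1 big1 ?addr0 // => p /negbTE->.
by rewrite mulr0.
Qed.

Lemma wproj_repr f I : planar ord0 k f -> size I = k ->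
  lsum k (fun J => wproj I J * f J) = f I.
Proof.
move=> /planar_inspan[c fc] Ik; rewrite (fc _ Ik).
rewrite (eq_lsum (G := fun J => \sum_p c p * (wproj I J * (delta ord0 (ncrel p) J)%:R))).
  rewrite lsum_exchange; apply: eq_bigr => p _.
  by rewrite lsum_mulr wproj_delta.
move=> J Jk; rewrite fc // mulr_sumr.
by apply: eq_bigr => p _; rewrite mulrCA.
Qed.

End GramUnit.

(** * Positivity of the Weingarten moments *)

Section ExpectationPositive.
Variables (C : numClosedFieldType) (N : nat).
Local Notation M := 'M[C]_N.
Implicit Types (e x y c z : M) (i j k l r : 'I_N).

Definition mxadj x : M := \matrix_(i, j) (x j i)^*.

(** [K] is the reproducing kernel of [E] for the Hilbert-Schmidt product. Equivalently [K j j'] is F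
    applied to the matrix unit at j, j', where F is the orthogonal projection onto the span of
    [E]. *)
Variables (E : M -> Prop) (K : 'I_N -> 'I_N -> M).
Hypotheses (E_one : E 1%:M) (E_mul : forall x y, E x -> E y -> E (x *m y))
  (E_adj : forall x, E x -> E (mxadj x)).
Hypotheses (K_herm : forall i i' j j', K j j' i i' = (K i i' j j')^*)
  (E_K : forall j j', E (K j j'))
  (K_repr : forall x, E x -> forall i i',
     \sum_j \sum_j' x j j' * K j j' i i' = x i i').

(** The module property e F(x) = F(e x) at a matrix unit, obtained by reproducing [e *m K j j'] and
    [mxadj e *m K k i'], which both lie in [E]. *)
Lemma expectation_mull e j j' k i' : E e ->
  (e *m K j j') k i' = \sum_r e r j * K r j' k i'.
Proof.
move=> Ee; rewrite -(K_repr (E_mul Ee (E_K j j'))).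
have := K_repr (E_mul (E_adj Ee) (E_K k i')) j j'.
move=> /(congr1 Num.conj); rewrite mxE !rmorph_sum /=.
under eq_bigr => i _ do rewrite rmorph_sum.
move=> H.
transitivity (\sum_r (((mxadj e) j r) * K k i' r j')^*); last first.
  by apply: eq_bigr => r _; rewrite mxE rmorphM /= conjCK -K_herm.
rewrite -{}H exchange_big /= [RHS]exchange_big /=; apply: eq_bigr => r' _.
under eq_bigr => r _ do rewrite mxE mulr_suml.
rewrite exchange_big /=; apply: eq_bigr => i _.
rewrite mxE mulr_suml rmorph_sum; apply: eq_bigr => r _.
by rewrite mxE !rmorphM /= conjCK -!K_herm mulrAC.
Qed.

(** F commutes with adjunction because [E] is stable under it. *)
Lemma K_adj i i' j j' : K j' j i' i = (K j j' i i')^*.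
Proof.
have := K_repr (E_adj (E_K j j')) i' i; rewrite mxE => <-.
have := K_repr (E_adj (E_K i' i)) j j'; rewrite mxE -K_herm => <-.
rewrite exchange_big /=; apply: eq_bigr => r _; apply: eq_bigr => r' _.
by rewrite !mxE -!K_herm mulrC.
Qed.

(** The Choi matrix of F acting on [c] read as a vector: its coefficient between the pairs (i, j)
    and (i', j') is [K j j' i i']. *)
Definition smear c : M := \matrix_(i, j) \sum_j' (K j j' *m c) i j'.

Lemma smear_comm e c : E e -> e *m smear c = smear c *m e.
Proof.
move=> Ee; apply/matrixP => k j; rewrite !mxE.
transitivity (\sum_j' (e *m K j j' *m c) k j').
  under eq_bigr => i _ do rewrite mxE mulr_sumr.
  by rewrite exchange_big /=; apply: eq_bigr => j' _; rewrite -mulmxA mxE.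
under [RHS]eq_bigr => r _ do rewrite mxE mulr_suml.
rewrite [RHS]exchange_big /=; apply: eq_bigr => j' _; rewrite mxE.
under [RHS]eq_bigr => r _ do rewrite mxE mulr_suml.
rewrite [RHS]exchange_big /=; apply: eq_bigr => i' _.
rewrite expectation_mull // mulr_suml.
by apply: eq_bigr => r _; ring.
Qed.

Lemma smear_commutant y : (forall e, E e -> e *m y = y *m e) ->
  smear y = y *m smear 1%:M.
Proof.
move=> yE; apply/matrixP => i j; rewrite !mxE.
under [RHS]eq_bigr => l _ do rewrite mxE mulr_sumr.
rewrite [RHS]exchange_big /=; apply: eq_bigr => j' _.
by rewrite yE // mxE; apply: eq_bigr => l _; rewrite mulmx1.
Qed.

Lemma smear_adj c y : \sum_i \sum_j (c i j)^* * smear y i j =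
  \sum_i \sum_j (smear c i j)^* * y i j.
Proof.
transitivity (\sum_i \sum_j \sum_j' \sum_i' (c i j)^* * (K j j' i i' * y i' j')).
  apply: eq_bigr => i _; apply: eq_bigr => j _; rewrite mxE mulr_sumr.
  by apply: eq_bigr => j' _; rewrite mxE mulr_sumr.
transitivity (\sum_i \sum_j \sum_j' \sum_i' (K j j' i i' * c i' j')^* * y i j);
  last first.
  apply: eq_bigr => i _; apply: eq_bigr => j _; rewrite mxE rmorph_sum mulr_suml.
  by apply: eq_bigr => j' _; rewrite mxE rmorph_sum mulr_suml.
under eq_bigr => i _.
  under eq_bigr => j _ do rewrite exchange_big.
  rewrite exchange_big /=.
over.
rewrite exchange_big /=; apply: eq_bigr => i _.
under eq_bigr => i' _ do rewrite exchange_big.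
rewrite exchange_big /=; apply: eq_bigr => j _.
rewrite exchange_big /=; apply: eq_bigr => j' _; apply: eq_bigr => i' _.
by rewrite rmorphM /= -K_adj; ring.
Qed.

(** Reproducing the member [K j j'] of [E] by itself splits each coefficient into a product of two,
    and the form becomes a sum of squares. *)
Lemma smear1_form (v : 'I_N -> C) :
  \sum_i \sum_j (v i)^* * smear 1%:M i j * v j =
  \sum_j' \sum_r \sum_r' `|\sum_j v j * K j j' r r'| ^+ 2.
Proof.
transitivity (\sum_i \sum_j \sum_j' (v i)^* * v j * K j j' i j').
  apply: eq_bigr => i _; apply: eq_bigr => j _; rewrite mxE.
  by rewrite mulr_sumr mulr_suml; apply: eq_bigr => j' _; rewrite mulmx1; ring.
under eq_bigr => i _ do rewrite exchange_big.
rewrite exchange_big /=; apply: eq_bigr => j' _.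
transitivity (\sum_r \sum_r' \sum_i \sum_j
    (v i * K i j' r r')^* * (v j * K j j' r r')); last first.
  apply: eq_bigr => r _; apply: eq_bigr => r' _.
  rewrite normCKC rmorph_sum mulr_suml; apply: eq_bigr => i _.
  by rewrite mulr_sumr.
under [RHS]eq_bigr => r _ do rewrite exchange_big.
rewrite [RHS]exchange_big /=; apply: eq_bigr => i _.
under [RHS]eq_bigr => r _ do rewrite exchange_big.
rewrite [RHS]exchange_big /=; apply: eq_bigr => j _.
rewrite -(K_repr (E_K j j')) mulr_sumr; apply: eq_bigr => r _.
rewrite mulr_sumr; apply: eq_bigr => r' _.
by rewrite rmorphM /= -K_herm; ring.
Qed.

Lemma smear1_ge0 (v : 'I_N -> C) :
  0 <= \sum_i \sum_j (v i)^* * smear 1%:M i j * v j.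
Proof.
rewrite smear1_form; do 3! apply: sumr_ge0 => ? _.
by rewrite exprn_ge0.
Qed.

Lemma smear1_unit : smear 1%:M \in unitmx.
Proof.
rewrite -unitmx_tr -row_free_unit; apply: inj_row_free => v vz.
have form0 : \sum_i \sum_j (v 0 i)^* * smear 1%:M i j * v 0 j = 0.
  apply: big1 => i _; have /rowP/(_ i) := vz; rewrite !mxE => vi.
  under eq_bigr => j _ do rewrite -mulrA.
  rewrite -mulr_sumr (_ : \sum_j _ = 0) ?mulr0 // -[RHS]vi.
  by apply: eq_bigr => j _; rewrite [in RHS]mxE mulrC.
move/eqP: form0; rewrite smear1_form psumr_eq0 => [|j' _]; last first.
  by do 2! apply: sumr_ge0 => ? _; rewrite exprn_ge0.
move=> /allP P0.
have vK j' r r' : \sum_j v 0 j * K j j' r r' = 0.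
  have := P0 j'; rewrite mem_index_enum => /(_ isT)/=.
  rewrite psumr_eq0 => [|? _]; last by apply: sumr_ge0 => ? _; rewrite exprn_ge0.
  move=> /allP/(_ r); rewrite mem_index_enum => /(_ isT)/=.
  rewrite psumr_eq0 => [|? _]; last by rewrite exprn_ge0.
  move=> /allP/(_ r'); rewrite mem_index_enum => /(_ isT)/=.
  by rewrite sqrf_eq0 normr_eq0 => /eqP.
apply/rowP => j; rewrite mxE.
transitivity (\sum_r \sum_l v 0 l * K l j r r); last first.
  by rewrite big1 // => r _; rewrite vK.
rewrite exchange_big /= (bigD1 j) //=.
(* F preserves the trace because 1 lies in [E]; taking traces in [vK] then isolates each coordinate
   of [v]. *)
have trK l : \sum_r K l j r r = (l == j)%:R.
  have /(congr1 Num.conj) := K_repr E_one l j; rewrite mxE rmorph_nat => <-.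
  rewrite rmorph_sum; apply: eq_bigr => r _.
  rewrite (bigD1 r) //= mxE eqxx mul1r big1 => [|s /negbTE sr].
    by rewrite addr0 -K_herm.
  by rewrite mxE eq_sym sr mul0r.
rewrite -mulr_sumr trK eqxx mulr1 big1 ?addr0 // => l /negbTE lj.
by rewrite -mulr_sumr trK lj mulr0.
Qed.

(* With z = smear 1, invertible and positive in the commutant of E, the element
   y = smear c * z^-1 of the commutant satisfies smear y = smear c, whence
   <c, smear c> = <smear c, y> = <y z, y> >= 0. *)
Lemma smear_ge0 c : 0 <= \sum_i \sum_j (c i j)^* * smear c i j.
Proof.
set z := smear 1%:M; pose y := smear c *m invmx z.
have zU : z \in unitmx := smear1_unit.
have yE e : E e -> e *m y = y *m e.
  move=> Ee; have ez : e *m invmx z = invmx z *m e.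
    apply: (can_inj (mulKmx zU)); apply: (can_inj (mulmxK zU)).
    rewrite mulmxA -(smear_comm _ Ee) -/z !mulmxA.
    by rewrite !mulmxK // mulmxV // mul1mx (smear_comm _ Ee).
  by rewrite /y mulmxA (smear_comm _ Ee) -!mulmxA ez.
have zy : smear c = y *m z by rewrite /y mulmxKV.
clearbody y; have -> : smear c = smear y by rewrite zy [RHS]smear_commutant.
rewrite smear_adj zy; apply: sumr_ge0 => i _.
have := smear1_ge0 (fun l => (y i l)^*); rewrite -/z -conjC_ge0.
rewrite rmorph_sum /=.
under eq_bigr => l _ do rewrite rmorph_sum.
rewrite exchange_big /=.
set S1 := \sum_(_ <- _) _; set S2 := \sum_(_ <- _) _; suff -> : S1 = S2 by [].
apply: eq_bigr => j _; rewrite [in RHS]mxE rmorph_sum mulr_suml.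
by apply: eq_bigr => l _; rewrite !rmorphM /= !conjCK.
Qed.

End ExpectationPositive.

(** * The moment functional of a reproducing kernel *)

Section Moments.
Variables (C : numClosedFieldType) (X : finType) (x0 : X).
Variable Q : nat -> seq X -> seq X -> C.
Local Notation planar := (@planar C X x0).
Hypotheses (Q_planar : forall k J, planar k (Q k ^~ J))
  (Q_sym : forall k I J, Q k I J = Q k J I)
  (Q_conj : forall k I J, (Q k I J)^* = Q k I J)
  (Q_repr : forall k f I, planar k f -> size I = k ->
     lsum k (fun J => Q k I J * f J) = f I).
Implicit Types (f g : seq X -> C) (I J : seq X).

Lemma lsum_merge_fork a r f g :
  lsum (a + r.+1) (fun l => f l * tmerge a g l) =
  lsum (a + r.+2) (fun l => fork x0 a f l * g l).
Proof.
rewrite !lsum_cat; apply: eq_lsum => u ua; rewrite !lsumS.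
apply: eq_bigr => x _; rewrite lsumS -lsum_exchange; apply: eq_lsum => v _.
rewrite (bigD1 x) //= [X in _ + X]big1 => [|y /negbTE yx].
  rewrite addr0 /tmerge /dup /fork -ua drop_size_cat //.
  rewrite -[u ++ x :: v]cat_rcons take_size_cat ?size_rcons // cat_rcons.
  rewrite !nth_cat ltnn subnn ltnNge leqnSn subSnn /= eqxx mul1r.
  by rewrite -(addn1 (size u)) del_catr /del /= drop0 cat_rcons.
by rewrite /fork !nth_cat ua ltnn subnn ltnNge leqnSn subSnn /= eq_sym yx !mul0r.
Qed.

Lemma lsum_tsum_ins a r f g :
  lsum (a + r) (fun l => f l * tsum a g l) =
  lsum (a + r.+1) (fun l => ins a f l * g l).
Proof.
rewrite !lsum_cat; apply: eq_lsum => u ua; rewrite lsumS -lsum_exchange.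
apply: eq_lsum => v _; rewrite /tsum mulr_sumr; apply: eq_bigr => x _.
rewrite /inj take_size_cat // drop_size_cat // /ins.
by rewrite -ua -[X in del X _]addn0 del_catr /del /= drop0.
Qed.

(** [tmerge] and its transpose [fork] both preserve planar tensors, so they intertwine the
    projections. Concretely, both sides are reproduced to the same double pairing; [Q_tsum] argues
    alike with [tsum] and [ins]. *)
Lemma Q_merge a r I J : size I = (a + r.+1)%N -> size J = (a + r.+2)%N ->
  Q (a + r.+2) (dup a I) J = fork x0 a (Q (a + r.+1) I) J.
Proof.
move=> Ik Jk; have mP : planar (a + r.+1) (tmerge a (Q (a + r.+2) ^~ J)).
  rewrite (_ : (a + r.+1)%N = (a + r.+2).-1); last by lia.
  by apply: planar_merge; [exact: Q_planar|lia].
rewrite -[LHS]/(tmerge a (Q (a + r.+2) ^~ J) I) -(Q_repr mP Ik).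
rewrite lsum_merge_fork -[RHS](Q_repr (k := (a + r.+2)%N)
  (f := fork x0 a (Q (a + r.+1) I))) //.
  by apply: eq_lsum => l _; rewrite mulrC Q_sym.
rewrite addnS; apply: planar_fork; first lia.
by apply: planar_ext (Q_planar _ I) => l _; rewrite Q_sym.
Qed.

Lemma Q_tsum a r I J : size I = (a + r)%N -> size J = (a + r.+1)%N ->
  \sum_x Q (a + r.+1) (inj a x I) J = Q (a + r) I (del a J).
Proof.
move=> Ik Jk; have mP : planar (a + r) (tsum a (Q (a + r.+1) ^~ J)).
  rewrite (_ : (a + r)%N = (a + r.+1).-1); last by lia.
  by apply: planar_tsum; [exact: Q_planar|lia].
rewrite -[LHS]/(tsum a (Q (a + r.+1) ^~ J) I) -(Q_repr mP Ik).
rewrite lsum_tsum_ins -[RHS]/(ins a (Q (a + r) I) J).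
rewrite -[RHS](Q_repr (k := (a + r.+1)%N) (f := ins a (Q (a + r) I))) //.
  by apply: eq_lsum => l _; rewrite mulrC Q_sym.
rewrite addnS; apply: planar_ins; first lia.
by apply: planar_ext (Q_planar _ I) => l _; rewrite Q_sym.
Qed.

Lemma Q_row u v u' v' x y y' k : size u = size u' -> size v = size v' ->
  k = (size u + (size v).+1)%N ->
  Q k.+1 (u ++ [:: x, x & v]) (u' ++ [:: y, y' & v']) =
  (y == y')%:R * Q k (u ++ x :: v) (u' ++ y :: v').
Proof.
move=> uu vv ->; rewrite -addnS.
have -> : u ++ [:: x, x & v] = dup (size u) (u ++ x :: v).
  rewrite /dup drop_size_cat // -{1}[u ++ x :: v]cat_rcons.
  by rewrite take_size_cat ?size_rcons // cat_rcons.
rewrite Q_merge ?size_cat /= ?uu ?vv // /fork !nth_cat ltnn subnn.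
rewrite ltnNge leqnSn subSnn /=; congr (_ * Q _ _ _).
by rewrite -(addn1 (size u')) del_catr /del /= drop0.
Qed.

Lemma Q_sumx u v u' v' y k : size u = size u' -> size v = size v' ->
  k = (size u + size v)%N ->
  \sum_x Q k.+1 (u ++ x :: v) (u' ++ y :: v') = Q k (u ++ v) (u' ++ v').
Proof.
move=> uu vv ->; rewrite -addnS.
under eq_bigr => x _.
  rewrite (_ : u ++ x :: v = inj (size u) x (u ++ v)); last first.
    by rewrite /inj take_size_cat // drop_size_cat.
over.
rewrite Q_tsum ?size_cat /= ?uu ?vv //; congr (Q _ _ _).
by rewrite -[X in del X _]addn0 del_catr /del /= drop0.
Qed.

Section Truncation.
Variable m : nat.
(** Words of length at most [m] index a finite matrix algebra, and any finite family of words fits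
    for some [m]. *)
Let W : finType := {b : 'I_m.+1 & b.-tuple X}.
Local Notation N := #|W|.
Implicit Types (i j : 'I_N).

Let wd i : seq X := tagged (enum_val i).

Let size_wd i : (size (wd i) < m.+1)%N.
Proof. by rewrite /wd size_tuple. Qed.

Let wd_inj : injective wd.
Proof.
move=> i j ij; apply: enum_val_inj; move: ij; rewrite /wd.
case: (enum_val i) (enum_val j) => [b t] [b' t'] /= tt'.
have bb : b = b' by apply: val_inj; rewrite /= -(size_tuple t) tt' size_tuple.
by move: t' tt'; rewrite -{}bb => t' /val_inj ->.
Qed.

Let sum_wd (F : seq X -> C) : \sum_i F (wd i) = \sum_(b < m.+1) lsum b F.
Proof.
rewrite /lsum sig_big_dep /= (reindex _ (onW_bij _ (@enum_val_bij W))) /=.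
by apply: eq_bigr => i _.
Qed.

Let sum_wd_size (F : seq X -> C) s : (s < m.+1)%N ->
  \sum_i (if size (wd i) == s then F (wd i) else 0) = lsum s F.
Proof.
move=> sm; rewrite (sum_wd (fun l => if size l == s then F l else 0)).
rewrite (bigD1 (Ordinal sm)) //= [X in _ + X]big1 ?addr0 => [|b bs].
  by apply: eq_lsum => l ->; rewrite eqxx.
rewrite (eq_lsum (G := fun=> 0)) => [|l lb]; first by rewrite /lsum big1.
by rewrite lb; case: eqP => // e; case/eqP: bs; apply: val_inj.
Qed.

Let E (x : 'M[C]_N) := exists2 y : seq X -> seq X -> C,
  biplanar x0 y & forall i j, x i j = y (wd i) (wd j).

(** A planar matrix becomes a planar tensor when its row word is reversed. On each block of given
    lengths the reproducing kernel is thus [Q], and blocks of different lengths are orthogonal. *)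
Let kern (j j' i i' : seq X) : C :=
  if size j == size i then
    if size j' == size i' then
      Q (size i + size i') (rev i ++ i') (rev j ++ j') else 0 else 0.

Let K j j' : 'M[C]_N := \matrix_(i, i') kern (wd j) (wd j') (wd i) (wd i').

Let E_one : E 1%:M.
Proof.
exists (fun I J => (I == J)%:R); first exact: biplanar_id.
by move=> i j; rewrite mxE (inj_eq wd_inj).
Qed.

Let E_mul x y : E x -> E y -> E (x *m y).
Proof.
move=> [x' xP xE] [y' yP yE].
exists (fun I J => \sum_(b < m.+1) lsum b (fun l => x' I l * y' l J)).
  by move=> k l; apply: planar_sum => b _; apply: biplanar_comp.
move=> i j; rewrite mxE -sum_wd; apply: eq_bigr => l _.
by rewrite xE yE.
Qed.

Let E_adj x : E x -> E (mxadj x).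
Proof.
move=> [x' xP xE]; exists (fun I J => (x' J I)^*); first exact: biplanar_star.
by move=> i j; rewrite mxE xE.
Qed.

Let E_K j j' : E (K j j').
Proof.
exists (kern (wd j) (wd j')); last by move=> i i'; rewrite mxE.
move=> k l; rewrite /kern.
have [jk|jk] := eqVneq (size (wd j)) k; last first.
  apply: planar_ext (planar_zero _ _ _) => _ /split_size[u [v [-> uk vl]]].
  by rewrite take_size_cat // size_rev uk (negbTE jk).
have [jl|jl] := eqVneq (size (wd j')) l; last first.
  apply: planar_ext (planar_zero _ _ _) => _ /split_size[u [v [-> uk vl]]].
  by rewrite take_size_cat // drop_size_cat // vl (negbTE jl); case: eqP.
apply: planar_ext (Q_planar (k + l) (rev (wd j) ++ wd j')).
move=> _ /split_size[u [v [-> uk vl]]].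
by rewrite take_size_cat // drop_size_cat // size_rev uk vl jk jl !eqxx revK.
Qed.

Let K_herm i i' j j' : K j j' i i' = (K i i' j j')^*.
Proof.
rewrite !mxE /kern (eq_sym (size (wd j))) (eq_sym (size (wd j'))).
case: eqP => [->|_]; last by rewrite rmorph0.
case: eqP => [->|_]; last by rewrite rmorph0.
by rewrite Q_conj Q_sym.
Qed.

Let K_repr x : E x -> forall i i',
  \sum_j \sum_j' x j j' * K j j' i i' = x i i'.
Proof.
move=> [y yP xE] i i'; set k := size (wd i); set l := size (wd i').
transitivity (\sum_j if size (wd j) == k then lsum l (fun J' =>
    y (wd j) J' * Q (k + l) (rev (wd i) ++ wd i') (rev (wd j) ++ J')) else 0).
  apply: eq_bigr => j _; case: eqP => jk; last first.
    by apply: big1 => j' _; rewrite mxE /kern; case: eqP; rewrite ?mulr0.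
  rewrite -sum_wd_size ?size_wd //; apply: eq_bigr => j' _.
  rewrite xE mxE /kern jk eqxx; case: eqP => _; last by rewrite mulr0.
  by rewrite Q_sym.
rewrite (sum_wd_size (fun J => lsum l (fun J' =>
  y J J' * Q (k + l) (rev (wd i) ++ wd i') (rev J ++ J')))) ?size_wd //.
have := Q_repr (yP k l) (I := rev (wd i) ++ wd i').
rewrite size_cat size_rev => /(_ erefl).
rewrite take_size_cat ?size_rev // drop_size_cat ?size_rev // revK -xE => <-.
rewrite lsum_cat lsum_rev; apply: eq_lsum => J Jk; apply: eq_lsum => J' _.
rewrite take_size_cat // drop_size_cat // revK mulrC Q_sym //.
Qed.

Let idx_ex : exists idx : seq X -> 'I_N, forall I, (size I < m.+1)%N -> wd (idx I) = I.
Proof.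
have /choice[idx idxE] : forall I, exists i, (size I < m.+1)%N -> wd i = I;
  last by exists idx.
move=> I; have [Im|Im] := boolP (size I < m.+1)%N; last first.
  by exists (enum_rank (existT _ ord0 [tuple] : W)).
exists (enum_rank (existT (fun b : 'I_m.+1 => b.-tuple X) (Ordinal Im) (in_tuple I) : W)).
by rewrite /wd enum_rankK.
Qed.

Let sum_delta (T : Type) (r : seq T) (a : T -> C) (f h : T -> 'I_N)
    (G : 'I_N -> 'I_N -> C) :
  \sum_i \sum_j (\sum_(p <- r) a p *: delta_mx (f p) (h p) : 'M[C]_N) i j * G i j =
  \sum_(p <- r) a p * G (f p) (h p).
Proof.
transitivity (\sum_(p <- r) \sum_i \sum_j
    a p * ((delta_mx (f p) (h p) : 'M[C]_N) i j * G i j)).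
  rewrite [RHS]exchange_big /=; apply: eq_bigr => i _.
  rewrite [RHS]exchange_big /=; apply: eq_bigr => j _.
  by rewrite summxE mulr_suml; apply: eq_bigr => p _; rewrite mxE mulrA.
apply: eq_bigr => p _; rewrite (bigD1 (f p)) //= (bigD1 (h p)) //=.
rewrite !mxE !eqxx mul1r !big1 ?addr0 // => [i ip|j jp].
  by apply: big1 => j _; rewrite mxE (negbTE ip) mul0r mulr0.
by rewrite mxE (negbTE jp) andbF mul0r mulr0.
Qed.

(* The value on w^* w' of the functional with moments Q. *)
Definition moment (w w' : seq (X * X)) : C :=
  Q (size w + size w') (rev (unzip1 w) ++ unzip1 w') (rev (unzip2 w) ++ unzip2 w').

Let kernE w w' : kern (unzip2 w) (unzip2 w') (unzip1 w) (unzip1 w') = moment w w'.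
Proof. by rewrite /kern !size_map !eqxx. Qed.

Let short (T : Type) (f : X * X -> T) w : (size w < m.+1)%N -> (size (map f w) < m.+1)%N.
Proof. by rewrite size_map. Qed.

Lemma trunc_moment_herm w w' : (size w < m.+1)%N -> (size w' < m.+1)%N ->
  moment w' w = (moment w w')^*.
Proof.
have [idx idxE] := idx_ex; move=> wm w'm.
have := K_adj E_adj K_herm E_K K_repr (idx (unzip1 w)) (idx (unzip1 w'))
  (idx (unzip2 w)) (idx (unzip2 w')).
by rewrite !mxE !idxE ?short // !kernE.
Qed.

(** The sum is the form of [smear K] at the combination [c] of matrix units whose indices are the
    row and column words of the members of [s]. *)
Lemma trunc_moment_ge0 (s : seq (C * seq (X * X))) :
  all (fun p => (size p.2 < m.+1)%N) s ->
  0 <= \sum_(p <- s) \sum_(q <- s) p.1^* * q.1 * moment p.2 q.2.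
Proof.
have [idx idxE] := idx_ex => /allP sm.
pose f (p : C * seq (X * X)) := idx (unzip1 p.2).
pose h (p : C * seq (X * X)) := idx (unzip2 p.2).
pose c : 'M[C]_N := \sum_(p <- s) p.1 *: delta_mx (f p) (h p).
have := smear_ge0 E_one E_mul E_adj K_herm E_K K_repr c.
set S1 := \sum_(i < N) _; set S2 := \sum_(p <- s) _; suff -> : S1 = S2 by [].
have smE i j : smear K c i j = \sum_(q <- s) q.1 * K j (h q) i (f q).
  rewrite mxE -(sum_delta s (fun q => q.1) f h (fun i' j' => K j j' i i')).
  rewrite exchange_big /=; apply: eq_bigr => j' _; rewrite mxE.
  by apply: eq_bigr => i' _; rewrite mulrC.
rewrite /S1 /S2.
transitivity (\sum_i \sum_j (\sum_(p <- s) p.1^* *: delta_mx (f p) (h p) : 'M[C]_N) i j *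
    smear K c i j).
  apply: eq_bigr => i _; apply: eq_bigr => j _; congr (_ * _).
  rewrite !summxE rmorph_sum; apply: eq_bigr => p _.
  by rewrite !mxE rmorphM /= rmorph_nat.
rewrite sum_delta !big_seq; apply: eq_bigr => p ps.
rewrite smE mulr_sumr !big_seq; apply: eq_bigr => q qs.
by rewrite mulrA mxE /f /h !idxE ?short ?sm // kernE.
Qed.

End Truncation.

Lemma moment_herm w w' : moment w' w = (moment w w')^*.
Proof. by apply: (@trunc_moment_herm (maxn (size w) (size w'))); lia. Qed.

Lemma moment_ge0 (s : seq (C * seq (X * X))) :
  0 <= \sum_(p <- s) \sum_(q <- s) p.1^* * q.1 * moment p.2 q.2.
Proof.
apply: (@trunc_moment_ge0 (\max_(p <- s) size p.2)); apply/allP => p ps.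
rewrite ltnS.
exact: (@leq_bigmax_seq _ s xpredT (fun p : C * seq (X * X) => size p.2) p ps).
Qed.

Lemma moment_nil : moment [::] [::] = 1.
Proof.
have := @Q_repr 0 (fun=> 1) [::] (planar_one _ _) erefl.
by rewrite lsum0 mulr1.
Qed.

Lemma moment_adj x w w' : moment (x :: w) w' = moment w (x :: w').
Proof. by rewrite /moment /= !rev_cons !cat_rcons addnS. Qed.

Lemma moment_row w w' x y y' :
  moment w [:: (x, y), (x, y') & w'] = (y == y')%:R * moment w ((x, y) :: w').
Proof.
rewrite /moment /= !addnS Q_row ?size_rev ?size_map //.
by rewrite addnS.
Qed.

Lemma moment_col w w' x x' y :
  moment w [:: (x, y), (x', y) & w'] = (x == x')%:R * moment w ((x, y) :: w').
Proof.
rewrite /moment /= !addnS [LHS]Q_sym Q_row ?size_rev ?size_map //.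
  by rewrite Q_sym.
by rewrite addnS.
Qed.

Lemma moment_sumx w w' y : \sum_x moment w ((x, y) :: w') = moment w w'.
Proof.
under eq_bigr => x _ do rewrite /moment /= !addnS.
by rewrite Q_sumx ?size_rev ?size_map.
Qed.

Lemma moment_sumy w w' x : \sum_y moment w ((x, y) :: w') = moment w w'.
Proof.
under eq_bigr => y _ do rewrite /moment /= !addnS Q_sym.
by rewrite Q_sumx ?size_rev ?size_map // Q_sym.
Qed.

End Moments.

(** * Pre-Hilbert spaces and their completion *)

Import Normc.
Local Notation "x %:C" := (real_complex _ x) : ring_scope.

(** * Limits of complex sequences *)

Section ComplexLimits.
Import classical_sets.
Variable R : realType.
Implicit Types (z w : nat -> (complex R)) (a b c : (complex R)) (e : R).

Definition converges z a :=
  forall e, 0 < e -> exists N, forall n, (N <= n)%N -> normc (z n - a) < e.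

Lemma normc_conj a : normc a^* = normc a.
Proof. by case: a => x y; rewrite /normc /= sqrrN. Qed.

Lemma normc_ge0 a : 0 <= normc a.
Proof. by case: a => x y; rewrite sqrtr_ge0. Qed.

Lemma normcB a b : normc (a - b) = normc (b - a).
Proof. by rewrite -normcN opprB. Qed.

Lemma normc_Re a : `|complex.Re a| <= normc a.
Proof.
case: a => x y; rewrite /normc /= -sqrtr_sqr ler_sqrt ?lerDl ?sqr_ge0 //.
by rewrite addr_ge0 ?sqr_ge0.
Qed.

Lemma normc_Im a : `|complex.Im a| <= normc a.
Proof.
case: a => x y; rewrite /normc /= -sqrtr_sqr ler_sqrt ?lerDr ?sqr_ge0 //.
by rewrite addr_ge0 ?sqr_ge0.
Qed.

Lemma normc_le (x y : R) : normc (Complex x y) <= `|x| + `|y|.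
Proof.
rewrite -(ger0_norm (addr_ge0 (normr_ge0 x) (normr_ge0 y))) -sqrtr_sqr.
rewrite ler_sqrt ?sqr_ge0 // sqrrD !real_normK ?num_real // addrAC lerDl.
by rewrite mulrn_wge0 // mulr_ge0.
Qed.

Lemma normc_real (x : R) : 0 <= x -> normc x%:C = x.
Proof. by move=> x0; rewrite /normc /= expr0n addr0 sqrtr_sqr ger0_norm. Qed.

Lemma normc_eq_small a : (forall e, 0 < e -> normc a < e) -> a = 0.
Proof.
move=> H; apply: eq0_normc; apply/eqP; rewrite eq_le normc_ge0 andbT.
by rewrite leNgt; apply/negP => /H; rewrite ltxx.
Qed.

Lemma converges_unique z a b : converges z a -> converges z b -> a = b.
Proof.
move=> za zb; apply/eqP; rewrite -subr_eq0; apply/eqP/normc_eq_small => e e0.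
have [N NP] := za _ (divr_gt0 e0 (ltr0Sn R 1)).
have [N' NP'] := zb _ (divr_gt0 e0 (ltr0Sn R 1)).
have := NP (maxn N N') (leq_maxl _ _); have := NP' (maxn N N') (leq_maxr _ _).
move: (z _) => x xb xa.
have -> : a - b = (a - x) + (x - b) by ring.
by apply: le_lt_trans (le_normcD _ _) _; rewrite normcB (splitr e) ltrD.
Qed.

Lemma convergesD z w a b : converges z a -> converges w b ->
  converges (fun n => z n + w n) (a + b).
Proof.
move=> za zb e e0; have [N NP] := za _ (divr_gt0 e0 (ltr0Sn R 1)).
have [N' NP'] := zb _ (divr_gt0 e0 (ltr0Sn R 1)).
exists (maxn N N') => n; rewrite geq_max => /andP[Nn N'n].
have -> : z n + w n - (a + b) = (z n - a) + (w n - b) by ring.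
apply: le_lt_trans (le_normcD _ _) _; rewrite [ltRHS](splitr e) ltrD ?NP ?NP' //.
Qed.

Lemma convergesZ c z a : converges z a -> converges (fun n => c * z n) (c * a).
Proof.
move=> za e e0; have c0 : 0 < normc c + 1 by rewrite ltr_wpDl ?normc_ge0.
have [N NP] := za _ (divr_gt0 e0 c0); exists N => n /NP.
rewrite ltr_pdivlMr // -mulrBr normcM; apply: le_lt_trans.
by rewrite mulrC ler_wpM2l ?normc_ge0 // lerDl.
Qed.

Lemma convergesJ z a : converges z a -> converges (fun n => (z n)^*) a^*.
Proof.
move=> za e /za[N NP]; exists N => n /NP.
by rewrite -(normc_conj (z n - a)) rmorphB.
Qed.

Lemma converges_ext z w a : z =1 w -> converges z a -> converges w a.
Proof. by move=> /funext->. Qed.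

Lemma converges_cst a : converges (fun=> a) a.
Proof. by move=> e e0; exists 0%N => n _; rewrite subrr normc0. Qed.

(** The limit is the supremum of the eventual lower bounds of [u], that is, its lower limit. *)
Lemma real_cauchy (u : nat -> R) :
  (forall e, 0 < e -> exists N, forall m n, (N <= m)%N -> (N <= n)%N ->
     `|u m - u n| < e) ->
  exists l, forall e, 0 < e -> exists N, forall n, (N <= n)%N -> `|u n - l| < e.
Proof.
move=> uC; pose A := [set x | exists N, forall n, (N <= n)%N -> x <= u n]%classic.
have near e N : (forall m n, (N <= m)%N -> (N <= n)%N -> `|u m - u n| < e) ->
    A (u N - e) /\ ubound A (u N + e).
  move=> NP; split.
    exists N => n Nn; have := NP N n (leqnn _) Nn; rewrite ltr_norml; lra.
  move=> x [N' N'P]; have := NP N (maxn N N') (leqnn _) (leq_maxl _ _).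
  have := N'P _ (leq_maxr N N'); rewrite ltr_norml; lra.
exists (sup A) => e e0; have e2 : 0 < e / 2 by lra.
have [N NP] := uC _ e2; exists N => n Nn.
have [lo hi] := near _ _ NP.
have h1 : u N - e / 2 <= sup A by apply: ub_le_sup => //; exists (u N + e / 2).
have h2 : sup A <= u N + e / 2 by apply: ge_sup => //; exists (u N - e / 2).
have := NP N n (leqnn _) Nn; rewrite !ltr_norml; lra.
Qed.

Lemma complex_cauchy z :
  (forall e, 0 < e -> exists N, forall m n, (N <= m)%N -> (N <= n)%N ->
     normc (z m - z n) < e) -> exists a, converges z a.
Proof.
move=> zC.
have [x xP] : exists x, forall e, 0 < e -> exists N, forall n, (N <= n)%N ->
    `|complex.Re (z n) - x| < e.
  apply: real_cauchy => e /zC[N NP]; exists N => m n Nm Nn.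
  by apply: le_lt_trans (NP m n Nm Nn); apply: le_trans (normc_Re _); rewrite raddfB.
have [y yP] : exists y, forall e, 0 < e -> exists N, forall n, (N <= n)%N ->
    `|complex.Im (z n) - y| < e.
  apply: real_cauchy => e /zC[N NP]; exists N => m n Nm Nn.
  by apply: le_lt_trans (NP m n Nm Nn); apply: le_trans (normc_Im _); rewrite raddfB.
exists (Complex x y) => e e0; have e2 : 0 < e / 2 by lra.
have [N NP] := xP _ e2; have [N' NP'] := yP _ e2.
exists (maxn N N') => n; rewrite geq_max => /andP[/NP h1 /NP' h2].
case: (z n) h1 h2 => a b /= h1 h2; apply: le_lt_trans (normc_le _ _) _; lra.
Qed.

End ComplexLimits.

(* Only the laws of the (semidefinite) inner product are recorded: vectors are
   never compared, so no module axioms are needed. *)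
Record prehilbert (R : realType) := PreHilbert {
  vect :> Type ;
  vadd : vect -> vect -> vect ;
  vscale : (complex R) -> vect -> vect ;
  ip : vect -> vect -> (complex R) ;
  vac : vect ;
  ipDr : forall x y z, ip x (vadd y z) = ip x y + ip x z ;
  ipZr : forall c x y, ip x (vscale c y) = c * ip x y ;
  ip_herm : forall x y, ip y x = (ip x y)^* ;
  ip_ge0 : forall x, 0 <= ip x x ;
  ip_vac : ip vac vac = 1
}.

Section PreHilbertTheory.
Variables (R : realType) (H : prehilbert R).
Implicit Types (x y z : H) (c : (complex R)).

Lemma ipDl x y z : ip (vadd x y) z = ip x z + ip y z.
Proof. by rewrite ip_herm ipDr rmorphD /= -!ip_herm. Qed.

Lemma ipZl c x y : ip (vscale c x) y = c^* * ip x y.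
Proof. by rewrite ip_herm ipZr rmorphM /= -ip_herm. Qed.

Definition vnorm x : R := Num.sqrt (complex.Re (ip x x)).
Definition vsub x y := vadd x (vscale (-1) y).

Lemma ipBr x y z : ip x (vsub y z) = ip x y - ip x z.
Proof. by rewrite ipDr ipZr mulN1r. Qed.

Lemma ipBl x y z : ip (vsub x y) z = ip x z - ip y z.
Proof. by rewrite ip_herm ipBr rmorphB /= -!ip_herm. Qed.

Lemma vnorm_ge0 x : 0 <= vnorm x.
Proof. exact: sqrtr_ge0. Qed.

Lemma ip_self x : ip x x = (vnorm x ^+ 2)%:C.
Proof.
have := ip_ge0 x; rewrite /vnorm; case: (ip x x) => a b.
by rewrite lecE /= => /andP[/eqP-> a0]; rewrite sqr_sqrtr.
Qed.

Lemma cauchy_schwarz x y : normc (ip x y) <= vnorm x * vnorm y.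
Proof.
set b := ip x y; set B := normc b.
have BE : B ^+ 2 = complex.Re b ^+ 2 + complex.Im b ^+ 2.
  by rewrite /B; case: (b) => s t; rewrite /normc sqr_sqrtr ?addr_ge0 ?sqr_ge0.
(* The square of [x] minus [s] times the conjugate of [b] times [y]; the factor conjugate to [b]
   makes the cross terms real. *)
have quad (s : R) : 0 <= vnorm x ^+ 2 - 2 * s * B ^+ 2 + s ^+ 2 * B ^+ 2 * vnorm y ^+ 2.
  have := ip_ge0 (vadd x (vscale (- s%:C * b^*) y)).
  rewrite ipDl !ipDr !ipZr !ipZl (ip_herm x y) -/b !ip_self.
  set lhs := _ + _; have -> : lhs =
      (vnorm x ^+ 2 - 2 * s * B ^+ 2 + s ^+ 2 * B ^+ 2 * vnorm y ^+ 2)%:C.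
    rewrite /lhs.
    rewrite BE; case: (b) => p q.
    by apply/eqP; rewrite eq_complex /=; apply/andP; split; apply/eqP; ring.
  by rewrite lecR.
have B0 : 0 <= B by apply: normc_ge0.
have [x0 y0] := (vnorm_ge0 x, vnorm_ge0 y).
have [Bp|] := ltrP 0 B; last by move=> B_le; apply: le_trans B_le _; apply: mulr_ge0.
have [yp|yn] := ltrP 0 (vnorm y); last first.
  have y00 : vnorm y = 0 by apply/eqP; rewrite eq_le yn y0.
  have B2 : B ^+ 2 != 0 by rewrite expf_neq0 // gt_eqF.
  (* The form may be degenerate. If [vnorm y] is 0, the quadratic term vanishes, and this [s] brings
     the remaining expression down to -1. *)
  have := quad ((vnorm x ^+ 2 + 1) / (2 * B ^+ 2)).
  have -> : 2 * ((vnorm x ^+ 2 + 1) / (2 * B ^+ 2)) * B ^+ 2 = vnorm x ^+ 2 + 1.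
    by field; rewrite gt_eqF.
  rewrite y00 expr0n mulr0; lra.
have := quad (vnorm y ^+ 2)^-1.
have y2 : vnorm y != 0 by rewrite gt_eqF.
have -> : vnorm x ^+ 2 - 2 * (vnorm y ^+ 2)^-1 * B ^+ 2 +
   (vnorm y ^+ 2)^-1 ^+ 2 * B ^+ 2 * vnorm y ^+ 2 =
   ((vnorm x * vnorm y) ^+ 2 - B ^+ 2) / vnorm y ^+ 2 by field.
rewrite ler_pdivlMr ?exprn_gt0 // mul0r subr_ge0.
by rewrite ler_pXn2r ?nnegrE ?mulr_ge0.
Qed.

(** Vectors satisfy no equations, so that [z] is a sum of [x] and [y] is expressed by its inner
    products; this covers differences that do not cancel as vectors. *)
Lemma vnorm_triangle x y z : (forall w, ip w z = ip w x + ip w y) ->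
  vnorm z <= vnorm x + vnorm y.
Proof.
move=> zE; have [z0|zn] := ltrP 0 (vnorm z); last first.
  by apply: le_trans zn _; rewrite addr_ge0 ?vnorm_ge0.
rewrite -(ler_pM2l z0) -expr2 mulrDr.
have -> : vnorm z ^+ 2 = normc (ip z z).
  by rewrite ip_self normc_real // exprn_ge0 ?vnorm_ge0.
rewrite zE; apply: le_trans (le_normcD _ _) _.
by apply: lerD; apply: cauchy_schwarz.
Qed.

Lemma vnormZ c x : vnorm (vscale c x) = normc c * vnorm x.
Proof.
rewrite {1}/vnorm ipZl ipZr ip_self mulrA.
have -> : c^* * c = (normc c ^+ 2)%:C.
  case: c => s t; rewrite /normc sqr_sqrtr ?addr_ge0 ?sqr_ge0 //.
  by apply/eqP; rewrite eq_complex /=; apply/andP; split; apply/eqP; ring.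
rewrite -rmorphM /= -exprMn sqrtr_sqr ger0_norm //.
by rewrite mulr_ge0 ?vnorm_ge0 ?normc_ge0.
Qed.

Lemma eq_vnorm x y : (forall w, ip w x = ip w y) -> vnorm x = vnorm y.
Proof. by move=> xy; rewrite /vnorm xy ip_herm xy -ip_herm. Qed.

Lemma vdist_triangle x y z :
  vnorm (vsub x z) <= vnorm (vsub x y) + vnorm (vsub y z).
Proof. by apply: vnorm_triangle => w; rewrite !ipBr; ring. Qed.

Definition vcauchy (u : nat -> H) := forall e : R, 0 < e ->
  exists N, forall m n, (N <= m)%N -> (N <= n)%N -> vnorm (vsub (u m) (u n)) < e.

Definition vconverges (u : nat -> H) x := forall e : R, 0 < e ->
  exists N, forall n, (N <= n)%N -> vnorm (vsub (u n) x) < e.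

Definition vcomplete := forall u, vcauchy u -> exists x, vconverges u x.

Lemma vcauchy_bounded u : vcauchy u -> exists2 M : R, 0 < M &
  exists N, forall n, (N <= n)%N -> vnorm (u n) < M.
Proof.
move=> /(_ 1 ltr01)[N NP]; exists (1 + vnorm (u N)).
  by rewrite ltr_pwDl ?vnorm_ge0.
exists N => n Nn; have := NP n N Nn (leqnn _).
have : vnorm (u n) <= vnorm (vsub (u n) (u N)) + vnorm (u N).
  by apply: vnorm_triangle => w; rewrite ipBr; ring.
lra.
Qed.

Lemma ip_cauchy u v : vcauchy u -> vcauchy v ->
  exists a, converges (fun n => ip (u n) (v n)) a.
Proof.
move=> uC vC; apply: complex_cauchy => e e0.
have [M M0 [N1 N1P]] := vcauchy_bounded uC.
have [M' M'0 [N2 N2P]] := vcauchy_bounded vC.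
have e1 : 0 < e / 2 / M by rewrite !divr_gt0.
have e2 : 0 < e / 2 / M' by rewrite !divr_gt0.
have [N3 N3P] := vC _ e1; have [N4 N4P] := uC _ e2.
exists (maxn (maxn N1 N2) (maxn N3 N4)) => m n.
rewrite !geq_max => /andP[/andP[m1 m2] /andP[m3 m4]] /andP[/andP[n1 n2] /andP[n3 n4]].
have -> : ip (u m) (v m) - ip (u n) (v n) =
    ip (u m) (vsub (v m) (v n)) + ip (vsub (u m) (u n)) (v n).
  by rewrite ipBr ipBl; ring.
apply: le_lt_trans (le_normcD _ _) _; rewrite (splitr e); apply: ltrD.
  apply: le_lt_trans (cauchy_schwarz _ _) _.
  have := N3P m n m3 n3; rewrite ltr_pdivlMr // mulrC => h.
  by apply: le_lt_trans h; apply: ler_wpM2r; rewrite ?vnorm_ge0 // ltW ?N1P.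
apply: le_lt_trans (cauchy_schwarz _ _) _.
have := N4P m n m4 n4; rewrite ltr_pdivlMr // => h.
by apply: le_lt_trans h; apply: ler_wpM2l; rewrite ?vnorm_ge0 // ltW ?N2P.
Qed.

End PreHilbertTheory.

Section Completion.
Variables (R : realType) (H : prehilbert R).

(** Cauchy sequences are not identified modulo null sequences, since inner products may be
    degenerate. *)
Record cauchyseq := CauchySeq { cseq :> nat -> H ; cseqP : vcauchy cseq }.
Implicit Types (u v w : cauchyseq).

Lemma cauchyD u v : vcauchy (fun n => vadd (u n) (v n)).
Proof.
move=> e e0; have e2 : 0 < e / 2 by rewrite divr_gt0.
have [N NP] := cseqP u e2; have [N' NP'] := cseqP v e2.
exists (maxn N N') => m n; rewrite !geq_max => /andP[m1 m2] /andP[n1 n2].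
apply: (@le_lt_trans _ _ (vnorm (vsub (u m) (u n)) + vnorm (vsub (v m) (v n)))).
  by apply: vnorm_triangle => w; rewrite !ipBr !ipDr; ring.
by rewrite (splitr e) ltrD ?NP ?NP'.
Qed.

Lemma cauchyZ c u : vcauchy (fun n => vscale c (u n)).
Proof.
move=> e e0; have c0 : 0 < normc c + 1 by rewrite ltr_wpDl ?normc_ge0.
have [N NP] := cseqP u (divr_gt0 e0 c0); exists N => m n m1 n1.
have := NP m n m1 n1; rewrite ltr_pdivlMr //; apply: le_lt_trans.
rewrite (@eq_vnorm _ _ _ (vscale c (vsub (u m) (u n)))).
  by rewrite vnormZ mulrC ler_wpM2l ?vnorm_ge0 // lerDl.
by move=> w; rewrite ipZr !ipBr !ipZr; ring.
Qed.

Lemma cauchy_cst (x : H) : vcauchy (fun=> x).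
Proof.
move=> e e0; exists 0%N => m n _ _.
suff -> : vnorm (vsub x x) = 0 by [].
by rewrite /vnorm ipBr subrr /= sqrtr0.
Qed.

Definition cip u v : complex R := projT1 (cid (ip_cauchy (cseqP u) (cseqP v))).

Lemma cipP u v : converges (fun n => ip (u n) (v n)) (cip u v).
Proof. exact: projT2 (cid (ip_cauchy (cseqP u) (cseqP v))). Qed.

Lemma cipE u v a : converges (fun n => ip (u n) (v n)) a -> cip u v = a.
Proof. by move=> ca; apply: converges_unique (cipP u v) ca. Qed.

Definition cadd u v := CauchySeq (cauchyD u v).
Definition cscale c u := CauchySeq (cauchyZ c u).
Definition ccst x := CauchySeq (cauchy_cst x).

Lemma cipDr u v w : cip u (cadd v w) = cip u v + cip u w.
Proof.
apply: cipE; apply: converges_ext (convergesD (cipP u v) (cipP u w)) => n.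
by rewrite ipDr.
Qed.

Lemma cipZr c u v : cip u (cscale c v) = c * cip u v.
Proof.
by apply: cipE; apply: converges_ext (convergesZ c (cipP u v)) => n; rewrite ipZr.
Qed.

Lemma cip_herm u v : cip v u = (cip u v)^*.
Proof.
by apply: cipE; apply: converges_ext (convergesJ (cipP u v)) => n; rewrite -ip_herm.
Qed.

Lemma cip_ge0 u : 0 <= cip u u.
Proof.
have := cipP u u; case: (cip u u) => a b ab; rewrite lecE /=; apply/andP; split.
  apply/eqP/eqP; rewrite -normr_eq0 eq_le normr_ge0 andbT leNgt; apply/negP => b0.
  have [N NP] := ab _ b0; have := NP N (leqnn _); rewrite ip_self.
  by move=> /(le_lt_trans (normc_Im _)); rewrite /= sub0r normrN ltxx.
rewrite leNgt; apply/negP => a0; have na0 : 0 < - a by rewrite oppr_gt0.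
have [N NP] := ab _ na0; have := NP N (leqnn _); rewrite ip_self.
move=> /(le_lt_trans (normc_Re _)) /=; rewrite ltr_norml.
have := sqr_ge0 (vnorm (u N)); lra.
Qed.

Lemma cip_cst x y : cip (ccst x) (ccst y) = ip x y.
Proof. by apply: cipE; apply: converges_cst. Qed.

Lemma cip_vac : cip (ccst (vac H)) (ccst (vac H)) = 1.
Proof. by rewrite cip_cst ip_vac. Qed.

Definition completion : prehilbert R :=
  PreHilbert cipDr cipZr cip_herm cip_ge0 cip_vac.

Lemma vnorm_completion_le (u : completion) (e : R) : 0 <= e ->
  (exists N, forall n, (N <= n)%N -> vnorm ((u : cauchyseq) n) <= e) -> vnorm u <= e.
Proof.
move=> e0 [N NP]; rewrite -(@ler_pXn2r _ 2) // ?nnegrE ?vnorm_ge0 //.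
rewrite leNgt; apply/negP => lt; have d0 : 0 < vnorm u ^+ 2 - e ^+ 2 by rewrite subr_gt0.
have [N' N'P] := cipP u u d0; have := N'P _ (leq_maxr N N').
have := NP _ (leq_maxl N N'); move: (maxn N N') => n h.
rewrite ip_self (_ : cip u u = (vnorm u ^+ 2)%:C); last exact: (@ip_self _ completion u).
move=> /(le_lt_trans (normc_Re _)) /=; rewrite ltr_norml.
have : vnorm ((u : cauchyseq) n) ^+ 2 <= e ^+ 2 by rewrite ler_pXn2r ?nnegrE ?vnorm_ge0.
lra.
Qed.

Lemma vnorm_completion_lt (u : completion) (e : R) : vnorm u < e ->
  exists N, forall n, (N <= n)%N -> vnorm ((u : cauchyseq) n) < e.
Proof.
move=> ue; have e0 : 0 <= e by apply: le_trans (vnorm_ge0 u) (ltW ue).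
have d0 : 0 < e ^+ 2 - vnorm u ^+ 2.
  by rewrite subr_gt0 ltr_pXn2r ?nnegrE ?vnorm_ge0.
have [N NP] := cipP u u d0; exists N => n /NP.
rewrite ip_self (_ : cip u u = (vnorm u ^+ 2)%:C); last exact: (@ip_self _ completion u).
move=> /(le_lt_trans (normc_Re _)) /=; rewrite ltr_norml => h.
by rewrite -(@ltr_pXn2r _ 2) // ?nnegrE ?vnorm_ge0 //; lra.
Qed.

Lemma completion_complete : vcomplete completion.
Proof.
move=> U UC.
have ex p : exists N, forall m n, (N <= m)%N -> (N <= n)%N ->
    vnorm (vsub ((U p : cauchyseq) m) ((U p : cauchyseq) n)) < (p.+1%:R : R)^-1.
  by apply: (cseqP (U p)); rewrite invr_gt0 ltr0Sn.
have [K KP] := choice ex.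
have inv_small (e : R) : 0 < e -> exists N, forall p, (N <= p)%N -> (p.+1%:R : R)^-1 < e.
  move=> e0; exists (Num.bound e^-1) => p Np.
  rewrite -[ltRHS]invrK ltf_pV2 ?posrE ?invr_gt0 ?ltr0Sn //.
  apply: lt_le_trans (archi_boundP _) _; first by rewrite invr_ge0 ltW.
  by rewrite ler_nat; lia.
(* A diagonal sequence: from the index [K p] on, [U p] varies by less than 1/(p+1), so its term
   there stands for its limit up to that error. *)
pose L p := (U p : cauchyseq) (K p).
have LC : vcauchy L.
  move=> e e0; have e3 : 0 < e / 3 by rewrite divr_gt0 ?ltr0Sn.
  have [N NP] := inv_small _ e3; have [N' N'P] := UC _ e3.
  exists (maxn N N') => p q; rewrite !geq_max => /andP[p1 p2] /andP[q1 q2].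
  have [M MP] := vnorm_completion_lt (N'P p q p2 q2).
  pose n := maxn M (maxn (K p) (K q)).
  have Mn : (M <= n)%N by rewrite leq_maxl.
  have pn : (K p <= n)%N by rewrite /n; lia.
  have qn : (K q <= n)%N by rewrite /n; lia.
  have h1 := lt_trans (KP p (K p) n (leqnn _) pn) (NP p p1).
  have h2 := lt_trans (KP q n (K q) qn (leqnn _)) (NP q q1).
  have h3 := MP n Mn.
  have := vdist_triangle (L p) ((U p : cauchyseq) n) (L q).
  have := vdist_triangle ((U p : cauchyseq) n) ((U q : cauchyseq) n) (L q).
  rewrite /L /= in h3 *.
  lra.
exists (CauchySeq LC : completion) => e e0.
have e3 : 0 < e / 3 by rewrite divr_gt0 ?ltr0Sn.
have [N NP] := inv_small _ e3; have [N' N'P] := LC _ e3.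
exists (maxn N N') => p; rewrite geq_max => /andP[p1 p2].
apply: (@le_lt_trans _ _ (e / 3 + e / 3)); last by lra.
apply: vnorm_completion_le; first by lra.
exists (maxn (K p) N') => n; rewrite geq_max => /andP[n1 n2] /=.
have h1 := lt_trans (KP p n (K p) n1 (leqnn _)) (NP p p1).
have h2 := N'P p n p2 n2.
have := vdist_triangle ((U p : cauchyseq) n) (L p) (L n).
rewrite /L /vsub /= in h1 h2 *; lra.
Qed.

End Completion.

(** * Bounded operators on a Hilbert space *)

Record hilbert (R : realType) := Hilbert {
  hspace :> prehilbert R ;
  hspace_complete : vcomplete hspace
}.

Section BoundedOperators.
Import classical_sets.
Variables (R : realType) (H : hilbert R).
Local Notation C := (complex R).
Implicit Types (x y : H) (c : C) (b : H -> H -> C).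

Definition bound b (M : R) :=
  forall x y, normc (b x y) <= M * (vnorm x * vnorm y).

(** A form comes with both an operator and its adjoint, so that [bstar] only exchanges the two. *)
Definition adjointable b := exists T T' : H -> H,
  forall x y, b x y = ip x (T y) /\ b x y = ip (T' x) y.

Definition bounded b := exists2 M : R, 0 <= M & bound b M.

(* An operator is encoded by its sesquilinear form, so that extensional equality
   of forms identifies operators that differ by null vectors. *)
Record bop := Bop { form :> H -> H -> C ; formP : adjointable form /\ bounded form }.
Implicit Types (f g k : bop).

Lemma bop_ext f g : (forall x y, f x y = g x y) -> f = g.
Proof.
case: f g => [f fP] [g gP] /= fg.
have e : f = g by apply/funext => x; apply/funext => y.
by move: fP gP; rewrite e => fP gP; congr Bop.
Qed.

Lemma op_ex f : exists T, forall x y, f x y = ip x (T y).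
Proof. by have [[T [T' TP]] _] := formP f; exists T => x y; have [] := TP x y. Qed.
Lemma adj_ex f : exists T, forall x y, f x y = ip (T x) y.
Proof. by have [[T [T' TP]] _] := formP f; exists T' => x y; have [] := TP x y. Qed.

Definition op f : H -> H := projT1 (cid (op_ex f)).
Definition adj f : H -> H := projT1 (cid (adj_ex f)).
Lemma opE f x y : ip x (op f y) = f x y.
Proof. by rewrite /op; case: cid => T /= ->. Qed.
Lemma adjE f x y : ip (adj f x) y = f x y.
Proof. by rewrite /adj; case: cid => T /= ->. Qed.

Definition bnormset f : set R := [set M | 0 <= M /\ bound f M]%classic.
Definition bnorm f : R := inf (bnormset f).

Lemma bnormset_inf f : has_inf (bnormset f).
Proof.
split; first by have [_ [M M0 MP]] := formP f; exists M.
by exists 0 => M [].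
Qed.

Lemma bnorm_ge0 f : 0 <= bnorm f.
Proof. by apply: lb_le_inf; [case: (bnormset_inf f)|move=> M []]. Qed.

Lemma bnorm_bound f : bound f (bnorm f).
Proof.
move=> x y; have [xy0|xy0] := ltrP 0 (vnorm x * vnorm y); last first.
  have e : vnorm x * vnorm y = 0.
    by apply/eqP; rewrite eq_le xy0 mulr_ge0 ?vnorm_ge0.
  by have [_ [M _ /(_ x y)]] := formP f; rewrite e !mulr0.
rewrite -ler_pdivrMr //; apply: lb_le_inf; first by case: (bnormset_inf f).
by move=> M [_ /(_ x y)]; rewrite ler_pdivrMr.
Qed.

Lemma bnorm_le f M : 0 <= M -> bound f M -> bnorm f <= M.
Proof. by move=> M0 fM; apply: ge_inf; [case: (bnormset_inf f)|split]. Qed.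

Lemma op_bound_of b M (T : H -> H) : 0 <= M -> bound b M ->
  (forall x y, b x y = ip x (T y)) -> forall y, vnorm (T y) <= M * vnorm y.
Proof.
move=> M0 bM TP y; have [T0|Tn] := ltrP 0 (vnorm (T y)); last first.
  by apply: le_trans Tn _; rewrite mulr_ge0 ?vnorm_ge0.
rewrite -(ler_pM2l T0) mulrCA; have := bM (T y) y; rewrite TP ip_self.
by rewrite normc_real ?exprn_ge0 ?vnorm_ge0 // expr2.
Qed.

Lemma op_bound f y : vnorm (op f y) <= bnorm f * vnorm y.
Proof.
by apply: op_bound_of (bnorm_ge0 f) (@bnorm_bound f) _ y => x z; rewrite opE.
Qed.

Fact bzeroP : adjointable (fun _ _ => 0) /\ bounded (fun _ _ => 0).
Proof.
split; last by exists 0 => // x y; rewrite normc0 mul0r.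
exists (vscale 0), (vscale 0) => x y.
by rewrite ipZr ipZl rmorph0 !mul0r.
Qed.
Definition bzero := Bop bzeroP.

Fact baddP f g : adjointable (fun x y => f x y + g x y) /\
  bounded (fun x y => f x y + g x y).
Proof.
split.
  exists (fun y => vadd (op f y) (op g y)), (fun x => vadd (adj f x) (adj g x)).
  by move=> x y; rewrite ipDr ipDl !opE !adjE.
exists (bnorm f + bnorm g); first by rewrite addr_ge0 ?bnorm_ge0.
move=> x y; apply: le_trans (le_normcD _ _) _.
by rewrite mulrDl lerD ?bnorm_bound.
Qed.
Definition badd f g := Bop (baddP f g).

Fact bscaleP c f : adjointable (fun x y => c * f x y) /\
  bounded (fun x y => c * f x y).
Proof.
split.
  exists (fun y => vscale c (op f y)), (fun x => vscale c^* (adj f x)) => x y.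
  by rewrite ipZr ipZl conjCK opE adjE.
exists (normc c * bnorm f); first by rewrite mulr_ge0 ?bnorm_ge0 ?normc_ge0.
by move=> x y; rewrite normcM -mulrA ler_wpM2l ?normc_ge0 ?bnorm_bound.
Qed.
Definition bscale c f := Bop (bscaleP c f).
Definition bopp f := bscale (-1) f.

Fact boneP : adjointable (@ip R H) /\ bounded (@ip R H).
Proof.
split; first by exists id, id.
by exists 1 => // x y; rewrite mul1r cauchy_schwarz.
Qed.
Definition bone := Bop boneP.

Fact bmulP f g : adjointable (fun x y => f x (op g y)) /\
  bounded (fun x y => f x (op g y)).
Proof.
split.
  exists (op f \o op g), (adj g \o adj f) => x y /=.
  by rewrite opE adjE -adjE opE.
exists (bnorm f * bnorm g); first by rewrite mulr_ge0 ?bnorm_ge0.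
move=> x y; apply: le_trans (bnorm_bound _ _ _) _.
rewrite -mulrA ler_wpM2l ?bnorm_ge0 // mulrCA ler_wpM2l ?vnorm_ge0 //.
exact: op_bound.
Qed.
Definition bmul f g := Bop (bmulP f g).

(** The definition of [bmul] exposes the left factor and hides the right one behind a chosen
    operator; here the roles are exchanged, which yields additivity in the right factor. *)
Lemma bmulE f g x y : bmul f g x y = g (adj f x) y.
Proof. by rewrite /= -adjE opE. Qed.

Fact bstarP f : adjointable (fun x y => (f y x)^*) /\ bounded (fun x y => (f y x)^*).
Proof.
split.
  exists (adj f), (op f) => x y.
  by rewrite ip_herm adjE [ip (op f x) y]ip_herm opE.
exists (bnorm f); first exact: bnorm_ge0.
by move=> x y; rewrite normc_conj mulrC (mulrC (vnorm x)) mulrC bnorm_bound.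
Qed.
Definition bstar f := Bop (bstarP f).

HB.instance Definition _ := gen_eqMixin bop.
HB.instance Definition _ := gen_choiceMixin bop.

Fact baddA : associative badd.
Proof. by move=> f g k; apply: bop_ext => x y /=; rewrite addrA. Qed.
Fact baddC : commutative badd.
Proof. by move=> f g; apply: bop_ext => x y /=; rewrite addrC. Qed.
Fact badd0 : left_id bzero badd.
Proof. by move=> f; apply: bop_ext => x y /=; rewrite add0r. Qed.
Fact baddN : left_inverse bzero bopp badd.
Proof. by move=> f; apply: bop_ext => x y /=; rewrite mulN1r addNr. Qed.
HB.instance Definition _ := GRing.isZmodule.Build bop baddA baddC badd0 baddN.

Fact bmulA : associative bmul.
Proof. by move=> f g k; apply: bop_ext => x y; rewrite bmulE; exact: esym (bmulE f g x (op k y)). Qed.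
Fact bmul1l : left_id bone bmul.
Proof. by move=> f; apply: bop_ext => x y /=; rewrite opE. Qed.
Fact bmul1r : right_id bone bmul.
Proof. by move=> f; apply: bop_ext => x y; rewrite bmulE /= adjE. Qed.
Fact bmulDl : left_distributive bmul badd.
Proof. by move=> f g k; apply: bop_ext. Qed.
Fact bmulDr : right_distributive bmul badd.
Proof.
by move=> f g k; apply: bop_ext => x y; rewrite bmulE /=; congr (_ + _);
   exact: esym (bmulE _ _ _ _).
Qed.
Fact bone_neq0 : bone != bzero :> bop.
Proof.
apply/eqP => /(congr1 (fun f : bop => f (vac H) (vac H))) /=.
by rewrite ip_vac => /eqP; rewrite oner_eq0.
Qed.
HB.instance Definition _ := GRing.Zmodule_isNzRing.Build bop
  bmulA bmul1l bmul1r bmulDl bmulDr bone_neq0.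

Fact bscaleA c c' f : bscale c (bscale c' f) = bscale (c * c') f.
Proof. by apply: bop_ext => x y /=; rewrite mulrA. Qed.
Fact bscale1 : left_id 1 bscale.
Proof. by move=> f; apply: bop_ext => x y /=; rewrite mul1r. Qed.
Fact bscaleDr : right_distributive bscale +%R.
Proof. by move=> c f g; apply: bop_ext => x y /=; rewrite mulrDr. Qed.
Fact bscaleDl f : {morph bscale^~ f : a b / a + b}.
Proof. by move=> a b; apply: bop_ext => x y /=; rewrite mulrDl. Qed.
HB.instance Definition _ := GRing.Zmodule_isLmodule.Build C bop
  bscaleA bscale1 bscaleDr bscaleDl.

Fact bscaleAl c f g : c *: (f * g) = c *: f * g.
Proof. by apply: bop_ext. Qed.
HB.instance Definition _ := GRing.Lmodule_isLalgebra.Build C bop bscaleAl.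
Fact bscaleAr c f g : c *: (f * g) = f * (c *: g).
Proof. by apply: bop_ext => x y; rewrite [RHS]bmulE; congr (_ * _); exact: bmulE. Qed.
HB.instance Definition _ := GRing.Lalgebra_isAlgebra.Build C bop bscaleAr.

Fact bstarD f g : bstar (f + g) = bstar f + bstar g.
Proof. by apply: bop_ext => x y /=; rewrite rmorphD. Qed.
Fact bstarZ c f : bstar (c *: f) = c^* *: bstar f.
Proof. by apply: bop_ext => x y /=; rewrite rmorphM. Qed.
Fact bstarM f g : bstar (f * g) = bstar g * bstar f.
Proof.
apply: bop_ext => x y; rewrite /=; congr (_^*).
by rewrite -[RHS]opE ip_herm opE /= conjCK.
Qed.
Fact bstarK f : bstar (bstar f) = f.
Proof. by apply: bop_ext => x y /=; rewrite conjCK. Qed.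

Fact bnorm_eq0 f : bnorm f = 0 -> f = 0.
Proof.
move=> f0; apply: bop_ext => x y; apply: eq0_normc; apply/eqP.
by rewrite eq_le normc_ge0 andbT; have := bnorm_bound f x y; rewrite f0 mul0r.
Qed.
Fact bnormD f g : bnorm (f + g) <= bnorm f + bnorm g.
Proof.
apply: bnorm_le; first by rewrite addr_ge0 ?bnorm_ge0.
move=> x y; apply: le_trans (le_normcD _ _) _.
by rewrite mulrDl lerD ?bnorm_bound.
Qed.
Lemma bnormZ_le c f : bnorm (c *: f) <= normc c * bnorm f.
Proof.
apply: bnorm_le; first by rewrite mulr_ge0 ?bnorm_ge0 ?normc_ge0.
by move=> x y; rewrite normcM -mulrA ler_wpM2l ?normc_ge0 ?bnorm_bound.
Qed.
Fact bnormZ c f : bnorm (c *: f) = normc c * bnorm f.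
Proof.
apply/eqP; rewrite eq_le bnormZ_le /=; have [->|c0] := eqVneq c 0.
  by rewrite normc0 mul0r bnorm_ge0.
have cp : 0 < normc c.
  by rewrite lt_neqAle normc_ge0 andbT eq_sym; apply: contra c0 => /eqP/eq0_normc->.
have := bnormZ_le c^-1 (c *: f); rewrite scalerA mulVf // scale1r normcV.
by rewrite ler_pdivlMl.
Qed.
Fact bnormM f g : bnorm (f * g) <= bnorm f * bnorm g.
Proof.
apply: bnorm_le; first by rewrite mulr_ge0 ?bnorm_ge0.
move=> x y; apply: le_trans (bnorm_bound f x (op g y)) _.
rewrite -mulrA ler_wpM2l ?bnorm_ge0 // mulrCA ler_wpM2l ?vnorm_ge0 //.
exact: op_bound.
Qed.
Lemma bnorm_star_le f : bnorm (bstar f) <= bnorm f.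
Proof.
apply: bnorm_le; first exact: bnorm_ge0.
by move=> x y; rewrite normc_conj mulrC (mulrC (vnorm x)) mulrC bnorm_bound.
Qed.
Fact bnorm_cstar f : bnorm (bstar f * f) = bnorm f ^+ 2.
Proof.
apply/eqP; rewrite eq_le; apply/andP; split.
  apply: le_trans (bnormM _ _) _; rewrite expr2.
  by rewrite ler_wpM2r ?bnorm_ge0 ?bnorm_star_le.
rewrite -ler_sqrt ?bnorm_ge0 // sqrtr_sqr ger0_norm ?bnorm_ge0 //.
(* [s] is a bound for [f]: the square of the norm of f y is the form of [bstar f * f] at y, y. *)
set s := Num.sqrt _; have s0 : 0 <= s := sqrtr_ge0 _.
apply: bnorm_le => // x y; rewrite -opE.
apply: le_trans (cauchy_schwarz _ _) _; rewrite mulrCA ler_wpM2l ?vnorm_ge0 //.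
rewrite -(@ler_pXn2r _ 2) // ?nnegrE ?mulr_ge0 ?vnorm_ge0 // exprMn.
rewrite (@sqr_sqrtr _ (bnorm (bstar f * f))) ?bnorm_ge0 //.
have := bnorm_bound (bstar f * f) y y.
rewrite -expr2 [X in normc X](_ : _ = (vnorm (op f y) ^+ 2)%:C).
  by rewrite normc_real ?exprn_ge0 ?vnorm_ge0.
by rewrite /= -opE -ip_herm ip_self.
Qed.

(** The pointwise limits [T] of the operators and [T'] of their adjoints represent one limit form,
    so it is adjointable. The Cauchy estimate passes to that limit ([near]) and gives both its
    boundedness and convergence in norm. *)
Fact bnorm_complete (u : nat -> bop) :
  (forall e : R, 0 < e -> exists N : nat, forall m n : nat,
     (N <= m)%N -> (N <= n)%N -> bnorm (u m - u n) < e) ->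
  exists l : bop, forall e : R, 0 < e -> exists N : nat, forall n : nat,
     (N <= n)%N -> bnorm (u n - l) < e.
Proof.
move=> uC.
have opB f g y : vnorm (vsub (op f y) (op g y)) <= bnorm (f - g) * vnorm y.
  apply: (@op_bound_of (f - g) _ (fun z => vsub (op f z) (op g z))).
  - exact: bnorm_ge0.
  - exact: bnorm_bound.
  - by move=> x z; rewrite ipBr !opE /= mulN1r.
have bstarB f g : bstar f - bstar g = bstar (f - g).
  by apply: bop_ext => x y /=; rewrite rmorphD rmorphM rmorphN rmorph1.
have limop (v : nat -> bop) : (forall e : R, 0 < e -> exists N : nat, forall m n : nat,
     (N <= m)%N -> (N <= n)%N -> bnorm (v m - v n) < e) ->
   exists T, forall y, vconverges (fun n => op (v n) y) (T y).
  move=> vC; suff /choice[T TP] : forall y, exists z, vconverges (fun n => op (v n) y) z.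
    by exists T.
  move=> y; apply: hspace_complete => e e0.
  have y0 : 0 < vnorm y + 1 by rewrite ltr_wpDl ?vnorm_ge0.
  have [N NP] := vC _ (divr_gt0 e0 y0); exists N => m n mN nN.
  apply: le_lt_trans (opB _ _ _) _; have := NP m n mN nN.
  rewrite ltr_pdivlMr //; apply: le_lt_trans.
  by rewrite ler_wpM2l ?bnorm_ge0 // lerDl.
have [T TP] := limop u uC.
have [T' T'P] : exists T', forall y, vconverges (fun n => op (bstar (u n)) y) (T' y).
  apply: (limop (fun n => bstar (u n))) => e /uC[N NP]; exists N => m n mN nN.
  by rewrite bstarB; apply: le_lt_trans (bnorm_star_le _) (NP m n mN nN).
have lim1 x y : converges (fun n => u n x y) (ip x (T y)).
  move=> e e0; have x0 : 0 < vnorm x + 1 by rewrite ltr_wpDl ?vnorm_ge0.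
  have [N NP] := TP y _ (divr_gt0 e0 x0); exists N => n /NP.
  rewrite ltr_pdivlMr // => h; rewrite -opE -ipBr.
  apply: le_lt_trans (cauchy_schwarz _ _) _; apply: le_lt_trans h.
  by rewrite mulrC ler_wpM2l ?vnorm_ge0 // lerDl.
have lim2 x y : converges (fun n => u n x y) (ip (T' x) y).
  move=> e e0; have y0 : 0 < vnorm y + 1 by rewrite ltr_wpDl ?vnorm_ge0.
  have [N NP] := T'P x _ (divr_gt0 e0 y0); exists N => n /NP.
  rewrite ltr_pdivlMr // => h.
  have -> : u n x y = ip (op (bstar (u n)) x) y by rewrite ip_herm opE /= conjCK.
  rewrite -ipBl; apply: le_lt_trans (cauchy_schwarz _ _) _; apply: le_lt_trans h.
  by rewrite ler_wpM2l ?vnorm_ge0 // lerDl.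
have near e N : 0 <= e -> (forall m n, (N <= m)%N -> (N <= n)%N -> bnorm (u m - u n) < e) ->
    forall n, (N <= n)%N -> bound (fun x y => u n x y - ip x (T y)) e.
  move=> e0 NP n nN x y; apply/ler_addgt0Pr => d d0.
  have [N' N'P] := lim1 x y _ d0; pose m := maxn N N'.
  have -> : u n x y - ip x (T y) = (u n x y - u m x y) + (u m x y - ip x (T y)) by ring.
  apply: le_trans (le_normcD _ _) _; apply: lerD; last by rewrite ltW ?N'P ?leq_maxr.
  have -> : u n x y - u m x y = (u n - u m) x y by rewrite /= mulN1r.
  apply: le_trans (bnorm_bound _ _ _) _.
  by rewrite ler_wpM2r ?mulr_ge0 ?vnorm_ge0 // ltW ?NP ?leq_maxl.
have lP : adjointable (fun x y => ip x (T y)) /\ bounded (fun x y => ip x (T y)).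
  split.
    exists T, T' => x y; split=> //; exact: converges_unique (lim1 x y) (lim2 x y).
  have [N NP] := uC _ ltr01; exists (1 + bnorm (u N)).
    by rewrite addr_ge0 ?bnorm_ge0.
  move=> x y; have -> : ip x (T y) = - (u N x y - ip x (T y)) + u N x y by ring.
  apply: le_trans (le_normcD _ _) _; rewrite normcN mulrDl lerD ?bnorm_bound //.
  exact: (near _ _ ler01 NP).
exists (Bop lP) => e e0; have e2 : 0 < e / 2 by rewrite divr_gt0.
have [N NP] := uC _ e2; exists N => n nN.
apply: (@le_lt_trans _ _ (e / 2)); last by lra.
apply: bnorm_le; first exact: ltW.
move=> x y; rewrite /= mulN1r; exact: (near _ _ (ltW e2) NP).
Qed.

HB.instance Definition _ := isCStarAlgebra.Build R bop
  bstarD bstarZ bstarM bstarK bnorm_eq0 bnormD bnormZ bnormM bnorm_cstar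
  bnorm_complete.

Lemma form_sum (I : Type) (r : seq I) (F : I -> bop) x y :
  (\sum_(i <- r) F i : bop) x y = \sum_(i <- r) F i x y.
Proof. by elim: r => [|i r IH]; rewrite ?big_nil // !big_cons /= IH. Qed.

End BoundedOperators.

(** * The GNS model of a moment functional *)

Section GNS.
Variables (R : realType) (n : nat).
Local Notation C := (complex R).
Local Notation letter := ('I_n * 'I_n)%type.
Variable mu : seq letter -> seq letter -> C.
Implicit Types (w : seq letter) (s t : seq (C * seq letter)) (x y : 'I_n).
Hypotheses
  (mu_ge0 : forall s, 0 <= \sum_(p <- s) \sum_(q <- s) p.1^* * q.1 * mu p.2 q.2)
  (mu_herm : forall w w', mu w' w = (mu w w')^*)
  (mu_nil : mu [::] [::] = 1)
  (mu_adj : forall p w w', mu (p :: w) w' = mu w (p :: w'))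
  (mu_row : forall w w' x y y',
     mu w [:: (x, y), (x, y') & w'] = (y == y')%:R * mu w ((x, y) :: w'))
  (mu_col : forall w w' x x' y,
     mu w [:: (x, y), (x', y) & w'] = (x == x')%:R * mu w ((x, y) :: w'))
  (mu_sumx : forall w w' y, \sum_x mu w ((x, y) :: w') = mu w w')
  (mu_sumy : forall w w' x, \sum_y mu w ((x, y) :: w') = mu w w').

(** Vectors of [words] are unreduced formal combinations, kept as lists of coefficients and words;
    addition is concatenation. *)
Definition fscale (c : C) s := [seq (c * p.1, p.2) | p <- s].
Definition fip s t : C := \sum_(p <- s) \sum_(q <- t) p.1^* * q.1 * mu p.2 q.2.

Fact fipDr s t t' : fip s (t ++ t') = fip s t + fip s t'.
Proof. by rewrite /fip -big_split; apply: eq_bigr => p _; rewrite big_cat. Qed.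

Fact fipZr c s t : fip s (fscale c t) = c * fip s t.
Proof.
rewrite /fip mulr_sumr; apply: eq_bigr => p _.
by rewrite big_map mulr_sumr; apply: eq_bigr => q _ /=; ring.
Qed.

Fact fip_herm s t : fip t s = (fip s t)^*.
Proof.
rewrite /fip rmorph_sum exchange_big; apply: eq_bigr => p _.
rewrite rmorph_sum; apply: eq_bigr => q _.
by rewrite !rmorphM /= conjCK -mu_herm; ring.
Qed.

Fact fip_vac : fip [:: (1, [::])] [:: (1, [::])] = 1.
Proof. by rewrite /fip !big_seq1 /= mu_nil rmorph1 !mulr1. Qed.

Definition words : prehilbert R :=
  PreHilbert fipDr fipZr fip_herm mu_ge0 fip_vac.

Definition gns : hilbert R := Hilbert (@completion_complete R words).

Definition lmul x y s : words := [seq (p.1, (x, y) :: p.2) | p <- s].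

Lemma fip_lmulr x y s t : fip s (lmul x y t) =
  \sum_(p <- s) \sum_(q <- t) p.1^* * q.1 * mu p.2 ((x, y) :: q.2).
Proof. by apply: eq_bigr => p _; rewrite big_map. Qed.

Lemma lmul_sym x y s t : fip (lmul x y s) t = fip s (lmul x y t).
Proof.
rewrite fip_lmulr /fip big_map; apply: eq_bigr => p _; apply: eq_bigr => q _ /=.
by rewrite mu_adj.
Qed.

Lemma fip_lmul2 x y x' y' s t : fip s (lmul x y (lmul x' y' t)) =
  \sum_(p <- s) \sum_(q <- t) p.1^* * q.1 * mu p.2 [:: (x, y), (x', y') & q.2].
Proof. by rewrite fip_lmulr; apply: eq_bigr => p _; rewrite big_map. Qed.

Lemma lmul_row x y y' s t :
  fip s (lmul x y (lmul x y' t)) = (y == y')%:R * fip s (lmul x y t).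
Proof.
rewrite fip_lmul2 fip_lmulr mulr_sumr; apply: eq_bigr => p _.
by rewrite mulr_sumr; apply: eq_bigr => q _; rewrite mu_row mulrCA.
Qed.

Lemma lmul_col x x' y s t :
  fip s (lmul x y (lmul x' y t)) = (x == x')%:R * fip s (lmul x y t).
Proof.
rewrite fip_lmul2 fip_lmulr mulr_sumr; apply: eq_bigr => p _.
by rewrite mulr_sumr; apply: eq_bigr => q _; rewrite mu_col mulrCA.
Qed.

Lemma lmul_sumx y s t : \sum_x fip s (lmul x y t) = fip s t.
Proof.
under eq_bigr => x _ do rewrite fip_lmulr.
rewrite exchange_big; apply: eq_bigr => p _.
rewrite exchange_big; apply: eq_bigr => q _.
by rewrite -mulr_sumr mu_sumx.
Qed.

Lemma lmul_sumy x s t : \sum_y fip s (lmul x y t) = fip s t.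
Proof.
under eq_bigr => y _ do rewrite fip_lmulr.
rewrite exchange_big; apply: eq_bigr => p _.
rewrite exchange_big; apply: eq_bigr => q _.
by rewrite -mulr_sumr mu_sumy.
Qed.

(** The hypothesis holds when [b] is the image of [a] under a symmetric idempotent. Hence letters do
    not increase norms: they extend to the completion and are bounded there. *)
Lemma contraction (H : prehilbert R) (a b : H) : ip b b = ip a b ->
  vnorm b <= vnorm a.
Proof.
move=> e; have [b0|b0] := ltrP 0 (vnorm b); last first.
  exact: le_trans b0 (vnorm_ge0 a).
rewrite -(ler_pM2r b0) -expr2; have := cauchy_schwarz a b.
by rewrite -e ip_self normc_real // exprn_ge0 ?vnorm_ge0.
Qed.

Lemma lmul_cauchy x y (u : cauchyseq words) : vcauchy (fun k => lmul x y (u k)).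
Proof.
move=> e /(cseqP u)[N NP]; exists N => k l kN lN.
apply: le_lt_trans (NP k l kN lN).
have -> : vsub (lmul x y (u k)) (lmul x y (u l)) = lmul x y (vsub (u k) (u l)).
  by rewrite /lmul map_cat -!map_comp /vsub /= /fscale -map_comp.
by apply: contraction; rewrite [LHS]lmul_sym [LHS]lmul_row eqxx mul1r.
Qed.

Definition clmul x y (u : gns) : gns := CauchySeq (lmul_cauchy x y u).

Lemma clmul_sym x y (a b : gns) : ip (clmul x y a) b = ip a (clmul x y b).
Proof.
apply: cipE; apply: converges_ext (cipP a (clmul x y b)) => k.
exact: esym (lmul_sym _ _ _ _).
Qed.

Lemma clmul_row x y y' (a b : gns) :
  ip a (clmul x y (clmul x y' b)) = (y == y')%:R * ip a (clmul x y b).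
Proof.
apply: cipE; apply: converges_ext (convergesZ _ (cipP a (clmul x y b))) => k.
exact: esym (lmul_row _ _ _ _ _).
Qed.

Lemma clmul_col x x' y (a b : gns) :
  ip a (clmul x y (clmul x' y b)) = (x == x')%:R * ip a (clmul x y b).
Proof.
apply: cipE; apply: converges_ext (convergesZ _ (cipP a (clmul x y b))) => k.
exact: esym (lmul_col _ _ _ _ _).
Qed.

Lemma converges_sum (I : Type) (r : seq I) (z : I -> nat -> C) (c : I -> C) :
  (forall i, converges (z i) (c i)) ->
  converges (fun k => \sum_(i <- r) z i k) (\sum_(i <- r) c i).
Proof.
move=> zc; elim: r => [|i r IH].
  by rewrite big_nil; apply: converges_ext (converges_cst 0) => k; rewrite big_nil.
rewrite big_cons; apply: converges_ext (convergesD (zc i) IH) => k.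
by rewrite big_cons.
Qed.

Lemma clmul_sumx y (a b : gns) : \sum_x ip a (clmul x y b) = ip a b.
Proof.
apply/esym/cipE; apply: converges_ext (converges_sum _ (fun x => cipP a (clmul x y b))).
by move=> k; apply: lmul_sumx.
Qed.

Lemma clmul_sumy x (a b : gns) : \sum_y ip a (clmul x y b) = ip a b.
Proof.
apply/esym/cipE; apply: converges_ext (converges_sum _ (fun y => cipP a (clmul x y b))).
by move=> k; apply: lmul_sumy.
Qed.

Fact gens_form x y : adjointable (fun a b : gns => ip a (clmul x y b)) /\
  bounded (fun a b : gns => ip a (clmul x y b)).
Proof.
split; first by exists (clmul x y), (clmul x y) => a b; rewrite clmul_sym.
exists 1 => // a b; rewrite mul1r; apply: le_trans (cauchy_schwarz _ _) _.
rewrite ler_wpM2l ?vnorm_ge0 //; apply: contraction.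
by rewrite clmul_sym clmul_row eqxx mul1r.
Qed.
Definition gen x y : bop gns := Bop (gens_form x y).

Lemma gen_mulr x y (f : bop gns) a b : (f * gen x y) a b = f a (clmul x y b).
Proof. by rewrite [LHS]bmulE -[RHS]adjE. Qed.

Lemma gen_mull x y (f : bop gns) a b : (gen x y * f) a b = f (clmul x y a) b.
Proof. by rewrite -[RHS]opE clmul_sym. Qed.

Definition gens : 'M[bop gns]_n := \matrix_(x, y) gen x y.

Lemma gens_magic : magic_unitary gens.
Proof.
split=> [x y|x y y' yy'|x x' y xx'|x|y].
- rewrite mxE; split; apply: bop_ext => a b.
    by rewrite gen_mulr; apply: etrans (clmul_row _ _ _ _ _) _; rewrite eqxx mul1r.
  by apply: etrans (clmul_sym _ _ _ _); apply/esym/ip_herm.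
- rewrite !mxE; apply: bop_ext => a b; rewrite gen_mulr.
  by apply: etrans (clmul_row _ _ _ _ _) _; rewrite (negbTE yy') mul0r.
- rewrite !mxE; apply: bop_ext => a b; rewrite gen_mulr.
  by apply: etrans (clmul_col _ _ _ _ _) _; rewrite (negbTE xx') mul0r.
- apply: bop_ext => a b; rewrite form_sum -[RHS](clmul_sumy x).
  by apply: eq_bigr => y _; rewrite mxE.
- apply: bop_ext => a b; rewrite form_sum -[RHS](clmul_sumx y).
  by apply: eq_bigr => x _; rewrite mxE.
Qed.

Definition vac_state (f : bop gns) : C := f (vac gns) (vac gns).

Lemma vac_state_word w :
  vac_state (\prod_(p <- w) gens p.1 p.2) = mu [::] w.
Proof.
(* Generalising the left vacuum to a word [w0] lets the letters of the product be absorbed on the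
   left one at a time, reversed by [mu_adj]. *)
suff gen_w w0 : (\prod_(p <- w) gens p.1 p.2 : bop gns)
    (ccst ([:: (1, w0)] : words)) (vac gns) = mu w0 w by exact: gen_w.
elim: w w0 => [|[x y] w IH] w0.
  rewrite big_nil; apply: etrans (cip_cst _ _) _.
  by rewrite /= /fip !big_seq1 /= rmorph1 !mul1r.
have cE : clmul x y (ccst ([:: (1, w0)] : words)) =
    ccst ([:: (1, (x, y) :: w0)] : words) by congr CauchySeq.
by rewrite big_cons mxE gen_mull cE IH mu_adj.
Qed.

Theorem magic_model : exists (B : cstarAlgType R) (v : 'M[B]_n) (om : B -> C),
  [/\ magic_unitary v, forall c a b, om (c *: a + b) = c * om a + om b
    & forall w, om (\prod_(p <- w) v p.1 p.2) = mu [::] w].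
Proof.
exists (bop gns), gens, vac_state; split=> //; first exact: gens_magic.
exact: vac_state_word.
Qed.

End GNS.

(** * The Haar state *)

Section MagicWords.
Variables (R : realType) (n : nat).
Local Notation X := 'I_n.
Implicit Types (A : cstarAlgType R) (I J L : seq X).

Definition mword A (u : 'M[A]_n) I J : A := \prod_(p <- zip I J) u p.1 p.2.

Lemma mword_cat A (u : 'M[A]_n) I I' J J' : size I = size J ->
  mword u (I ++ I') (J ++ J') = mword u I J * mword u I' J'.
Proof. by move=> IJ; rewrite /mword zip_cat // big_cat. Qed.

Lemma mword_cons A (u : 'M[A]_n) x I y J :
  mword u (x :: I) (y :: J) = u x y * mword u I J.
Proof. by rewrite /mword /= big_cons. Qed.

Lemma mword_rmorph A (B : cstarAlgType R) (u : 'M[A]_n) (v : 'M[B]_n) (f : {lrmorphism A -> B}) I J :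
  (forall i j, f (u i j) = v i j) -> f (mword u I J) = mword v I J.
Proof.
by move=> fu; rewrite /mword rmorph_prod; apply: eq_bigr => p _; exact: fu.
Qed.

(** An inserted point is handled by the row sums equal to 1; a doubled point by idempotence when the
    two row letters agree and by orthogonality within a column when they differ. *)
Lemma mword_planar A (u : 'M[A]_n) (x0 : X) k f : magic_unitary u ->
  planar x0 k f -> forall I, size I = k ->
  lsum k (fun L => f L *: mword u I L) = (f I)%:A.
Proof.
move=> [up urow ucol usumr usumc].
elim=> {k f} [|k s f sk fP IH|k s f sk fP IH|k c f g fP IHf gP IHg|k|
  k f g fg fP IH] I Ik.
- by rewrite lsum0 (size0nil Ik) /mword big_nil.
- have [I1 [I2' [-> I1s I2s]]] := @split_size _ s (k - s).+1 I ltac:(lia).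
  case: I2' I2s => [//|x I2] /= [I2s].
  have -> : ins s f (I1 ++ x :: I2) = f (I1 ++ I2).
    by rewrite /ins -I1s -[X in del X _]addn0 del_catr /del /= drop0.
  rewrite -IH ?size_cat ?I1s ?I2s; last by lia.
  have -> : k.+1 = (s + (k - s).+1)%N by lia.
  have -> : lsum k (fun L => f L *: mword u (I1 ++ I2) L) =
      lsum (s + (k - s)) (fun L => f L *: mword u (I1 ++ I2) L).
    by congr lsum; lia.
  rewrite !lsum_cat; apply: eq_lsum => L1 L1s; rewrite lsumS -lsum_exchange.
  apply: eq_lsum => L2 _; rewrite mword_cat ?I1s //.
  rewrite -[mword u I2 L2]mul1r -(usumr x) mulr_suml mulr_sumr scaler_sumr.
  apply: eq_bigr => y _; rewrite mword_cat ?I1s // mword_cons; congr (_ *: _).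
  by rewrite /ins -L1s -[X in del X _]addn0 del_catr /del /= drop0.
- have [I1 [I2' [-> I1s I2s]]] := @split_size _ s (k - s).+1 I ltac:(lia).
  case: I2' I2s => [//|x [|x' I2]] /= [I2s]; first lia.
  have fE (L1 L2 : seq X) y y' : size L1 = s ->
      fork x0 s f (L1 ++ [:: y, y' & L2]) = (y == y')%:R * f (L1 ++ y :: L2).
    move=> L1s; rewrite /fork !nth_cat L1s ltnn subnn ltnNge leqnSn subSnn /=.
    by rewrite -L1s -(addn1 (size L1)) del_catr /del /= drop0.
  rewrite fE //.
  have -> : ((x == x')%:R * f (I1 ++ x :: I2))%:A = (x == x')%:R *: (f (I1 ++ x :: I2))%:A :> A.
    by rewrite scalerA.
  rewrite -IH ?size_cat /= ?I1s; last by lia.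
  have -> : k.+1 = (s + (k - s.+1).+2)%N by lia.
  have -> : lsum k (fun L => f L *: mword u (I1 ++ x :: I2) L) =
      lsum (s + (k - s.+1).+1) (fun L => f L *: mword u (I1 ++ x :: I2) L).
    by congr lsum; lia.
  rewrite !lsum_cat lsum_scaler; apply: eq_lsum => L1 L1s.
  rewrite !lsumS scaler_sumr; apply: eq_bigr => y _.
  rewrite lsumS -lsum_exchange lsum_scaler; apply: eq_lsum => L2 _.
  rewrite (bigD1 y) //= [X in _ + X]big1 => [|y' /negbTE y'y].
    rewrite addr0 fE // eqxx mul1r !mword_cat ?I1s ?L1s //.
    rewrite !mword_cons scalerA mulrC -scalerA; congr (_ *: _).
    rewrite [X in _ * X]mulrA; have [<-|xx'] := eqVneq x x'.
      by have [-> _] := up x y; rewrite scale1r.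
    by rewrite ucol // mul0r mulr0 scale0r.
  by rewrite fE // eq_sym y'y mul0r scale0r.
- rewrite (eq_lsum (G := fun L => c *: (f L *: mword u I L) + g L *: mword u I L)).
    rewrite lsumD -lsum_scaler IHf // IHg //.
    by rewrite scalerDl scalerA.
  by move=> L _; rewrite scalerDl scalerA.
- rewrite scale0r /lsum big1 // => L _.
  by rewrite scale0r.
- rewrite -fg // -IH //; apply: eq_lsum => L Lk; by rewrite fg.
Qed.

End MagicWords.

Section HaarState.
Variables (R : realType) (m : nat) (A T : cstarAlgType R) (u : 'M[A]_m.+4)
  (tens : A -> A -> T) (Delta : {lrmorphism A -> T}) (h : {scalar A}).
Local Notation X := 'I_m.+4.
Implicit Types (I J L : seq X).
Hypotheses (uA : is_quantum_permutation_algebra u) (tensT : is_cstar_tensor tens)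
  (DeltaE : is_comultiplication u tens Delta) (hh : is_haar_state tens Delta h).

Lemma linear_map_sum (V W : lmodType (complex R)) (f : V -> W) (K : Type)
    (r : seq K) (F : K -> V) :
  linear f -> f (\sum_(i <- r) F i) = \sum_(i <- r) f (F i).
Proof.
move=> fl; have f0 : f 0 = 0.
  by have := fl (-1) 0 0; rewrite scaleN1r oppr0 addr0 scaleN1r addNr.
elim: r => [|i r IH]; first by rewrite !big_nil.
by rewrite !big_cons -IH -{1}[F i]scale1r fl scale1r.
Qed.

Lemma Delta_mword k I J : size I = k -> size J = k ->
  Delta (mword u I J) = lsum k (fun L => tens (mword u I L) (mword u L J)).
Proof.
have [[tl tr] [t1 tM] _ _ _] := tensT; have [_ Du] := DeltaE.
elim: k I J => [|k IH] [|x I] [|y J] //= Ik Jk.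
  by rewrite lsum0 /mword big_nil rmorph1 t1.
case: Ik Jk => Ik [Jk].
rewrite mword_cons rmorphM /= Du IH // mulr_suml lsumS; apply: eq_bigr => z _.
rewrite /lsum mulr_sumr; apply: eq_bigr => L _.
by rewrite tM !mword_cons.
Qed.

(** The left slice applied to the expansion of [Delta (mword u I J)] gives the relation P u_k = P as
    an identity in [A]. *)
Lemma haar_left k I J : size I = k -> size J = k ->
  lsum k (fun L => h (mword u I L) *: mword u L J) = (h (mword u I J))%:A.
Proof.
move=> Ik Jk; have [_ [S [[_ St] SD]] _] := hh.
rewrite -SD (Delta_mword Ik Jk) /lsum linear_sum /=.
by apply: eq_bigr => L _; rewrite St.
Qed.

Lemma wproj_model : exists (B : cstarAlgType R) (v : 'M[B]_m.+4)
    (om : B -> complex R),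
  [/\ magic_unitary v, forall c a b, om (c *: a + b) = c * om a + om b
    & forall k I J, size I = k -> size J = k ->
        om (mword v I J) = wproj R k I J].
Proof.
pose Q k := @wproj R k m.
have Q_planar k J : planar ord0 k (Q k ^~ J) := @wproj_planar R k m J.
have Q_sym k I J : Q k I J = Q k J I := @wproj_sym R k m I J.
have Q_conj k I J : (Q k I J)^* = Q k I J := @wproj_conj R k m I J.
have Q_repr k f I : planar ord0 k f -> size I = k ->
  lsum k (fun J => Q k I J * f J) = f I := @wproj_repr R k m f I.
have [B [v [om [vM omL omE]]]] := magic_model (moment_ge0 Q_planar Q_sym Q_conj Q_repr)
  (moment_herm Q_planar Q_sym Q_conj Q_repr) (moment_nil Q_repr)
  (moment_adj Q) (moment_row Q_planar Q_sym Q_repr)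
  (moment_col Q_planar Q_sym Q_repr) (moment_sumx Q_planar Q_sym Q_repr)
  (moment_sumy Q_planar Q_sym Q_repr).
exists B, v, om; split=> // k I J Ik Jk; rewrite omE /moment /=.
by rewrite size_zip Ik Jk minnn add0n unzip1_zip ?unzip2_zip ?Ik ?Jk.
Qed.

Lemma haar_wproj k I J : size I = k -> size J = k ->
  h (mword u I J) = wproj R k I J.
Proof.
move=> Ik Jk; have [uM uU] := uA.
have [B [v [om [vM omL omE]]]] := wproj_model.
have [[f [_ fu]] _] := uU B v vM.
have om_sum (K : Type) (r : seq K) (F : K -> B) :
    om (\sum_(i <- r) F i) = \sum_(i <- r) om (F i).
  exact: (@linear_map_sum B (complex R)^o om).
have omZ c a : om (c *: a) = c * om a.
  have om0 : om 0 = 0.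
    by have := omL (-1) 0 0; rewrite scaleN1r oppr0 addr0 mulN1r addNr.
  by rewrite -[c *: a]addr0 omL om0 addr0.
(* Evaluating the invariance of h in the model shows that h fixes wproj from the
   left; the universal relations alone show that it fixes wproj from the right. *)
have right : lsum k (fun L => h (mword u I L) * wproj R k L J) = h (mword u I J).
  have /(congr1 (fun a => om (f a))) := haar_left Ik Jk.
  rewrite linearZ /= rmorph1 omZ.
  have -> : om 1 = 1.
    have := omE 0 [::] [::] erefl erefl; rewrite /mword big_nil => ->.
    have := @wproj_repr R 0 m (fun=> 1) [::] (planar_one _ _) erefl.
    by rewrite lsum0 mulr1.
  rewrite mulr1 => <-; rewrite /lsum linear_sum om_sum; apply: eq_bigr => L _.
  by rewrite linearZ /= omZ (mword_rmorph _ _ fu) (omE k) ?size_tuple.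
have /(congr1 h) := mword_planar uM (@wproj_planar R k m J) Ik.
have [[h1 _] _ _] := hh; rewrite linearZ /= h1 mulr1 => <-.
rewrite -right /lsum linear_sum; apply: eq_bigr => L _.
by rewrite linearZ /= mulrC.
Qed.

End HaarState.

Theorem theorem2p1 (R : realType) (n k : nat) (A T : cstarAlgType R)
    (u : 'M[A]_n) (tens : A -> A -> T) (Delta : {lrmorphism A -> T})
    (h : {scalar A}) :
  (4 <= n)%N -> (1 <= k)%N ->
  is_quantum_permutation_algebra u ->
  is_min_tensor tens ->
  is_comultiplication u tens Delta ->
  is_haar_state tens Delta h ->
  gram R k n \in unitmx /\
  forall i j : {ffun 'I_k -> 'I_n},
    h (\prod_(t < k) u (i t) (j t)) =
    \sum_(p : NC k) \sum_(q : NC k)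
       pdelta R p i * pdelta R q j * weingarten R n p q.
Proof.
(* Writing [n] as [m.+4] provides four letters for the Pauli matrices and the default letter
   [ord0]. *)
case: n u => [|[|[|[|m]]]] // u _ _ uA [tensT _] DeltaE hh.
split=> [|i j]; first exact: gram_unit.
have -> : \prod_(t < k) u (i t) (j t) = mword u (codom i) (codom j).
  by rewrite /mword /codom /image_mem zip_map big_map
    [index_enum _]unlock -enumT.
have sz (l : {ffun 'I_k -> 'I_m.+4}) : size (codom l) = k.
  by rewrite size_codom card_ord.
apply: etrans (haar_wproj uA tensT DeltaE hh (sz i) (sz j)) _.
by apply: eq_bigr => p _; apply: eq_bigr => q _; rewrite !pdelta_codom.
Qed.
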